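(* Let $M$ be a complex manifold of dimension $m$ endowed with a real analytic Kähler metric $g_M$ with Kähler form $\omega_M$. Assume that around every point of $M$ there are local holomorphic coordinates on a neighbourhood $U$ and a real analytic local Kähler potential $\psi: U\to\mathbb{R}$ with $\omega_M=\frac{\sqrt{-1}}{2}\partial\bar\partial\psi$ on $U$, such that the polarization of $\psi$ is a Nash function. Let $n\ge 1$ be an integer, and let $(S,\omega_S)$ be either $(\mathbb{CP}^n_b,\omega_{FS})$ for some $b>0$, or $(\mathbb{CH}^n_b,\omega_{hyp})$ for some $b<0$. Let $D\subset\mathbb{C}$ be a connected open subset and let $F:D\to S$ and $L:D\to M$ be holomorphic mappings such that $$F^*\omega_S=L^*\omega_M\quad\text{on } D.$$ Then $F$ is a constant map. Moreover, $(M,g_M)$ and $S$ (with the metric $g_{FS}$, respectively $g_{hyp}$) are not relatives.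
   Context: Nash function: a holomorphic function $f$ on an open set $D'\subset\mathbb{C}^k$ is a Nash function if for every $x_0\in D'$ there are an open neighbourhood $V$ of $x_0$ and a nonzero polynomial $P:\mathbb{C}^k\times\mathbb{C}\to\mathbb{C}$ with $P(x,f(x))=0$ for all $x\in V$. Polarization: if $\psi$ is real analytic on an open coordinate set $U\subset\mathbb{C}^m$, its polarization is the holomorphic function $\psi(z,w)$ on an open neighbourhood $W\subset U\times\mathrm{conj}(U)$ of the diagonal $\{(z,\bar z)\}$, where $\mathrm{conj}(U)=\{z:\bar z\in U\}$, such that $\psi(z,\bar z)=\psi(z)$. Complex space forms: $\mathbb{CP}^n_b$ ($b>0$) is complex projective space with the Fubini–Study metric $g_{FS}$ whose Kähler form on $U_0=\{Z_0\ne0\}$, in the affine coordinates $z_j=\frac{Z_j}{bZ_0}$, is $\omega_{FS}=\frac{\sqrt{-1}}{2b}\partial\bar\partial\log(1+b\sum_{j=1}^n|z_j|^2)$. $\mathbb{CH}^n_b$ ($b<0$) is the ball $\{z\in\mathbb{C}^n:\sum_j|z_j|^2<-1/b\}$ with the metric $g_{hyp}$ whose Kähler form is $\omega_{hyp}=\frac{\sqrt{-1}}{2b}\partial\bar\partial\log(1+b\sum_{j=1}^n|z_j|^2)$. Relatives: two Kähler manifolds are relatives if they have a common Kähler submanifold (of positive dimension) with their induced metrics, i.e. there are a complex manifold $S'$ of positive dimension and holomorphic immersions of $S'$ into both manifolds which induce the same Kähler metric on $S'$. *)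

(* Defs.v *)
From HB Require Import structures.
(* The notations of mpoly clash with those of mathcomp-analysis, and some of its
   names with those of ssrbool, hence the filter and the position. *)
From mathcomp Require Import -(notations) mpoly.
From mathcomp Require Import all_boot all_order all_algebra.
From mathcomp Require Import all_classical all_reals all_analysis.
From mathcomp Require Import complex.
Import Order.TTheory GRing.Theory Num.Theory.
Import numFieldNormedType.Exports.

Set Implicit Arguments.
Unset Strict Implicit.
Unset Printing Implicit Defensive.

Local Open Scope classical_set_scope.
Local Open Scope ring_scope.
Local Open Scope quotient_scope.

(* The topology, norm and derivative of mathcomp-analysis are attached to an
   arbitrary numFieldType K (seen as a space over itself); they are not found
   for the bare type R[i], hence this packed version of it. *)
Definition Cplx (R : realType) : numClosedFieldType := R[i].

Section ComplexCalculus.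
Variable R : realType.
Local Notation C := (Cplx R).

Definition reC (z : C) : R := complex.Re z.
Definition imC (z : C) : R := complex.Im z.
Definition ofR (x : R) : C := (x%:C)%C.
Definition abs2 (z : C) : R := reC z ^+ 2 + imC z ^+ 2.

Definition conjv m n (A : 'M[C]_(m, n)) : 'M[C]_(m, n) := map_mx Num.conj A.

Definition sqnorm n (z : 'rV[C]_n) : R := \sum_(j < n) abs2 (z 0 j).

(* [differentiable] is taken over the field C, that is, the differential is
   C-linear. *)
Definition holomorphic_on k (D : set 'rV[C]_k) (f : 'rV[C]_k -> C) : Prop :=
  forall z, D z -> differentiable f z.

Definition real_coords m (z : 'rV[C]_m) : 'rV[R]_(m + m) :=
  row_mx (map_mx reC z) (map_mx imC z).

Definition monomial_at k (a : 'I_k -> nat) (x : 'rV[R]_k) : R :=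
  \prod_(i < k) x 0 i ^+ a i.

(* Near each point of U, f is the sum of an absolutely convergent power series
   in the 2m real coordinates; partial sums run over the multi-indices all of
   whose entries are < N. *)
Definition real_analytic_on m (U : set 'rV[C]_m) (f : 'rV[C]_m -> R) : Prop :=
  forall z0, U z0 ->
  exists (r : R) (c : ('I_(m + m) -> nat) -> R),
    [/\ 0 < r,
        exists B : R, forall N : nat,
          \sum_(a : {ffun 'I_(m + m) -> 'I_N})
             `|c (fun i => a i)| * monomial_at (fun i => a i) (const_mx r) <= B
      & forall h : 'rV[C]_m,
          (forall i, `|real_coords h 0 i| < r) ->
          (fun N : nat => \sum_(a : {ffun 'I_(m + m) -> 'I_N})
             c (fun i => a i) * monomial_at (fun i => a i) (real_coords h))
            @ \oo --> f (z0 + h)].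

Definition real_deriv m (v : 'rV[C]_m) (f : 'rV[C]_m -> R) (z : 'rV[C]_m) : R :=
  derive1 (fun t : R => f (z + ofR t *: v)) 0.

Definition real_derivC m (v : 'rV[C]_m) (f : 'rV[C]_m -> C) (z : 'rV[C]_m) : C :=
  (real_deriv v (reC \o f) z +i* real_deriv v (imC \o f) z)%C.

Definition basis_vec m (j : 'I_m) : 'rV[C]_m := delta_mx 0 j.

(* With z_j = x_j + i y_j :
   d/dz_j = (d/dx_j - i d/dy_j)/2,  d/dzbar_j = (d/dx_j + i d/dy_j)/2. *)
Definition dz m (j : 'I_m) (f : 'rV[C]_m -> C) (z : 'rV[C]_m) : C :=
  (real_derivC (basis_vec j) f z
   - 'i * real_derivC ('i *: basis_vec j) f z) / 2%:R.

Definition dzbar m (j : 'I_m) (f : 'rV[C]_m -> C) (z : 'rV[C]_m) : C :=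
  (real_derivC (basis_vec j) f z
   + 'i * real_derivC ('i *: basis_vec j) f z) / 2%:R.

(* A real (1,1)-form (i/2) \sum_(j,k) h_jk dz_j /\ dzbar_k is represented by the
   Hermitian matrix h. The matrix of (i/2) ddbar psi is the following one. *)
Definition ddbar m (psi : 'rV[C]_m -> R) (z : 'rV[C]_m) : 'M[C]_m :=
  \matrix_(j, k) dz j (dzbar k (ofR \o psi)) z.

(* Matrix of the pullback of the form h by a holomorphic map whose Jacobian is
   J (in row-vector convention, J_jl = df_l/dz_j). *)
Definition pull_form k m (J : 'M[C]_(k, m)) (h : 'M[C]_m) : 'M[C]_k :=
  J *m h *m conjv J^T.

Definition nash_on k (D : set 'rV[C]_k) (f : 'rV[C]_k -> C) : Prop :=
  holomorphic_on D f /\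
  forall x0, D x0 ->
  exists (V : set 'rV[C]_k) (P : mpoly (k + 1) C),
    [/\ open V, V x0, V `<=` D, P != 0 &
        forall x, V x -> meval (fun i => row_mx x (f x)%:M 0 i) P = 0].

(* A pair (z, w) of C^m x C^m is the row vector row_mx z w. *)
Definition is_polarization m (U : set 'rV[C]_m) (psi : 'rV[C]_m -> R)
    (W : set 'rV[C]_(m + m)) (Psi : 'rV[C]_(m + m) -> C) : Prop :=
  [/\ open W,
      forall z w, W (row_mx z w) -> U z /\ U (conjv w),
      forall z, U z -> W (row_mx z (conjv z)),
      holomorphic_on W Psi
    & forall z, U z -> Psi (row_mx z (conjv z)) = ofR (psi z)].

Definition has_nash_polarization m (U : set 'rV[C]_m) (psi : 'rV[C]_m -> R) :=
  exists (W : set 'rV[C]_(m + m)) (Psi : 'rV[C]_(m + m) -> C),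
    is_polarization U psi W Psi /\ nash_on W Psi.

End ComplexCalculus.

Section Manifolds.
Variable R : realType.
Local Notation C := (Cplx R).

(* [cinv] is only meaningful on the image of [cdom] by [cmap]. *)
Record chart (T : Type) (m : nat) := Chart {
  cdom : set T;
  cmap : T -> 'rV[C]_m;
  cinv : 'rV[C]_m -> T }.

Definition cimage T m (c : chart T m) : set 'rV[C]_m := cmap c @` cdom c.

Definition is_chart (T : topologicalType) m (c : chart T m) : Prop :=
  [/\ open (cdom c),
      open (cimage c),
      forall p, cdom c p -> cinv c (cmap c p) = p,
      forall p, cdom c p -> {for p, continuous (cmap c)}
    & forall p, cdom c p -> {for cmap c p, continuous (cinv c)}].

Definition transition T m (c c' : chart T m) : 'rV[C]_m -> 'rV[C]_m :=
  cmap c' \o cinv c.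

Definition holo_transition T m (c c' : chart T m) : Prop :=
  forall p, cdom c p -> cdom c' p -> differentiable (transition c c') (cmap c p).

(* The structures below carry the data only; the axioms are in the predicates
   [is_complex_manifold] and [is_kahler]. *)
Record cmanifold (m : nat) := CManifold {
  carrier :> topologicalType;
  atlas_index : Type;
  atlas : atlas_index -> chart carrier m }.

Definition is_complex_manifold m (X : cmanifold m) : Prop :=
  [/\ hausdorff_space X,
      @second_countable X,
      forall i, is_chart (@atlas m X i),
      forall p : X, exists i, cdom (@atlas m X i) p
    & forall i j, holo_transition (@atlas m X i) (@atlas m X j)].

Definition is_holo_chart m (X : cmanifold m) (c : chart X m) : Prop :=
  is_chart c /\
  forall i, holo_transition c (@atlas m X i) /\ holo_transition (@atlas m X i) c.

(* [metric i z] is the matrix at z, in the i-th chart, of the Kaehler form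
   (i/2) \sum_(j,k) h_jk dz_j /\ dzbar_k (equivalently of the Hermitian metric
   \sum_(j,k) h_jk dz_j dzbar_k). *)
Record hmanifold (m : nat) := HManifold {
  underlying :> cmanifold m;
  metric : atlas_index underlying -> 'rV[C]_m -> 'M[C]_m }.

Definition is_kahler m (X : hmanifold m) : Prop :=
  [/\ is_complex_manifold X,
      forall (i : atlas_index X) z, cimage (atlas i) z ->
        (metric i z)^T = conjv (metric i z),
      forall (i : atlas_index X) z, cimage (atlas i) z ->
        forall u : 'rV[C]_m, u != 0 -> 0 < (pull_form u (metric i z)) 0 0,
      forall (i j : atlas_index X) (p : X),
        cdom (atlas i) p -> cdom (atlas j) p ->
        metric i (cmap (atlas i) p) =
        pull_form (jacobian (transition (atlas i) (atlas j)) (cmap (atlas i) p))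
                  (metric j (cmap (atlas j) p))
    & (* d omega = 0 *)
      forall (i : atlas_index X) z, cimage (atlas i) z ->
        forall j k l : 'I_m,
          dz l (fun w => metric i w j k) z = dz j (fun w => metric i w l k) z].

Definition real_analytic_metric m (X : hmanifold m) : Prop :=
  forall (i : atlas_index X) (j k : 'I_m),
    real_analytic_on (cimage (atlas i)) (fun z => reC (metric i z j k)) /\
    real_analytic_on (cimage (atlas i)) (fun z => imC (metric i z j k)).

(* omega_X = (i/2) ddbar psi on the domain of c, psi being read in c. *)
Definition is_kahler_potential m (X : hmanifold m) (c : chart X m)
    (psi : 'rV[C]_m -> R) : Prop :=
  forall (i : atlas_index X) (p : X), cdom c p -> cdom (atlas i) p ->
    ddbar psi (cmap c p) =
    pull_form (jacobian (transition c (atlas i)) (cmap c p))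
              (metric i (cmap (atlas i) p)).

Definition nash_kahler_potentials m (X : hmanifold m) : Prop :=
  forall p : X, exists (c : chart X m) (psi : 'rV[C]_m -> R),
    [/\ is_holo_chart c, cdom c p,
        real_analytic_on (cimage c) psi,
        is_kahler_potential c psi
      & has_nash_polarization (cimage c) psi].

(* D is open, F is only considered on D. *)
Definition holomorphic_curve m (X : cmanifold m) (D : set C) (F : C -> X) : Prop :=
  forall z, D z ->
    {for z, continuous F} /\
    forall i : atlas_index X, cdom (atlas i) (F z) ->
      differentiable (cmap (atlas i) \o F) z.

(* F^* omega_X = (i/2) g dz /\ dzbar at z, with g read in the i-th chart. *)
Definition curve_pullback m (X : hmanifold m) (F : C -> X)
    (i : atlas_index X) (z : C) : C :=
  (pull_form (derive1 (cmap (atlas i) \o F) z)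
             (metric i (cmap (atlas i) (F z)))) 0 0.

Definition same_curve_pullback m n (X : hmanifold m) (Y : hmanifold n)
    (D : set C) (F : C -> X) (G : C -> Y) : Prop :=
  forall z, D z -> forall (i : atlas_index X) (j : atlas_index Y),
    cdom (atlas i) (F z) -> cdom (atlas j) (G z) ->
    curve_pullback F i z = curve_pullback G j z.

Definition in_charts k m (X : cmanifold k) (Y : cmanifold m) (f : X -> Y)
    (i : atlas_index X) (j : atlas_index Y) : 'rV[C]_k -> 'rV[C]_m :=
  cmap (atlas j) \o f \o cinv (atlas i).

Definition holomorphic_immersion k m (X : cmanifold k) (Y : cmanifold m)
    (f : X -> Y) : Prop :=
  continuous f /\
  forall (p : X) (i : atlas_index X) (j : atlas_index Y),
    cdom (atlas i) p -> cdom (atlas j) (f p) ->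
    differentiable (in_charts f i j) (cmap (atlas i) p) /\
    row_free (jacobian (in_charts f i j) (cmap (atlas i) p)).

(* Matrix at p, in the i-th chart of X, of the metric induced by f : X -> Y,
   computed in the j-th chart of Y. *)
Definition induced_metric k m (X : cmanifold k) (Y : hmanifold m) (f : X -> Y)
    (i : atlas_index X) (j : atlas_index Y) (p : X) : 'M[C]_k :=
  pull_form (jacobian (in_charts f i j) (cmap (atlas i) p))
            (metric j (cmap (atlas j) (f p))).

Definition relatives m n (X : hmanifold m) (Y : hmanifold n) : Prop :=
  exists (k : nat) (Z : cmanifold k) (f : Z -> X) (g : Z -> Y),
    [/\ (0 < k)%N /\ is_complex_manifold Z, [set: Z] !=set0,
        holomorphic_immersion f, holomorphic_immersion g
      & forall (p : Z) (i : atlas_index Z) (j : atlas_index X) (l : atlas_index Y),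
          cdom (atlas i) p -> cdom (atlas j) (f p) -> cdom (atlas l) (g p) ->
          induced_metric f i j p = induced_metric g i l p].

End Manifolds.

Section ProjectiveSpace.
Variables (R : realType) (n : nat).
Local Notation C := (Cplx R).

Definition punctured : set 'rV[C]_n.+1 := [set Z | Z != 0].

Definition proportional (Z Z' : punctured) : bool :=
  `[< exists2 l : C, l != 0 & \val Z' = l *: \val Z >].

Lemma proportional_refl : reflexive proportional.
Proof. by move=> Z; apply/asboolP; exists 1; rewrite ?oner_eq0 ?scale1r. Qed.

Lemma proportional_sym : symmetric proportional.
Proof.
suff H Z Z' : proportional Z Z' -> proportional Z' Z.
  by move=> Z Z'; apply/idP/idP => /H.
move=> /asboolP[l l0 E]; apply/asboolP; exists l^-1; first by rewrite invr_eq0.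
by rewrite E scalerA mulVf ?scale1r.
Qed.

Lemma proportional_trans : transitive proportional.
Proof.
move=> Z2 Z1 Z3 /asboolP[l l0 E] /asboolP[l' l'0 E']; apply/asboolP.
by exists (l' * l); rewrite ?mulf_neq0 // E' E scalerA.
Qed.

Canonical proportional_equiv : equiv_rel punctured :=
  EquivRel proportional proportional_refl proportional_sym proportional_trans.

Definition CP := quotient_topology {eq_quot proportional_equiv}.

Definition homogeneous_coords (p : CP) : 'rV[C]_n.+1 := \val (repr p).

Variable b : R.

(* The vector with Z_j = 1 and with the remaining Z_k equal to b z_k. *)
Definition lift_affine (j : 'I_n.+1) (z : 'rV[C]_n) : 'rV[C]_n.+1 :=
  \row_i (if unlift j i is Some k then ofR b * z 0 k else 1).

Lemma lift_affine_neq0 j z : lift_affine j z \in punctured.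
Proof.
rewrite inE /punctured /=; apply/eqP => /rowP/(_ j).
by rewrite !mxE unlift_none => /eqP; rewrite oner_eq0.
Qed.

(* On U_0 these are the coordinates z_k = Z_k / (b Z_0). *)
Definition CP_chart (j : 'I_n.+1) : chart R CP n := {|
  cdom := [set p | homogeneous_coords p 0 j != 0];
  cmap := fun p => \row_k (homogeneous_coords p 0 (lift j k) /
                           (ofR b * homogeneous_coords p 0 j));
  cinv := fun z => \pi_CP (exist _ (lift_affine j z) (lift_affine_neq0 j z)) |}.

Definition CP_manifold : cmanifold R n :=
  @CManifold R n CP 'I_n.+1 CP_chart.

(* |Z_0|^2 + |Z_1|^2 / b + ... + |Z_n|^2 / b: the form (i/2b) ddbar log(FS_norm)
   does not depend on the local lift of p to Z, which extends to the whole space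
   the form given on U_0 by FS_potential0 below. *)
Definition FS_norm (Z : 'rV[C]_n.+1) : R :=
  abs2 (Z 0 ord0) + b^-1 * \sum_(k < n) abs2 (Z 0 (lift ord0 k)).

Definition FS_potential (j : 'I_n.+1) (z : 'rV[C]_n) : R :=
  b^-1 * ln (FS_norm (lift_affine j z)).

Definition space_form_potential (z : 'rV[C]_n) : R :=
  b^-1 * ln (1 + b * sqnorm z).

(* On U_0, the potential of the Fubini-Study form is log(1 + b |z|^2) / b. *)
Lemma FS_potential0 : b != 0 -> FS_potential ord0 =1 space_form_potential.
Proof.
move=> b0 z; rewrite /FS_potential /space_form_potential /FS_norm; congr (_ * ln _).
rewrite /lift_affine !mxE unlift_none; congr (_ + _).
  by rewrite /abs2 /reC /imC /= expr1n expr0n addr0.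
rewrite /sqnorm !mulr_sumr; apply: eq_bigr => k _; rewrite mxE liftK.
case: (z 0 k) => x y; rewrite /abs2 /reC /imC /=.
by rewrite !mul0r subr0 addr0 !exprMn -mulrDr expr2 -!mulrA mulKf.
Qed.

Definition CPb : hmanifold R n :=
  @HManifold R n CP_manifold (fun j z => ddbar (FS_potential j) z).

End ProjectiveSpace.

Section HyperbolicSpace.
Variables (R : realType) (n : nat) (b : R).
Hypothesis b_lt0 : b < 0.
Local Notation C := (Cplx R).

Definition CH_ball : set 'rV[C]_n := [set z | sqnorm z < - b^-1].

Lemma CH_origin_subproof : (0 : 'rV[C]_n) \in CH_ball.
Proof.
rewrite inE /CH_ball /= /sqnorm big1 => [|j _].
  by rewrite oppr_gt0 invr_lt0.
by rewrite mxE /abs2 /reC /imC /= expr0n addr0.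
Qed.

Definition CH_origin : CH_ball := exist _ 0 CH_origin_subproof.

Definition CH_chart (_ : unit) : chart R CH_ball n := {|
  cdom := setT;
  cmap := fun p => \val p;
  cinv := fun z => insubd CH_origin z |}.

Definition CH_manifold : cmanifold R n :=
  @CManifold R n CH_ball unit CH_chart.

Definition CHb : hmanifold R n :=
  @HManifold R n CH_manifold (fun _ z => ddbar (space_form_potential b) z).

End HyperbolicSpace.

Inductive complex_space_form (R : realType) (n : nat) : hmanifold R n -> Prop :=
| ProjectiveForm (b : R) : 0 < b -> complex_space_form (CPb n b)
| HyperbolicForm (b : R) (b_lt0 : b < 0) : complex_space_form (CHb n b_lt0).

(* Main.v *)
(* Locally, F and L are vectors of holomorphic functions f and l of one variable. Equality
   of the pulled back forms, polarized in (z, w), says that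
   d_z (N_w / N - b T_w) = 0, where N(z, w) = alpha + sum_k beta_k f_k(z) conj f_k(conj w) is
   the polarized space form norm and T is the polarized Nash potential along l. Choose a
   transcendence basis X of C(f, l) among the components of f and l; by the implicit
   function theorem all components are algebraic functions of X near a generic point, and
   N and T extend to functions of (X, w). Nash functions and their derivatives remain
   algebraic in X, so the identity N_w = N (b T_w + q(w)), valid on the curve, holds for all X.
   Restricted to a line in X, g = N(., w) / N(., w') and h = b (T(., w) - T(., w')) are then
   algebraic functions of one variable with g' = h' g, which forces h to be constant. Hence
   T_zw = 0: the pulled back forms vanish, so f is constant because the space form metric is
   definite. A common Kaehler submanifold would contain a disc immersed in both manifolds,
   in contradiction with the constancy of its image in the space form. *)
From HB Require Import structures.
Require Import Defs.
From mathcomp Require Import -(notations) mpoly.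
From mathcomp Require Import all_boot all_order all_algebra.
From mathcomp Require Import all_classical all_reals all_analysis.
From mathcomp Require Import complex ring lra.
Import Order.TTheory GRing.Theory Num.Theory.
Import numFieldNormedType.Exports.

Set Implicit Arguments.
Unset Strict Implicit.
Unset Printing Implicit Defensive.

Local Open Scope classical_set_scope.
Local Open Scope ring_scope.

(** * Complex numbers as a normed field over the reals *)

(** Two difficulties shape the proof. First, the components of the curve are in general
    transcendental, so nothing on it need be algebraic in [z]; but independence of the basis [X]
    makes the image of the curve Zariski dense, and algebraic identities spread from it to an open
    set of values of [X]. The variable [w] also enters through transcendental functions; it is kept
    as a parameter, and only derivatives in constant directions are claimed to be algebraic. Second,
    equality of the forms determines the potentials only up to a function of [z] alone and one of
    [w] alone. The derivative in [w] removes the first and leaves [q(w)]; symmetry of mixed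
    derivatives then makes the logarithmic derivative in [X] independent of [w], and comparing two
    values [w], [w'] removes the unknown that remains. Derivatives of Nash functions are treated as
    limits of difference quotients, because the polynomial equation may degenerate along an
    algebraic map. All functions live in a ring of total functions, which is not a domain; zero
    divisors are excluded by restricting to holomorphic functions on a ball. *)

Section Modulus.
Variable R : realType.
Local Notation C := (Cplx R).
Implicit Types V W : normedModType C.

Lemma le_of_eq (x y : R) : x = y -> x <= y. Proof. by move=> ->. Qed.

(* The norm of a normed C-space takes its values in C; [nm] is its real version. *)
Definition nm V (v : V) : R := reC `|v|.

Lemma ofR_is_zmod_morphism : zmod_morphism (@ofR R).
Proof. by move=> x y; rewrite /ofR rmorphB. Qed.

Lemma ofR_is_monoid_morphism : monoid_morphism (@ofR R).
Proof. by split; [rewrite /ofR rmorph1 | move=> x y; rewrite /ofR rmorphM]. Qed.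

HB.instance Definition _ := GRing.isZmodMorphism.Build R C (@ofR R) ofR_is_zmod_morphism.
HB.instance Definition _ := GRing.isMonoidMorphism.Build R C (@ofR R) ofR_is_monoid_morphism.

Lemma reC_is_zmod_morphism : zmod_morphism (@reC R).
Proof. by move=> [a b] [c d]. Qed.

Lemma imC_is_zmod_morphism : zmod_morphism (@imC R).
Proof. by move=> [a b] [c d]. Qed.

HB.instance Definition _ := GRing.isZmodMorphism.Build C R (@reC R) reC_is_zmod_morphism.
HB.instance Definition _ := GRing.isZmodMorphism.Build C R (@imC R) imC_is_zmod_morphism.

Lemma reC_ofR x : reC (@ofR R x) = x. Proof. by []. Qed.

Lemma imC_ofR x : imC (@ofR R x) = 0. Proof. by []. Qed.

Lemma C_ext (z w : C) : reC z = reC w -> imC z = imC w -> z = w.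
Proof. by case: z w => a b [c d] /= -> ->. Qed.

Lemma reCD (z w : C) : reC (z + w) = reC z + reC w. Proof. exact: raddfD. Qed.

Lemma imCD (z w : C) : imC (z + w) = imC z + imC w. Proof. exact: raddfD. Qed.

Lemma reCB (z w : C) : reC (z - w) = reC z - reC w. Proof. exact: raddfB. Qed.

Lemma imCB (z w : C) : imC (z - w) = imC z - imC w. Proof. exact: raddfB. Qed.

Lemma reCM (z w : C) : reC (z * w) = reC z * reC w - imC z * imC w.
Proof. by case: z w => a b [c d]. Qed.

Lemma imCM (z w : C) : imC (z * w) = reC z * imC w + imC z * reC w.
Proof. by case: z w => a b [c d]. Qed.

Lemma reC_ofRM x (z : C) : reC (ofR x * z) = x * reC z.
Proof. by rewrite reCM imC_ofR mul0r subr0. Qed.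

Lemma imC_ofRM x (z : C) : imC (ofR x * z) = x * imC z.
Proof. by rewrite imCM imC_ofR mul0r addr0. Qed.

Lemma reCi : reC ('i : C) = 0.
Proof. by have -> : ('i : C) = ('i)%C by rewrite /Num.imaginary /=. Qed.

Lemma imCi : imC ('i : C) = 1.
Proof. by have -> : ('i : C) = ('i)%C by rewrite /Num.imaginary /=. Qed.

Lemma C_decomp (z : C) : z = ofR (reC z) + 'i * ofR (imC z).
Proof.
apply: C_ext.
  by rewrite reCD reCM reCi imCi !reC_ofR imC_ofR mul0r mulr0 subr0 addr0.
by rewrite imCD imCM reCi imCi !imC_ofR reC_ofR mul0r mul1r !add0r.
Qed.

Lemma ler_ofR (x y : R) : (ofR x <= ofR y) = (x <= y).
Proof. exact: lecR. Qed.

Lemma ltr_ofR (x y : R) : (ofR x < ofR y) = (x < y).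
Proof. exact: ltcR. Qed.

Lemma ofR_reC (z : C) : 0 <= z -> ofR (reC z) = z.
Proof. by move=> z0; apply: C_ext => //; rewrite imC_ofR /imC (ger0_Im z0). Qed.

Section Nm.
Variable V : normedModType C.
Implicit Types v w : V.

Lemma nmE v : `|v| = ofR (nm v).
Proof. by rewrite ofR_reC. Qed.

Lemma nm_ge0 v : 0 <= nm v.
Proof. by rewrite -ler_ofR -nmE rmorph0. Qed.

Lemma nm0 : nm (0 : V) = 0.
Proof. by rewrite /nm normr0. Qed.

Lemma nm_eq0 v : (nm v == 0) = (v == 0).
Proof.
apply/eqP/eqP => [h|->]; last exact: nm0.
by apply/eqP; rewrite -normr_eq0 nmE h rmorph0.
Qed.

Lemma nm_gt0 v : (0 < nm v) = (v != 0).
Proof. by rewrite lt0r nm_eq0 nm_ge0 andbT. Qed.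

Lemma nmN v : nm (- v) = nm v.
Proof. by rewrite /nm normrN. Qed.

Lemma nmB v w : nm (v - w) = nm (w - v).
Proof. by rewrite -nmN opprB. Qed.

Lemma nmD v w : nm (v + w) <= nm v + nm w.
Proof. by rewrite -ler_ofR rmorphD /= -!nmE ler_normD. Qed.

Lemma nmBD v w : nm (v - w) <= nm v + nm w.
Proof. by rewrite -(nmN w) nmD. Qed.

Lemma nm_dist v w x : nm (v - w) <= nm (v - x) + nm (x - w).
Proof. by have -> : v - w = (v - x) + (x - w); [rewrite addrA subrK | exact: nmD]. Qed.

Lemma nmZ (c : C) v : nm (c *: v) = nm c * nm v.
Proof.
suff : ofR (nm (c *: v)) = ofR (nm c * nm v) by case.
by rewrite rmorphM /= -!nmE normrZ.
Qed.

End Nm.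

Lemma nmM (a b : C) : nm (a * b) = nm a * nm b.
Proof. exact: nmZ. Qed.

Lemma nm1 : nm (1 : C) = 1.
Proof. by rewrite /nm normr1. Qed.

Lemma nmX (a : C) n : nm (a ^+ n) = nm a ^+ n.
Proof. by elim: n => [|n IH]; rewrite ?expr0 ?nm1 // !exprS nmM IH. Qed.

Lemma nmV (a : C) : nm a^-1 = (nm a)^-1.
Proof.
have [->|a0] := eqVneq a 0; first by rewrite invr0 nm0 invr0.
have na0 : nm a != 0 by rewrite nm_eq0.
by apply: (mulfI na0); rewrite -nmM divff // nm1 divff.
Qed.

Lemma nm_ofR x : nm (ofR x) = `|x|.
Proof. by rewrite /nm /reC /ofR normc_def /= expr0n addr0 sqrtr_sqr. Qed.

Lemma nm_i : nm ('i : C) = 1.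
Proof. by rewrite /nm normCi. Qed.

Lemma nm_sqr (z : C) : nm z ^+ 2 = reC z ^+ 2 + imC z ^+ 2.
Proof. by rewrite /nm /reC normc_def /= sqr_sqrtr // addr_ge0 // sqr_ge0. Qed.

Lemma nm_re (z : C) : `|reC z| <= nm z.
Proof.
rewrite -[leRHS]ger0_norm ?nm_ge0 // -ler_sqr ?nnegrE // !real_normK ?num_real //.
by rewrite nm_sqr lerDl sqr_ge0.
Qed.

Lemma nm_im (z : C) : `|imC z| <= nm z.
Proof.
rewrite -[leRHS]ger0_norm ?nm_ge0 // -ler_sqr ?nnegrE // !real_normK ?num_real //.
by rewrite nm_sqr lerDr sqr_ge0.
Qed.

Lemma nm_le_reim (z : C) : nm z <= `|reC z| + `|imC z|.
Proof.
rewrite {1}(C_decomp z); apply: le_trans (nmD _ _) _.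
by rewrite nmM nm_i mul1r !nm_ofR.
Qed.

Lemma nbhsCP V (x : V) (A : set V) :
  nbhs x A <-> exists2 r : R, 0 < r & forall y, nm (y - x) < r -> A y.
Proof.
split=> [/nbhs_normP[e /= e0 h]|[r r0 h]].
  exists (reC e); first by rewrite -ltr_ofR ofR_reC ?ltW.
  by move=> y; rewrite -ltr_ofR -nmE ofR_reC ?ltW // => hy; apply: h; rewrite /ball_ /= distrC.
apply/nbhs_normP; exists (ofR r) => /=; first by rewrite -(rmorph0 (@ofR R)) ltr_ofR.
by move=> y; rewrite /ball_ /= distrC nmE ltr_ofR; apply: h.
Qed.

Lemma openCP V (A : set V) :
  open A <-> forall x, A x -> exists2 r : R, 0 < r & forall y, nm (y - x) < r -> A y.
Proof.
rewrite openE; split=> h x Ax; first by apply/nbhsCP; exact: h.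
by apply/nbhsCP; exact: h.
Qed.

Lemma cvgCP (T : Type) (F : set_system T) {FF : Filter F} V (f : T -> V) (l : V) :
  f @ F --> l <-> forall e : R, 0 < e -> \forall x \near F, nm (f x - l) < e.
Proof.
split=> [h e e0|h A /nbhsCP[r r0 hA]].
  by apply: (h [set y | nm (y - l) < e]); apply/nbhsCP; exists e.
by rewrite /nbhs /=; near=> x; apply: hA; near: x; exact: h.
Unshelve. all: by end_near. Qed.

Lemma contCP V W (f : V -> W) (x : V) :
  {for x, continuous f} <-> forall e : R, 0 < e ->
    exists2 d : R, 0 < d & forall y, nm (y - x) < d -> nm (f y - f x) < e.
Proof.
split=> [/cvgCP h e /h /nbhsCP //|h].
by apply/cvgCP => e /h /nbhsCP.
Qed.

Lemma ler_nm_C V W (e : C) (v : V) (w : W) :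
  0 < e -> nm v <= reC e * nm w -> `|v| <= e * `|w|.
Proof.
by move=> e0; rewrite !nmE -{2}(ofR_reC (ltW e0)) -rmorphM ler_ofR.
Qed.

Lemma lin_bounded V W (L : {linear V -> W}) :
  continuous L -> exists2 M : R, 0 < M & forall v, nm (L v) <= M * nm v.
Proof.
move=> /(_ 0)/contCP/(_ 1 ltr01)[d d0 hd].
exists (2 * d^-1); first by rewrite mulr_gt0 ?invr_gt0.
have {}hd y : nm y < d -> nm (L y) < 1.
  by rewrite -{1}[y]subr0 => /hd; rewrite linear0 subr0.
move=> v; have [->|v0] := eqVneq v 0; first by rewrite linear0 !nm0 mulr0.
have nv : 0 < nm v by rewrite nm_gt0.
(* Rescaling by this factor brings [v] to norm [d / 2], inside the ball where [L] stays below 1. *)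
have c0 : 0 < d / 2 / nm v by rewrite !divr_gt0.
have := hd (ofR (d / 2 / nm v) *: v); rewrite nmZ nm_ofR gtr0_norm //.
rewrite mulfVK ?gt_eqF // ltr_pdivrMr // ltr_pMr // ltr1n => /(_ isT).
rewrite linearZ nmZ nm_ofR gtr0_norm // => h.
have -> : 2 * d^-1 * nm v = (d / 2 / nm v)^-1 by field; rewrite !gt_eqF.
by rewrite -(ler_pM2l c0) divff ?gt_eqF // ltW.
Qed.

Lemma bounded_lin V W (L : {linear V -> W}) (M : R) :
  (forall v, nm (L v) <= M * nm v) -> continuous L.
Proof.
move=> h x; apply/contCP => e e0.
have M1 : 0 < `|M| + 1 by rewrite ltr_wpDl.
exists (e / (`|M| + 1)) => [|y]; first by rewrite divr_gt0.
rewrite ltr_pdivlMr // -linearB => h1.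
apply: le_lt_trans (h _) (le_lt_trans _ h1).
by rewrite mulrC ler_wpM2l ?nm_ge0 //; have := ler_norm M; lra.
Qed.

Lemma diffCP V W (f : V -> W) x :
  differentiable f x <-> continuous ('d f x) /\
   forall e : R, 0 < e -> exists2 d : R, 0 < d &
     forall h, nm h < d -> nm (f (h + x) - f x - 'd f x h) <= e * nm h.
Proof.
split=> [df|[cd H]].
  split; first exact: diff_continuous.
  have /eqaddoP E := diff_locally df.
  move=> e e0; have /E/nbhsCP[d d0 hd] : (0 : C) < ofR e by rewrite -(rmorph0 (@ofR R)) ltr_ofR.
  exists d => // h hh; have := hd h; rewrite subr0 => /(_ hh).
  by rewrite !nmE -rmorphM /= ler_ofR opprD addrA.
apply/diff_locallyP; split => //; apply/eqaddoP => e e0.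
have e0' : 0 < reC e by rewrite -ltr_ofR ofR_reC ?ltW.
have [d d0 hd] := H _ e0'; apply/nbhsCP; exists d => // h; rewrite subr0 => /hd.
by rewrite -addrA -opprD; exact: ler_nm_C.
Qed.

Lemma diffC_intro V W (f : V -> W) x (L : {linear V -> W}) :
  continuous L ->
  (forall e : R, 0 < e -> exists2 d : R, 0 < d &
     forall h, nm h < d -> nm (f (h + x) - f x - L h) <= e * nm h) ->
  differentiable f x /\ ('d f x = L :> (V -> W)).
Proof.
move=> cL H; have E : f \o shift x = cst (f x) + L +o_ (0 : V) id.
  apply/eqaddoP => e e0; have e0' : 0 < reC e by rewrite -ltr_ofR ofR_reC ?ltW.
  have [d d0 hd] := H _ e0'; apply/nbhsCP; exists d => // h; rewrite subr0 => /hd.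
  by rewrite -addrA -opprD; exact: ler_nm_C.
have dE := diff_unique cL E; split=> //.
by apply/diff_locallyP; rewrite dE.
Qed.

End Modulus.

(** * Calculus along a real parameter *)

Section RealParameter.
Variable R : realType.
Local Notation C := (Cplx R).

(** [V] is a space over C while the parameter is real, so the derivative is stated directly by its
    increment estimate, without division by [h]. *)
Definition rder (V : normedModType C) (f : R -> V) (x : R) (c : V) : Prop :=
  forall e : R, 0 < e -> exists2 d : R, 0 < d &
    forall h : R, `|h| < d -> nm (f (x + h) - f x - ofR h *: c) <= e * `|h|.

Lemma rderP (f : R -> R) x c : is_derive x (1 : R) f c <->
  forall e : R, 0 < e -> exists2 d : R, 0 < d &
    forall h : R, `|h| < d -> `|f (x + h) - f x - h * c| <= e * `|h|.
Proof.
split=> [df e e0|H].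
  have /cvgrPdist_le /(_ _ e0) := @ex_derive _ _ _ _ _ _ _ df.
  rewrite -/(derive _ _ _) (@derive_val _ _ _ _ _ _ _ df).
  move=> /nbhs_ballP[d /= d0 hd]; exists d => // h hh.
  have [->|h0] := eqVneq h 0; first by rewrite addr0 mul0r !subr0 subrr normr0 mulr0.
  have := hd h; rewrite /ball /= sub0r normrN => /(_ hh h0).
  rewrite -(ler_pM2r (_ : 0 < `|h|)) ?normr_gt0 // -normrM => hh2; apply: le_trans hh2.
  rewrite -normrN; apply: le_of_eq; congr (`| _ |); rewrite /= [h *: 1]mulr1 [h + x]addrC.
  by rewrite /GRing.scale /=; field.
have cv : (fun h => h^-1 *: ((f \o shift x) (h *: 1) - f x)) @ 0^' --> c.
  apply/cvgrPdist_le => e e0; have [d d0 hd] := H _ e0.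
  apply/nbhs_ballP; exists d => // h; rewrite /ball /= sub0r normrN => hh h0.
  have := hd h hh; rewrite -ler_pdivrMr ?normr_gt0 // -normfV -normrM => hh2; apply: le_trans hh2.
  rewrite -normrN; apply: le_of_eq; congr (`| _ |); rewrite /= [h *: 1]mulr1 [h + x]addrC.
  by rewrite /GRing.scale /=; field.
by apply: DeriveDef; [exact: cvgP cv | exact: cvg_lim cv].
Qed.

Lemma rder_re (f : R -> C) x c : rder f x c -> is_derive x (1 : R) (@reC R \o f) (reC c).
Proof.
move=> H; apply/rderP => e /H[d d0 hd]; exists d => // h /hd /=.
by apply: le_trans; rewrite -[h * _]reC_ofRM -!reCB nm_re.
Qed.

Lemma rder_im (f : R -> C) x c : rder f x c -> is_derive x (1 : R) (@imC R \o f) (imC c).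
Proof.
move=> H; apply/rderP => e /H[d d0 hd]; exists d => // h /hd /=.
by apply: le_trans; rewrite -[h * _]imC_ofRM -!imCB nm_im.
Qed.

Lemma rder_reim (f : R -> C) x c : is_derive x (1 : R) (@reC R \o f) (reC c) ->
  is_derive x (1 : R) (@imC R \o f) (imC c) -> rder f x c.
Proof.
move=> /rderP H1 /rderP H2 e e0; have e2 : 0 < e / 2 by rewrite divr_gt0.
have [d1 d10 h1] := H1 _ e2; have [d2 d20 h2] := H2 _ e2.
exists (Num.min d1 d2) => [|h]; first by rewrite lt_min d10.
rewrite lt_min => /andP[/h1 hh1 /h2 hh2]; apply: le_trans (nm_le_reim _) _.
rewrite !reCB !imCB reC_ofRM imC_ofRM; move: hh1 hh2 => /=; lra.
Qed.

Lemma sub_split (V : zmodType) (F G f g A B : V) :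
  F + G - (f + g) - (A + B) = (F - f - A) + (G - g - B).
Proof. by rewrite !opprD (addrACA F G) (addrACA (F - f)). Qed.

Lemma linBZ (V W : normedModType C) (L : {linear V -> W}) (u v : V) (a : C) :
  L (u - a *: v) = L u - a *: L v.
Proof. by rewrite linearB linearZ. Qed.

Section General.
Variables V W : normedModType C.

Lemma rder_cont (f : R -> V) x c : rder f x c ->
  forall e, 0 < e -> exists2 d : R, 0 < d & forall h, `|h| < d -> nm (f (x + h) - f x) < e.
Proof.
move=> /(_ 1 ltr01)[d d0 hd] e e0; have k0 : 0 < 1 + nm c by rewrite ltr_pwDl ?nm_ge0.
exists (Num.min d (e / (1 + nm c))) => [|h]; first by rewrite lt_min d0 divr_gt0.
rewrite lt_min ltr_pdivlMr // => /andP[/hd h1 h2]; apply: le_lt_trans h2.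
have := nmD (f (x + h) - f x - ofR h *: c) (ofR h *: c).
rewrite subrK nmZ nm_ofR; lra.
Qed.

Lemma rder_comp (f : R -> V) x c (g : V -> W) : rder f x c -> differentiable g (f x) ->
  rder (g \o f) x ('d g (f x) c).
Proof.
move=> df /diffCP[cl H] e e0.
have [M M0 hM] := lin_bounded cl.
have k0 : 0 < 2 + 2 * nm c by rewrite ltr_pwDl // mulr_ge0 ?nm_ge0.
have [d d0 hd] := H (e / (2 + 2 * nm c)) (divr_gt0 e0 k0).
have [d1 d10 hd1] := rder_cont df d0.
have m0 : 0 < Num.min 1 (e / (2 * M)) by rewrite lt_min ltr01 divr_gt0 // mulr_gt0.
have [d2 d20 hd2] := df _ m0.
exists (Num.min d1 d2) => [|h]; first by rewrite lt_min d10.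
rewrite lt_min => /andP[/hd1 h1 /hd2 h2] /=.
set k := f (x + h) - f x in h1 h2.
have -> : f (x + h) = k + f x by rewrite subrK.
have {}h1 := hd _ h1; clearbody k.
have -> : g (k + f x) - g (f x) - ofR h *: 'd g (f x) c =
  (g (k + f x) - g (f x) - 'd g (f x) k) + 'd g (f x) (k - ofR h *: c).
  by rewrite linBZ addrA subrK.
have ha : nm (k - ofR h *: c) <= `|h| by apply: le_trans h2 _; rewrite ler_piMl // ge_min lexx.
have hb : nm (k - ofR h *: c) <= e / (2 * M) * `|h|.
  by apply: le_trans h2 _; rewrite ler_wpM2r // ge_min lexx orbT.
have hk : nm k <= (1 + nm c) * `|h|.
  have := nmD (k - ofR h *: c) (ofR h *: c); rewrite subrK nmZ nm_ofR; lra.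
apply: le_trans (nmD _ _) _; rewrite [e](_ : _ = e / 2 + e / 2); last by field.
rewrite mulrDl lerD //.
  apply: le_trans h1 _; apply: le_trans (ler_wpM2l (divr_ge0 (ltW e0) (ltW k0)) hk) _; apply: le_of_eq.
  by field; rewrite gt_eqF // ; lra.
apply: le_trans (hM _) _; rewrite -(ler_pM2l M0) in hb; apply: le_trans hb _.
by apply: le_of_eq; field; rewrite gt_eqF.
Qed.

Lemma rderD (f g : R -> V) x a b : rder f x a -> rder g x b ->
  rder (fun t => f t + g t) x (a + b).
Proof.
move=> H1 H2 e e0; have e2 : 0 < e / 2 by rewrite divr_gt0.
have [d1 d10 h1] := H1 _ e2; have [d2 d20 h2] := H2 _ e2.
exists (Num.min d1 d2) => [|h]; first by rewrite lt_min d10.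
rewrite lt_min => /andP[/h1 hh1 /h2 hh2].
have -> : f (x + h) + g (x + h) - (f x + g x) - ofR h *: (a + b) =
  (f (x + h) - f x - ofR h *: a) + (g (x + h) - g x - ofR h *: b).
  by rewrite scalerDr sub_split.
by apply: le_trans (nmD _ _) _; lra.
Qed.

Lemma rderZ (k : C) (f : R -> V) x a : rder f x a -> rder (fun t => k *: f t) x (k *: a).
Proof.
move=> H e e0; have k0 : 0 < nm k + 1 by rewrite ltr_wpDl ?nm_ge0.
have [d d0 hd] := H _ (divr_gt0 e0 k0); exists d => // h /hd hh.
rewrite scalerA [ofR h * k]mulrC -scalerA -!scalerBr nmZ.
apply: le_trans (_ : (nm k + 1) * (e / (nm k + 1) * `|h|) <= _).
  by rewrite ler_pM ?nm_ge0 ?lerDl.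
by apply: le_of_eq; field; rewrite gt_eqF.
Qed.

Lemma rder_cst (v : V) x : rder (fun=> v) x 0.
Proof.
move=> e e0; exists 1 => // h _.
by rewrite subrr scaler0 subr0 nm0 mulr_ge0 // ltW.
Qed.

Lemma rder_line (v : V) x : rder (fun t => ofR t *: v) x v.
Proof.
move=> e e0; exists 1 => // h _.
by rewrite (rmorphD (@ofR R)) scalerDl [ofR x *: v + _]addrC addrK subrr nm0 mulr_ge0 // ltW.
Qed.

Lemma rder_eq (f : R -> V) x a b : rder f x a -> a = b -> rder f x b.
Proof. by move=> + <-. Qed.

Lemma rder_ext (f g : R -> V) x a : f =1 g -> rder f x a -> rder g x a.
Proof. by move=> /funext <-. Qed.

Lemma rder_aff (u v : V) x : rder (fun t => u + ofR t *: v) x v.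
Proof. by apply: rder_eq (rderD (rder_cst u x) (rder_line v x)) _; rewrite add0r. Qed.

End General.

Lemma is_derive_cont (f : R -> R) x c : is_derive x (1 : R) f c -> {for x, continuous f}.
Proof. by move=> df; apply: differentiable_continuous; apply/derivable1_diffP; exact: ex_derive. Qed.

Lemma mean_value (f df : R -> R) (a b : R) : a <= b ->
  (forall x, a <= x <= b -> is_derive x (1 : R) f (df x)) ->
  exists2 x, a <= x <= b & f b - f a = df x * (b - a).
Proof.
move=> ab H; have [||c] := @MVT_segment _ f df a b ab; last 1 first.
- by rewrite in_itv /= => ? ?; exists c.
- by move=> x; rewrite in_itv /= => /andP[h1 h2]; apply: H; rewrite !ltW.
apply: continuous_in_subspaceT => x; rewrite inE /= in_itv /= => hx.
exact: is_derive_cont (H _ hx).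
Qed.

(** The mean value theorem fails for complex values; applied to the real and imaginary parts
    separately, it costs the factor 2. *)
Lemma rder_mvt (f df : R -> C) (a b m : R) : a <= b ->
  (forall x, a <= x <= b -> rder f x (df x)) ->
  (forall x, a <= x <= b -> nm (df x) <= m) ->
  nm (f b - f a) <= 2 * m * (b - a).
Proof.
move=> ab H Hm; have ba : 0 <= b - a by rewrite subr_ge0.
have [x hx Ex] := mean_value ab (fun x hx => rder_re (H x hx)).
have [y hy Ey] := mean_value ab (fun x hx => rder_im (H x hx)).
apply: le_trans (nm_le_reim _) _; rewrite reCB imCB [X in `|X| + _]Ex [X in _ + `|X|]Ey.
rewrite !normrM (ger0_norm ba) -mulrDl ler_wpM2r // mulr2n mulrDl mul1r lerD //.
  exact: le_trans (nm_re _) (Hm _ hx).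
exact: le_trans (nm_im _) (Hm _ hy).
Qed.

Lemma max_contract (a u v : R) : `|Num.max a u - Num.max a v| <= `|u - v|.
Proof.
have h1 := ler_norm (u - v); have := ler_norm (v - u); rewrite distrC => h2.
by rewrite !maxElt; case: (ltP a u) => ?; case: (ltP a v) => ?;
  rewrite ler_norml; apply/andP; split; lra.
Qed.

Lemma min_contract (a u v : R) : `|Num.min u a - Num.min v a| <= `|u - v|.
Proof.
have h1 := ler_norm (u - v); have := ler_norm (v - u); rewrite distrC => h2.
by rewrite !minElt; case: (ltP u a) => ?; case: (ltP v a) => ?;
  rewrite ler_norml; apply/andP; split; lra.
Qed.

Lemma real_primitive (f : R -> R) (a b : R) : a <= b ->
  (forall x, a <= x <= b -> {for x, continuous f}) ->
  exists F : R -> R, forall x, a <= x <= b -> is_derive x (1 : R) F (f x).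
Proof.
(* Precomposition with the clamp onto [[a, b]] turns [f] into a function continuous on the whole
   line. *)
move=> ab cf; pose cl x := Num.max a (Num.min x b).
have clab x : a <= cl x <= b.
  by rewrite /cl le_max lexx /= ge_max ab /= ge_min lexx orbT.
have cl_id x : a <= x <= b -> cl x = x.
  by move=> /andP[h1 h2]; rewrite /cl (min_idPl h2) (max_idPr h1).
have ccl : continuous cl.
  move=> x; apply/cvgrPdist_lt => e e0; apply/nbhs_ballP; exists e => // y.
  rewrite /ball /=; apply: le_lt_trans.
  exact: le_trans (max_contract _ _ _) (min_contract _ _ _).
have cg : continuous (f \o cl).
  by move=> x; apply: continuous_comp; [exact: ccl | exact: cf].
(* Integration starts at [a - 1] so that [a] is an interior point and the derivative there is
   two-sided; [b + 1] plays the same role below. *)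
pose F x := \int[@lebesgue_measure R]_(t in `[a - 1, x]) (f \o cl) t.
exists F => x hx.
have [h1 h2] : derivable F x (1 : R) /\ derive1 F x = (f \o cl) x.
  apply: (@continuous_FTC1_closed R (f \o cl) (a - 1) x (b + 1)); last exact: cg.
  - by case/andP: hx => _ hx; rewrite (le_lt_trans hx) // ltrDl.
  - apply: continuous_compact_integrable; first exact: segment_compact.
    exact: continuous_subspaceT.
  - by case/andP: hx => hx _; rewrite (lt_le_trans _ hx) // gtrBl.
move: h1 h2; clearbody F; rewrite derive1E => h1 h2; apply: DeriveDef h1 _.
by rewrite h2; exact: congr1 (cl_id x hx).
Qed.

Definition primitive_on (f : R -> C) (a b : R) (F : R -> C) :=
  forall x, a <= x <= b -> rder F x (f x).

Definition rcont (f : R -> C) x := forall e, 0 < e ->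
  exists2 d : R, 0 < d & forall h, `|h| < d -> nm (f (x + h) - f x) < e.

Lemma rcont_reim (f : R -> C) x : rcont f x ->
  {for x, continuous (@reC R \o f)} /\ {for x, continuous (@imC R \o f)}.
Proof.
move=> H; split; apply/cvgrPdist_lt => e /H[d d0 hd]; apply/nbhs_ballP; exists d => // y;
  rewrite /ball /= distrC => hy; rewrite distrC -?reCB -?imCB;
  have := hd _ hy; rewrite [x + _]addrC subrK; apply: le_lt_trans; [exact: nm_re | exact: nm_im].
Qed.

Lemma ex_primitive (f : R -> C) (a b : R) : a <= b -> (forall x, a <= x <= b -> rcont f x) ->
  exists F, primitive_on f a b F.
Proof.
move=> ab cf.
have [G hG] := real_primitive ab (fun x hx => (rcont_reim (cf x hx)).1).
have [H hH] := real_primitive ab (fun x hx => (rcont_reim (cf x hx)).2).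
exists (fun x => ofR (G x) + 'i * ofR (H x)) => x hx.
apply: rder_reim.
  have -> : @reC R \o (fun t => ofR (G t) + 'i * ofR (H t)) = G; last exact: hG.
  by apply/funext => t; rewrite -[LHS]/(reC (ofR (G t) + 'i * ofR (H t))) reCD reCM reCi imC_ofR mul0r mulr0 subr0 addr0.
have -> : @imC R \o (fun t => ofR (G t) + 'i * ofR (H t)) = H; last exact: hH.
by apply/funext => t; rewrite -[LHS]/(imC (ofR (G t) + 'i * ofR (H t))) imCD imCM reCi imCi imC_ofR mul0r mul1r !add0r.
Qed.

Lemma rder0_cst (f : R -> C) (a b : R) : a <= b ->
  (forall x, a <= x <= b -> rder f x 0) -> f b = f a.
Proof.
move=> ab H; apply/eqP; rewrite -subr_eq0 -nm_eq0 eq_le nm_ge0 andbT.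
have := rder_mvt (m := 0) ab H; rewrite mulr0 mul0r; apply.
by move=> x _; rewrite nm0.
Qed.

(** The integral as increment of a primitive: linearity, splitting and the fundamental theorem
    reduce to facts about primitives. In the absence of a primitive the default [cst 0] gives the
    value 0. *)
Definition cint (f : R -> C) (a b : R) : C :=
  let F := xget (cst 0) [set F | primitive_on f a b F] in F b - F a.

Lemma cintE f (a b : R) F : a <= b -> primitive_on f a b F -> cint f a b = F b - F a.
Proof.
move=> ab pF; rewrite /cint; case: xgetP => [G _ /= pG|/(_ F)/(_ pF) //].
suff e : F b - G b = F a - G a.
  by rewrite -[F b](subrK (G b)) e; ring.
apply: (rder0_cst (f := fun x => F x - G x)) ab _ => x hx.
have := rderD (pF _ hx) (rderZ (-1) (pG _ hx)); rewrite scaleN1r subrr.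
by apply: rder_ext => t; rewrite scaleN1r.
Qed.

Lemma cint_prim f (a b : R) : a <= b -> (forall x, a <= x <= b -> rcont f x) ->
  exists2 F, primitive_on f a b F & cint f a b = F b - F a.
Proof.
by move=> ab cf; have [F hF] := ex_primitive ab cf; exists F => //; exact: cintE.
Qed.

Lemma eq_cint f g (a b : R) : (forall x, a <= x <= b -> f x = g x) -> cint f a b = cint g a b.
Proof.
move=> fg; rewrite /cint; suff -> : primitive_on f a b = primitive_on g a b by [].
by apply/funext => F; apply/propext; split => H x hx; have := H x hx; rewrite fg.
Qed.

Lemma cint_split f (a b c : R) : a <= b -> b <= c -> (forall x, a <= x <= c -> rcont f x) ->
  cint f a c = cint f a b + cint f b c.
Proof.
move=> ab bc cf; have [F pF ->] := cint_prim (le_trans ab bc) cf.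
rewrite (cintE ab (F := F)); first rewrite (cintE bc (F := F)).
- ring.
- by move=> x /andP[h1 h2]; apply: pF; rewrite h2 (le_trans ab).
by move=> x /andP[h1 h2]; apply: pF; rewrite h1 (le_trans h2).
Qed.

Lemma cintD f g (a b : R) : a <= b -> (forall x, a <= x <= b -> rcont f x) ->
  (forall x, a <= x <= b -> rcont g x) ->
  cint (fun x => f x + g x) a b = cint f a b + cint g a b.
Proof.
move=> ab cf cg; have [F pF ->] := cint_prim ab cf; have [G pG ->] := cint_prim ab cg.
rewrite (cintE ab (F := fun x => F x + G x)); first by rewrite opprD addrACA.
by move=> x hx; apply: rderD; [exact: pF | exact: pG].
Qed.

Lemma cintZ (k : C) f (a b : R) : a <= b -> (forall x, a <= x <= b -> rcont f x) ->
  cint (fun x => k * f x) a b = k * cint f a b.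
Proof.
move=> ab cf; have [F pF ->] := cint_prim ab cf.
rewrite (cintE ab (F := fun x => k * F x)); first by rewrite mulrBr.
by move=> x hx; apply: rderZ; exact: pF.
Qed.

Lemma cint_bound f (a b m : R) : a <= b -> (forall x, a <= x <= b -> rcont f x) ->
  (forall x, a <= x <= b -> nm (f x) <= m) -> nm (cint f a b) <= 2 * m * (b - a).
Proof. by move=> ab cf; have [F pF ->] := cint_prim ab cf; exact: rder_mvt. Qed.

End RealParameter.

(** * Complex differentials *)

Section Calculus.
Variable R : realType.
Local Notation C := (Cplx R).

(** A relation instead of the function ['d f x]: the differential of a compound expression is then
    built together with the proof that it exists. *)
Definition dd (V W : normedModType C) (f : V -> W) (x : V) (L : V -> W) : Prop :=
  differentiable f x /\ ('d f x : V -> W) = L.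

Section VW.
Variables V W : normedModType C.

Lemma dd_diff (f : V -> W) x L : dd f x L -> differentiable f x.
Proof. by case. Qed.

Lemma dd_val (f : V -> W) x L h : dd f x L -> 'd f x h = L h.
Proof. by case=> _ ->. Qed.

Lemma ddP (f : V -> W) x : differentiable f x -> dd f x ('d f x).
Proof. by []. Qed.

Lemma dd_ext (f g : V -> W) x L M : dd f x L -> f =1 g -> L =1 M -> dd g x M.
Proof. by move=> H /funext <- /funext <-. Qed.

Lemma dd_eq (f : V -> W) x L M : dd f x L -> L =1 M -> dd f x M.
Proof. by move=> H /funext <-. Qed.

Lemma dd_cst (c : W) x : dd (fun _ : V => c) x (fun=> 0).
Proof.
split; first exact: (@differentiable_cst C V W c x).
exact: (@diff_cst C V W c x).
Qed.

Lemma ddD (f g : V -> W) x L M : dd f x L -> dd g x M ->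
  dd (fun z => f z + g z) x (fun h => L h + M h).
Proof.
move=> [df <-] [dg <-]; split; first exact: (@differentiableD C V W f g x df dg).
exact: (@diffD C V W f g x df dg).
Qed.

Lemma ddB (f g : V -> W) x L M : dd f x L -> dd g x M ->
  dd (fun z => f z - g z) x (fun h => L h - M h).
Proof.
move=> [df <-] [dg <-]; split; first exact: (@differentiableB C V W f g x df dg).
exact: (@diffB C V W f g x df dg).
Qed.

Lemma ddZ (k : C) (f : V -> W) x L : dd f x L -> dd (fun z => k *: f z) x (fun h => k *: L h).
Proof.
move=> [df <-]; split; first exact: (@differentiableZ C V W f k x df).
exact: (@diffZ C V W f k x df).
Qed.

Lemma dd_sum (I : finType) (f : I -> V -> W) x (L : I -> V -> W) :
  (forall i, dd (f i) x (L i)) -> dd (fun z => \sum_i f i z) x (fun h => \sum_i L i h).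
Proof.
move=> H.
have E (s : seq I) : dd (fun z => \sum_(i <- s) f i z) x (fun h => \sum_(i <- s) L i h).
  elim: s => [|i s IH].
    by apply: dd_ext (dd_cst 0 x) _ _ => z; rewrite big_nil.
  by apply: dd_ext (ddD (H i) IH) _ _ => z; rewrite big_cons.
by apply: dd_ext (E (index_enum I)) _ _.
Qed.

End VW.

Lemma dd_id (V : normedModType C) (x : V) : dd id x id.
Proof.
have H : is_diff x (id : V -> V) id by exact: is_diff_id.
by split; [exact: ex_diff | exact: diff_val].
Qed.

Lemma ddM (V : normedModType C) (f g : V -> C) x L M : dd f x L -> dd g x M ->
  dd (fun z => f z * g z) x (fun h => f x * M h + g x * L h).
Proof.
move=> [df <-] [dg <-]; split; first exact: (@differentiableM C V f g x df dg).
exact: (@diffM C V f g x df dg).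
Qed.

Lemma ddMl (V : normedModType C) (c : C) (f : V -> C) x L : dd f x L ->
  dd (fun z => c * f z) x (fun h => c * L h).
Proof. exact: ddZ. Qed.

Lemma dd_comp (U V W : normedModType C) (f : U -> V) (g : V -> W) x L M :
  dd f x L -> dd g (f x) M -> dd (fun z => g (f z)) x (fun h => M (L h)).
Proof.
move=> [df <-] [dg <-]; split; first exact: (@differentiable_comp C U V W f g x df dg).
exact: (@diff_comp C U V W f g x df dg).
Qed.

Lemma ddV (V : normedModType C) (f : V -> C) x L : dd f x L -> f x != 0 ->
  dd (fun z => (f z)^-1) x (fun h => - (f x)^-2 * L h).
Proof.
move=> [df <-] f0; split; first exact: (@differentiableV C V f x df f0).
exact: (@diffV C V f x df f0).
Qed.

Lemma dd_lin (V W : normedModType C) (L : {linear V -> W}) (m : R) x :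
  (forall v, nm (L v) <= m * nm v) -> dd L x L.
Proof.
move=> /bounded_lin cL; split; first exact: linear_differentiable.
exact: diff_lin.
Qed.

Lemma derive1_dd (W : normedModType C) (f : C -> W) (z h : C) : differentiable f z ->
  'd f z h = h *: derive1 f z.
Proof. by move=> df; rewrite (@diff1E C W f z df). Qed.

Lemma dd_derive1 (W : normedModType C) (f : C -> W) (z : C) (c : W) :
  dd f z (fun h => h *: c) -> derive1 f z = c.
Proof.
by move=> [df E]; have := derive1_dd 1 df; rewrite E !scale1r => ->.
Qed.

Lemma dd1 (W : normedModType C) (f : C -> W) (z : C) : differentiable f z ->
  dd f z (fun h => h *: derive1 f z).
Proof. by move=> df; split=> //; apply/funext => h; exact: derive1_dd. Qed.

Lemma near_dd (V W : normedModType C) (f g : V -> W) x L :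
  (exists2 r : R, 0 < r & forall y, nm (y - x) < r -> f y = g y) -> dd f x L -> dd g x L.
Proof.
move=> [r r0 fg] [df <-].
have fgx : f x = g x by apply: fg; rewrite subrr nm0.
have cl := diff_continuous df.
have [||h1 h2] := @diffC_intro _ V W g x ('d f x) _ _; last by split.
- exact: cl.
- move=> e e0; have /diffCP[_ /(_ e e0)[d d0 hd]] := df.
  exists (Num.min d r) => [|h]; first by rewrite lt_min d0.
  rewrite lt_min => /andP[h1 h2]; have := hd h h1.
  by rewrite fgx fg // addrK.
Qed.

Lemma near_diff (V W : normedModType C) (f g : V -> W) x :
  (exists2 r : R, 0 < r & forall y, nm (y - x) < r -> f y = g y) ->
  differentiable f x -> differentiable g x.
Proof. by move=> H /ddP/(near_dd H)[]. Qed.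

Lemma rder_dd (V W : normedModType C) (f : R -> V) (g : V -> W) x c L :
  rder f x c -> dd g (f x) L -> rder (fun t => g (f t)) x (L c).
Proof. by move=> df [dg <-]; exact: rder_comp. Qed.

End Calculus.

(** * Goursat's lemma and Cauchy's formula *)

Section Goursat.
Variable R : realType.
Local Notation C := (Cplx R).

(** Choosing a bad quarter again and again yields nested rectangles of the original proportions; the
    suprema of their lower corners give a point common to all of them. *)
Lemma bisection (Bad : R -> R -> R -> R -> Prop) (a b c d : R) : a < b -> c < d ->
  (forall a b c d, a < b -> c < d -> Bad a b c d ->
     let m := (a + b) / 2 in let n := (c + d) / 2 in
     [\/ Bad a m c n, Bad a m n d, Bad m b c n | Bad m b n d]) ->
  Bad a b c d ->
  exists x y, [/\ a <= x <= b, c <= y <= d & forall e, 0 < e ->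
    exists a' b' c' d', [/\ a <= a' <= x /\ x <= b' <= b, c <= c' <= y /\ y <= d' <= d,
      a' < b' /\ b' - a' < e, d' - c' = (b' - a') / (b - a) * (d - c) & Bad a' b' c' d']].
Proof.
move=> ab cd step bad0.
pose good (r : R * R * (R * R)) := [/\ r.1.1 < r.1.2, r.2.1 < r.2.2 & Bad r.1.1 r.1.2 r.2.1 r.2.2].
pose sub (r r' : R * R * (R * R)) := [/\ r.1.1 <= r'.1.1, r'.1.2 <= r.1.2,
  r.2.1 <= r'.2.1, r'.2.2 <= r.2.2 &
  r'.1.2 - r'.1.1 = (r.1.2 - r.1.1) / 2 /\ r'.2.2 - r'.2.1 = (r.2.2 - r.2.1) / 2].
(* The implication stands under the existential so that [choice] returns a total successor function,
   ready to be iterated. *)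
have nxt r : exists r', good r -> good r' /\ sub r r'.
  have [gr|] := pselect (good r); last by exists r.
  case: r gr => [[a1 b1] [c1 d1]] [/= ab1 cd1 bad1].
  case: (step _ _ _ _ ab1 cd1 bad1) => H.
  - by exists (a1, (a1 + b1) / 2, (c1, (c1 + d1) / 2)); split; split => //=; lra.
  - by exists (a1, (a1 + b1) / 2, ((c1 + d1) / 2, d1)); split; split => //=; lra.
  - by exists ((a1 + b1) / 2, b1, (c1, (c1 + d1) / 2)); split; split => //=; lra.
  - by exists ((a1 + b1) / 2, b1, ((c1 + d1) / 2, d1)); split; split => //=; lra.
have {nxt}[f hf] := choice nxt.
pose r n := iter n f (a, b, (c, d)).
have gr n : good (r n) by elim: n => [//|n IH]; have [] := hf _ IH.
have sr n : sub (r n) (r n.+1) by have [] := hf _ (gr n).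
have w1 n : (r n).1.2 - (r n).1.1 = (b - a) / 2 ^+ n.
  elim: n => [|n IH]; first by rewrite expr0 divr1.
  by have [_ _ _ _ [-> _]] := sr n; rewrite IH exprS invfM [2^-1 * _]mulrC mulrA.
have w2 n : (r n).2.2 - (r n).2.1 = (d - c) / 2 ^+ n.
  elim: n => [|n IH]; first by rewrite expr0 divr1.
  by have [_ _ _ _ [_ ->]] := sr n; rewrite IH exprS invfM [2^-1 * _]mulrC mulrA.
have mono (n k : nat) : [/\ (r n).1.1 <= (r (n + k)%N).1.1, (r (n + k)%N).1.2 <= (r n).1.2,
    (r n).2.1 <= (r (n + k)%N).2.1 & (r (n + k)%N).2.2 <= (r n).2.2].
  elim: k => [|k [h1 h2 h3 h4]]; first by rewrite addn0.
  rewrite addnS; have [g1 g2 g3 g4 _] := sr (n + k)%N.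
  by split; [exact: le_trans g1 | exact: le_trans g2 _ | exact: le_trans g3 | exact: le_trans g4 _].
have cross (n k : nat) : (r n).1.1 <= (r k).1.2 /\ (r n).2.1 <= (r k).2.2.
  have [h1 _ h3 _] := mono n k; have [_ h2 _ h4] := mono k n; rewrite addnC in h2 h4.
  have [g1 g2 _] := gr (n + k)%N; split.
    exact: le_trans h1 (le_trans (ltW g1) h2).
  exact: le_trans h3 (le_trans (ltW g2) h4).
pose A := [set (r n).1.1 | n in setT]; pose B := [set (r n).2.1 | n in setT].
have supA : has_sup A.
  by split; [exists a, 0%N | exists b => _ [n _ <-]; exact: (cross n 0%N).1].
have supB : has_sup B.
  by split; [exists c, 0%N | exists d => _ [n _ <-]; exact: (cross n 0%N).2].
have x1 n : (r n).1.1 <= sup A by apply: ub_le_sup; [case: supA | exists n].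
have x2 n : sup A <= (r n).1.2 by apply: ge_sup; [case: supA | move=> _ [k _ <-]; exact: (cross k n).1].
have y1 n : (r n).2.1 <= sup B by apply: ub_le_sup; [case: supB | exists n].
have y2 n : sup B <= (r n).2.2 by apply: ge_sup; [case: supB | move=> _ [k _ <-]; exact: (cross k n).2].
exists (sup A), (sup B); split.
- by rewrite (x1 0%N) (x2 0%N).
- by rewrite (y1 0%N) (y2 0%N).
(* With this [n], [(b - a) / e < n + 1 < 2 ^ (n + 1)], so the rectangle of rank [n + 1] is narrower
   than [e]. *)
move=> e e0; pose n := Num.truncn ((b - a) / e).
have [m0 m1 m2 m3] := mono 0%N n.+1; rewrite add0n in m0 m1 m2 m3.
have [g1 g2 g3] := gr n.+1.
exists (r n.+1).1.1, (r n.+1).1.2, (r n.+1).2.1, (r n.+1).2.2; split => //.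
- by rewrite m0 x1 x2 m1.
- by rewrite m2 y1 y2 m3.
- split=> //; rewrite w1 ltr_pdivrMr ?exprn_gt0 // -ltr_pdivrMl // mulrC.
  have h : (b - a) / e < n.+1%:R by apply: truncnS_gt.
  apply: lt_trans h _; rewrite -natrX ltr_nat; exact: ltn_expl.
- rewrite w1 w2; field; rewrite expf_neq0 //= subr_eq0 gt_eqF //.
Qed.

(** For [t] in [[-1, 1]] this runs over the right-hand side of the square of half-side [s] centred
    at 0. Rectangles in [(s, t)] become trapezoids, four rotated copies of which fill the ring
    between two squares. *)
Definition gam (s t : R) : C := ofR s * (1 + 'i * ofR t).

Lemma rder_gam_s s t : rder (fun s => gam s t) s (1 + 'i * ofR t).
Proof. exact: (rder_line (1 + 'i * ofR t : C) s). Qed.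

Lemma rder_gam_t s t : rder (fun t => gam s t) t ('i * ofR s).
Proof.
apply: rder_ext (rder_aff (ofR s : C) ('i * ofR s) t) => x.
by rewrite /gam /GRing.scale /=; ring.
Qed.

Lemma nm_gam s t : 0 <= s -> -1 <= t <= 1 -> s <= nm (gam s t) <= 2 * s.
Proof.
move=> s0 /andP[t1 t2]; rewrite nmM nm_ofR ger0_norm // [2 * s]mulrC; apply/andP; split.
  rewrite ler_peMr //; apply: le_trans (nm_re _).
  by rewrite reCD reCM reCi !imC_ofR mul0r mulr0 subr0 addr0 normr1.
rewrite ler_wpM2l //; apply: le_trans (nmD _ _) _.
by rewrite nm1 nmM nm_i mul1r nm_ofR [2]mulr2n lerD // ler_norml t1.
Qed.

Lemma nm_1i (t : R) : -1 <= t <= 1 -> nm (1 + 'i * ofR t : C) <= 2.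
Proof.
by move=> /(nm_gam ler01); rewrite /gam rmorph1 mul1r mulr1 => /andP[].
Qed.

(** Contour integral of [k] along the boundary of the image by [gam] of the rectangle [[a, b] x
    [c, d]]. *)
Definition Jr (k : C -> C) (a b c d : R) : C :=
  cint (fun s => (1 + 'i * ofR c) * k (gam s c)) a b
  + cint (fun t => 'i * ofR b * k (gam b t)) c d
  - cint (fun s => (1 + 'i * ofR d) * k (gam s d)) a b
  - cint (fun t => 'i * ofR a * k (gam a t)) c d.

Lemma rder_rcont (f : R -> C) x y : rder f x y -> rcont f x.
Proof. exact: rder_cont. Qed.

Lemma rcont_s (k : C -> C) (u : C) s t : differentiable k (gam s t) ->
  rcont (fun s => u * k (gam s t)) s.
Proof.
by move=> dk; apply: rder_rcont (rderZ u (rder_comp (rder_gam_s s t) dk)).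
Qed.

Lemma rcont_t (k : C -> C) (u : C) s t : differentiable k (gam s t) ->
  rcont (fun t => u * k (gam s t)) t.
Proof.
by move=> dk; apply: rder_rcont (rderZ u (rder_comp (rder_gam_t s t) dk)).
Qed.

Definition diff_rect (k : C -> C) a b c d :=
  forall s t : R, a <= s <= b -> c <= t <= d -> differentiable k (gam s t).

Lemma Jr_split k (a m b c n d : R) : a <= m -> m <= b -> c <= n -> n <= d ->
  diff_rect k a b c d ->
  Jr k a b c d = Jr k a m c n + Jr k a m n d + Jr k m b c n + Jr k m b n d.
Proof.
move=> am mb cn nd dk; have ab := le_trans am mb; have cd := le_trans cn nd.
rewrite {1}/Jr (cint_split am mb); last by move=> s hs; apply: rcont_s; apply: dk; rewrite ?lexx.
rewrite (@cint_split _ _ c n d); last by move=> s hs; apply: rcont_t; apply: dk; rewrite ?lexx ?ab ?cd.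
all: try by [].
rewrite [X in _ - X - _](cint_split am mb); last by move=> s hs; apply: rcont_s; apply: dk; rewrite ?lexx ?ab ?cd.
rewrite [X in _ - X](@cint_split _ _ c n d); last by move=> s hs; apply: rcont_t; apply: dk; rewrite ?lexx ?ab ?cd.
all: try by [].
rewrite /Jr; do ![match goal with |- context [cint ?f ?a ?b] => move: (cint f a b) => ? end].
ring.
Qed.

Lemma Jr_prim (k P : C -> C) (a b c d : R) : a <= b -> c <= d ->
  (forall z, differentiable P z) -> (forall z h, 'd P z h = h * k z) ->
  Jr k a b c d = 0.
Proof.
move=> ab cd dP dE.
have hs t : cint (fun s => (1 + 'i * ofR t) * k (gam s t)) a b = P (gam b t) - P (gam a t).
  apply: (cintE (F := fun s => P (gam s t))) => // s _.
  by rewrite -dE; exact: (rder_comp (rder_gam_s s t)).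
have ht s : cint (fun t => 'i * ofR s * k (gam s t)) c d = P (gam s d) - P (gam s c).
  apply: (cintE (F := fun t => P (gam s t))) => // t _.
  by rewrite -dE; exact: (rder_comp (rder_gam_t s t)).
by rewrite /Jr !hs !ht; ring.
Qed.

Lemma Jr_add (k1 k2 : C -> C) (a b c d : R) : a <= b -> c <= d ->
  diff_rect k1 a b c d -> diff_rect k2 a b c d ->
  Jr (fun z => k1 z + k2 z) a b c d = Jr k1 a b c d + Jr k2 a b c d.
Proof.
move=> ab cd d1 d2.
have hs t : c <= t <= d -> cint (fun s => (1 + 'i * ofR t) * (k1 (gam s t) + k2 (gam s t))) a b =
    cint (fun s => (1 + 'i * ofR t) * k1 (gam s t)) a b + cint (fun s => (1 + 'i * ofR t) * k2 (gam s t)) a b.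
  move=> ht; rewrite -cintD //; first by apply: eq_cint => s _; rewrite mulrDr.
  - by move=> s h; apply: rcont_s; apply: d1.
  - by move=> s h; apply: rcont_s; apply: d2.
have ht s : a <= s <= b -> cint (fun t => 'i * ofR s * (k1 (gam s t) + k2 (gam s t))) c d =
    cint (fun t => 'i * ofR s * k1 (gam s t)) c d + cint (fun t => 'i * ofR s * k2 (gam s t)) c d.
  move=> hs'; rewrite -cintD //; first by apply: eq_cint => t _; rewrite mulrDr.
  - by move=> t h; apply: rcont_t; apply: d1.
  - by move=> t h; apply: rcont_t; apply: d2.
rewrite /Jr !hs ?ht ?lexx ?ab ?cd //.
do ![match goal with |- context [cint ?f ?a ?b] => move: (cint f a b) => ? end].
ring.
Qed.

Lemma Jr_bound (k : C -> C) (a b c d m : R) : 0 <= a -> a <= b -> -1 <= c -> c <= d -> d <= 1 ->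
  diff_rect k a b c d ->
  (forall s t, a <= s <= b -> c <= t <= d -> nm (k (gam s t)) <= m) ->
  nm (Jr k a b c d) <= 8 * (1 + b) * m * ((b - a) + (d - c)).
Proof.
move=> a0 ab c1 cd d1 dk km.
have m0 : 0 <= m by apply: le_trans (nm_ge0 _) (km a c _ _); rewrite lexx.
have b0 : 0 <= b := le_trans a0 ab.
have hs t : c <= t <= d -> nm (cint (fun s => (1 + 'i * ofR t) * k (gam s t)) a b) <= 4 * m * (b - a).
  move=> ht; have -> : 4 * m * (b - a) = 2 * (2 * m) * (b - a) by ring.
  apply: cint_bound => // s h; first by apply: rcont_s; exact: dk.
  rewrite nmM ler_pM ?nm_ge0 ?km //; apply: nm_1i.
  by case/andP: ht => h1 h2; rewrite (le_trans c1 h1) (le_trans h2 d1).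
have ht s : a <= s <= b -> nm (cint (fun t => 'i * ofR s * k (gam s t)) c d) <= 2 * (b * m) * (d - c).
  move=> h; apply: cint_bound => // t h'; first by apply: rcont_t; exact: dk.
  rewrite !nmM nm_i mul1r ler_pM ?nm_ge0 ?km // nm_ofR ger0_norm; case/andP: h => // h1 _.
  exact: le_trans a0 h1.
have bm : 0 <= b * m by rewrite mulr_ge0.
have w1 : 0 <= b - a by rewrite subr_ge0.
have w2 : 0 <= d - c by rewrite subr_ge0.
have e1 := hs c; have e2 := hs d; have e3 := ht a; have e4 := ht b.
rewrite !lexx ?ab ?cd in e1 e2 e3 e4.
move: (e1 isT) (e2 isT) (e3 isT) (e4 isT) => {e1 e2 e3 e4} e1 e2 e3 e4.
rewrite /Jr; apply: le_trans (nmBD _ _) _; apply: le_trans (lerD (nmBD _ _) e3) _.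
apply: le_trans (lerD (lerD (nmD _ _) e2) (lexx _)) _.
apply: le_trans (lerD (lerD (lerD e1 e4) (lexx _)) (lexx _)) _.
have h1 := mulr_ge0 m0 w1; have h2 := mulr_ge0 m0 w2.
have h3 := mulr_ge0 bm w1; have h4 := mulr_ge0 bm w2.
lra.
Qed.

Lemma gam_dist (b s t x y : R) : 0 <= x <= b -> -1 <= t <= 1 ->
  nm (gam s t - gam x y) <= (2 + b) * (`|s - x| + `|t - y|).
Proof.
move=> /andP[x0 xb] ht; have -> : gam s t - gam x y =
   ofR (s - x) * (1 + 'i * ofR t) + 'i * ofR x * ofR (t - y).
  by rewrite /gam !rmorphB /=; ring.
apply: le_trans (nmD _ _) _; rewrite !nmM nm_i mul1r !nm_ofR (ger0_norm x0).
have h1 := nm_1i ht.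
have h2 := ler_wpM2l (normr_ge0 (s - x)) h1; have h3 := ler_wpM2r (normr_ge0 (t - y)) xb.
have := mulr_ge0 (le_trans x0 xb) (normr_ge0 (s - x)); have := normr_ge0 (t - y).
lra.
Qed.

Lemma affine_primitive (u v p : C) : exists P : C -> C, forall z,
  dd P z (fun h => h * (u + v * (z - p))).
Proof.
exists (fun z => u * z + (v / 2) * ((z - p) * (z - p))) => z.
have D := ddB (dd_id z) (dd_cst p z).
apply: dd_eq (ddD (ddMl u (dd_id z)) (ddMl (v / 2) (ddM D D))) _ => h.
by rewrite subr0; field.
Qed.

(** A nonzero integral would yield arbitrarily small rectangles whose integral exceeds [e] times
    their area. Near the limit point [k] is affine up to a small remainder; the affine part has a
    primitive and contributes nothing, and the remainder contributes too little. *)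
Lemma goursat (k : C -> C) (a b c d : R) : 0 <= a -> a < b -> -1 <= c -> c < d -> d <= 1 ->
  diff_rect k a b c d -> Jr k a b c d = 0.
Proof.
move=> a0 ab c1 cd d1 dk; apply/eqP; rewrite -nm_eq0 eq_le nm_ge0 andbT leNgt; apply/negP => J0.
pose A := (b - a) * (d - c).
have A0 : 0 < A by rewrite mulr_gt0 ?subr_gt0.
(* Half of the ratio of integral to area, so that the initial rectangle satisfies the strict
   inequality of [Bad]. *)
pose e := nm (Jr k a b c d) / A / 2.
have e0 : 0 < e by rewrite !divr_gt0.
pose Bad a' b' c' d' := [/\ a <= a', b' <= b, c <= c', d' <= d &
  e * ((b' - a') * (d' - c')) < nm (Jr k a' b' c' d')].
have sub a' b' c' d' : a <= a' -> b' <= b -> c <= c' -> d' <= d -> diff_rect k a' b' c' d'.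
  move=> h1 h2 h3 h4 s t /andP[s1 s2] /andP[t1 t2]; apply: dk.
    by rewrite (le_trans h1 s1) (le_trans s2 h2).
  by rewrite (le_trans h3 t1) (le_trans t2 h4).
have [||x [y [hx hy H]]] := @bisection Bad a b c d ab cd.
- move=> a' b' c' d' ab' cd' [h1 h2 h3 h4 h5] m n.
  have am : a' < m by rewrite /m; lra.
  have mb : m < b' by rewrite /m; lra.
  have cn : c' < n by rewrite /n; lra.
  have nd : n < d' by rewrite /n; lra.
  have := Jr_split (ltW am) (ltW mb) (ltW cn) (ltW nd) (sub _ _ _ _ h1 h2 h3 h4).
  set J1 := Jr _ _ m _ n; set J2 := Jr _ _ m n _; set J3 := Jr _ m _ _ n; set J4 := Jr _ m _ n _ => E.
  have area : e * ((b' - a') * (d' - c')) =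
    e * ((m - a') * (n - c')) + e * ((m - a') * (d' - n)) + e * ((b' - m) * (n - c')) + e * ((b' - m) * (d' - n)).
    by ring.
  case: (ltP (e * ((m - a') * (n - c'))) (nm J1)) => b1; first by constructor 1; split=> //; lra.
  case: (ltP (e * ((m - a') * (d' - n))) (nm J2)) => b2; first by constructor 2; split=> //; lra.
  case: (ltP (e * ((b' - m) * (n - c'))) (nm J3)) => b3; first by constructor 3; split=> //; lra.
  case: (ltP (e * ((b' - m) * (d' - n))) (nm J4)) => b4; first by constructor 4; split=> //; lra.
  have t1 := nmD (J1 + J2 + J3) J4; have t2 := nmD (J1 + J2) J3; have t3 := nmD J1 J2.
  by move: h5; rewrite E area => h5; exfalso; clear -h5 b1 b2 b3 b4 t1 t2 t3; lra.
- split=> //; rewrite /e -/A [X in X < _](_ : _ = nm (Jr k a b c d) / 2); last by field; rewrite gt_eqF.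
  by rewrite ltr_pdivrMr // ltr_pMr // ltr1n.
have dkp := dk _ _ hx hy; set p := gam x y in dkp.
have /diffCP[_ Hd] := dkp.
have b0 : 0 < b := le_lt_trans a0 ab.
pose K := 2 + b; have K0 : 0 < K by rewrite /K; lra.
pose W := (b - a) + (d - c); have W0 : 0 < W by rewrite /W; lra.
(* Chosen so that the estimate of [Jr_bound] for the remainder on a rectangle scaled by [l] is at
   most [e * A * l ^+ 2], which is [e] times its area. *)
pose eta := e * A / (8 * (1 + b) * K * W ^+ 2).
have D0 : 0 < 8 * (1 + b) * K * W ^+ 2 by rewrite !mulr_gt0 // ?exprn_gt0 //; lra.
have eta0 : 0 < eta by rewrite divr_gt0 // mulr_gt0.
have [del del0 hdel] := Hd _ eta0.
(* A rectangle narrower than [lam] has scale [l < del / (K * W)], hence its image lies within [del]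
   of [p]. *)
pose lam := del / (K * W) * (b - a).
have lam0 : 0 < lam by rewrite mulr_gt0 ?divr_gt0 ?mulr_gt0 // subr_gt0.
have [a' [b' [c' [d' [[/andP[h1 h2] /andP[h3 h4]] [/andP[h5 h6] /andP[h7 h8]] [ab' wl] wE bad]]]]] := H _ lam0.
have [_ _ _ _ badJ] := bad.
pose l := (b' - a') / (b - a).
have w1 : b' - a' = l * (b - a) by rewrite /l mulfVK // subr_eq0 gt_eqF.
have w2 : d' - c' = l * (d - c) by [].
have l0 : 0 < l by rewrite divr_gt0 // subr_gt0.
have [q qE] := affine_primitive (k p) (derive1 k p) p.
pose aff z := k p + derive1 k p * (z - p).
pose rem z := k z - aff z.
have dq z : differentiable aff z.
  exact: dd_diff (ddD (dd_cst _ z) (ddMl _ (ddB (dd_id z) (dd_cst p z)))).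
have dk' := sub _ _ _ _ h1 h4 h5 h8.
have drem : diff_rect rem a' b' c' d'.
  by move=> s t hs ht; apply: differentiableB; [exact: dk' | exact: dq].
have JE : Jr k a' b' c' d' = Jr rem a' b' c' d'.
  have kE : k = fun z => aff z + rem z.
    by apply/funext => z; rewrite /rem (addrC (aff z)) subrK.
  rewrite {1}kE.
  have cd' : c' <= d' by rewrite -subr_ge0 w2 mulr_ge0 ?subr_ge0 ?ltW.
  have j1 : Jr aff a' b' c' d' = 0.
    exact: (Jr_prim (ltW ab') cd' (fun z => dd_diff (qE z)) (fun z h => dd_val h (qE z))).
  have d2 : diff_rect aff a' b' c' d' by move=> s t _ _; exact: dq.
  by rewrite (Jr_add (ltW ab') cd' d2 drem) j1 add0r.
have remb s t : a' <= s <= b' -> c' <= t <= d' -> nm (rem (gam s t)) <= eta * (K * (l * W)).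
  move=> /andP[s1 s2] /andP[t1 t2].
  have hd : nm (gam s t - p) <= K * (l * W).
    have hx0 : 0 <= x <= b by case/andP: hx => hx1 hx2; rewrite hx2 (le_trans a0 hx1).
    have ht1 : -1 <= t <= 1 by clear -c1 h5 t1 t2 h8 d1; apply/andP; split; lra.
    apply: le_trans (gam_dist s y hx0 ht1) _.
    rewrite ler_pM2l // /W mulrDr -w1 -w2 lerD //; clear -s1 s2 t1 t2 h2 h3 h6 h7;
      rewrite ler_norml; apply/andP; split; lra.
  have := hdel (gam s t - p); rewrite subrK.
  have -> : nm (gam s t - p) < del.
    apply: le_lt_trans hd _; rewrite mulrCA -ltr_pdivlMr ?mulr_gt0 //.
    by rewrite /l ltr_pdivrMr ?subr_gt0.
  move=> /(_ isT); rewrite derive1_dd // => h; rewrite /rem /aff opprD addrA.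
  rewrite [derive1 k p * _]mulrC; apply: le_trans h _.
  by rewrite ler_pM2l.
have := Jr_bound (le_trans a0 h1) (ltW ab') (le_trans c1 h5) (le_trans h6 h7) (le_trans h8 d1) drem remb.
rewrite -JE w1 w2 -mulrDr -/W => hJ.
move: badJ; rewrite ltNge => /negP; apply; apply: le_trans hJ _.
have hb : 8 * (1 + b') * (eta * (K * (l * W))) * (l * W) <= 8 * (1 + b) * (eta * (K * (l * W))) * (l * W).
  have lW : 0 <= l * W by rewrite ltW // mulr_gt0.
  have eKlW : 0 <= eta * (K * (l * W)).
    by apply: mulr_ge0; [exact: ltW | apply: mulr_ge0 => //; exact: ltW].
  by rewrite ler_wpM2r // ler_wpM2r // ler_wpM2l // lerD2l.
apply: le_trans hb _; apply: le_of_eq; rewrite w1 w2 /eta /A; field.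
by rewrite !gt_eqF //=; lra.
Qed.

End Goursat.

(** * Integrals along squares and Cauchy's formula for the derivative *)

Section SquareIntegral.
Variable R : realType.
Local Notation C := (Cplx R).

Definition edge (k : C -> C) (u : C) (r : R) : C :=
  cint (fun t => u * ('i * ofR r) * k (u * gam r t)) (-1) 1.

(* Integral of [k] along the boundary of the square of half-side [r] centred at 0,
   each side being the image of the right-hand side by a power of [i]. *)
Definition sqint (k : C -> C) (r : R) : C :=
  edge k 1 r + edge k 'i r + edge k (-1) r + edge k (- 'i) r.

Definition unit4 (u : C) := [\/ u = 1, u = 'i, u = -1 | u = - 'i].

Lemma nm_unit4 u : unit4 u -> nm u = 1.
Proof. by case=> ->; rewrite ?nmN ?nm1 ?nm_i. Qed.

(** The factor 2 makes room for the corners: by [nm_gam], the square of half-side [s] lies between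
    the circles of radii [s] and [2 * s]. *)
Definition cont_ring (k : C -> C) (a b : R) :=
  forall z, a <= nm z <= 2 * b -> {for z, continuous k}.

Lemma leN11 : (-1 : R) <= 1. Proof. by rewrite (le_trans (lerN10 _)). Qed.

Lemma rcont_comp (k : C -> C) (f : R -> C) t c : rder f t c -> {for f t, continuous k} ->
  rcont (fun t => k (f t)) t.
Proof.
move=> df /contCP ck e /ck[d d0 hd]; have [d' d'0 hd'] := rder_cont df d0.
by exists d' => // h /hd' /hd.
Qed.

Lemma rcontZ (u : C) (f : R -> C) t : rcont f t -> rcont (fun t => u * f t) t.
Proof.
move=> cf e e0; have k0 : 0 < nm u + 1 by rewrite ltr_wpDl ?nm_ge0.
have [d d0 hd] := cf _ (divr_gt0 e0 k0); exists d => // h /hd hh.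
rewrite -mulrBr nmM; apply: le_lt_trans (_ : (nm u + 1) * nm (f (t + h) - f t) < _).
  by rewrite ler_wpM2r ?nm_ge0 // lerDl.
by rewrite mulrC -ltr_pdivlMr.
Qed.

Lemma rcont_edge (k : C -> C) u (r a b : R) : unit4 u -> 0 < r -> a <= r <= b -> cont_ring k a b ->
  forall t : R, -1 <= t <= 1 -> rcont (fun t => u * ('i * ofR r) * k (u * gam r t)) t.
Proof.
move=> u4 r0 /andP[ar rb] ck t ht; apply: rcontZ.
have := rcont_comp (rderZ u (rder_gam_t r t)); apply.
apply: ck; rewrite nmZ (nm_unit4 u4) mul1r.
have /andP[h1 h2] := nm_gam (ltW r0) ht.
by rewrite (le_trans ar h1) (le_trans h2) // ler_pM2l.
Qed.

Lemma edgeD k1 k2 u r : unit4 u -> 0 < r -> cont_ring k1 r r -> cont_ring k2 r r ->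
  edge (fun z => k1 z + k2 z) u r = edge k1 u r + edge k2 u r.
Proof.
move=> u4 r0 c1 c2; have rr : r <= r <= r by rewrite lexx.
rewrite /edge -cintD ?leN11 //.
- by apply: eq_cint => t _; rewrite mulrDr.
- exact: rcont_edge u4 r0 rr c1.
- exact: rcont_edge u4 r0 rr c2.
Qed.

Lemma edgeZ c k u r : unit4 u -> 0 < r -> cont_ring k r r ->
  edge (fun z => c * k z) u r = c * edge k u r.
Proof.
move=> u4 r0 ck; have rr : r <= r <= r by rewrite lexx.
rewrite /edge -cintZ ?leN11 //; first by apply: eq_cint => t _; rewrite mulrCA.
exact: rcont_edge u4 r0 rr ck.
Qed.

Lemma edge_bound k u r m : unit4 u -> 0 < r -> cont_ring k r r ->
  (forall z, r <= nm z <= 2 * r -> nm (k z) <= m) -> nm (edge k u r) <= 4 * r * m.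
Proof.
move=> u4 r0 ck km; have rr : r <= r <= r by rewrite lexx.
have -> : 4 * r * m = 2 * (r * m) * (1 - -1) by ring.
apply: cint_bound; [exact: leN11 | exact: rcont_edge u4 r0 rr ck|].
move=> t ht; rewrite !nmM (nm_unit4 u4) nm_i nm_ofR (gtr0_norm r0) !mul1r ler_pM2l //.
by apply: km; rewrite nmM (nm_unit4 u4) mul1r; apply: nm_gam => //; exact: ltW.
Qed.

Let u1 : unit4 1. Proof. by constructor. Qed.
Let u2 : unit4 'i. Proof. by constructor 2. Qed.
Let u3 : unit4 (-1). Proof. by constructor 3. Qed.
Let u5 : unit4 (- 'i). Proof. by constructor 4. Qed.

Lemma sqintD k1 k2 r : 0 < r -> cont_ring k1 r r -> cont_ring k2 r r ->
  sqint (fun z => k1 z + k2 z) r = sqint k1 r + sqint k2 r.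
Proof. by move=> r0 c1 c2; rewrite /sqint !edgeD //; do ![move: (edge _ _ _) => ?]; ring. Qed.

Lemma sqintZ c k r : 0 < r -> cont_ring k r r -> sqint (fun z => c * k z) r = c * sqint k r.
Proof. by move=> r0 ck; rewrite /sqint !edgeZ // -!mulrDr. Qed.

Lemma sqint_bound k r m : 0 < r -> cont_ring k r r ->
  (forall z, r <= nm z <= 2 * r -> nm (k z) <= m) -> nm (sqint k r) <= 16 * r * m.
Proof.
move=> r0 ck km; have E u (h : unit4 u) := edge_bound h r0 ck km.
rewrite /sqint; apply: le_trans (nmD _ _) _; apply: le_trans (lerD (nmD _ _) (E _ u5)) _.
apply: le_trans (lerD (lerD (nmD _ _) (E _ u3)) (lexx _)) _.
apply: le_trans (lerD (lerD (lerD (E _ u1) (E _ u2)) (lexx _)) (lexx _)) _.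
by apply: le_of_eq; ring.
Qed.

Lemma eq_sqint k1 k2 r : 0 < r -> (forall z, r <= nm z <= 2 * r -> k1 z = k2 z) ->
  sqint k1 r = sqint k2 r.
Proof.
move=> r0 E; have Ed u : unit4 u -> edge k1 u r = edge k2 u r.
  move=> u4; apply: eq_cint => t ht; rewrite E // nmM (nm_unit4 u4) mul1r.
  by apply: nm_gam => //; exact: ltW.
by rewrite /sqint !Ed.
Qed.

(** The ring between the two squares is cut along the diagonals into four trapezoids, to each of
    which [goursat] applies. *)
Lemma sqint_const k (a b : R) : 0 < a -> a < b ->
  (forall z, a <= nm z <= 2 * b -> differentiable k z) -> sqint k a = sqint k b.
Proof.
move=> a0 ab dk.
pose ku u := fun z : C => u * k (u * z).
pose H u (c : R) := cint (fun s => (1 + 'i * ofR c) * ku u (gam s c)) a b.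
have G u : unit4 u -> edge k u b - edge k u a = H u 1 - H u (-1).
  move=> u4; have J : Jr (ku u) a b (-1) 1 = 0.
    apply: (goursat (ltW a0) ab (lexx _) _ (lexx _)); first exact: (lt_trans (ltrN10 _)).
    move=> s t /andP[s1 s2] ht.
    have s0 : 0 <= s := le_trans (ltW a0) s1.
    have /andP[h1 h2] := nm_gam s0 ht.
    have dz : differentiable k (u * gam s t).
      apply: dk; rewrite nmM (nm_unit4 u4) mul1r (le_trans s1 h1) (le_trans h2) //.
      by rewrite ler_pM2l.
    exact: dd_diff (ddMl u (dd_comp (ddMl u (dd_id (gam s t))) (ddP dz))).
  have Eb r : cint (fun t => 'i * ofR r * ku u (gam r t)) (-1) 1 = edge k u r.
    by apply: eq_cint => t _; rewrite /ku; ring.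
  move: J; rewrite /Jr !Eb -/(H u (-1)) -/(H u 1) => J.
  have -> : edge k u b - edge k u a = H u 1 - H u (-1) + (H u (-1) + edge k u b - H u 1 - edge k u a) by ring.
  by rewrite J addr0.
(* The lower diagonal of the side turned by ['i] is the upper diagonal of the preceding side, so the
   diagonal integrals cancel in pairs. *)
have T u : H (u * 'i) (-1) = H u 1.
  apply: eq_cint => s _; rewrite /ku.
  have i2 : ('i : C) * 'i = -1 by rewrite -expr2 sqrCi.
  have -> : u * 'i * gam s (-1) = u * gam s 1.
    rewrite /gam rmorphN rmorph1.
    have -> : u * 'i * (ofR s * (1 + 'i * -1)) = u * (ofR s * ('i - 'i * 'i)) by ring.
    by rewrite i2; ring.
  rewrite rmorphN rmorph1 !mulrA; congr (_ * _).
  have -> : (1 + 'i * -1) * u * 'i = ('i - 'i * 'i) * u by ring.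
  by rewrite i2; ring.
have T1 := T 1; have T2 := T 'i; have T3 := T (-1); have T4 := T (- 'i).
rewrite mul1r in T1; rewrite -expr2 sqrCi in T2; rewrite mulN1r in T3.
rewrite mulNr -expr2 sqrCi opprK in T4.
apply/eqP; rewrite eq_sym -subr_eq0 /sqint; apply/eqP.
have -> : forall x1 x2 x3 x4 y1 y2 y3 y4 : C, x1 + x2 + x3 + x4 - (y1 + y2 + y3 + y4) =
  (x1 - y1) + (x2 - y2) + (x3 - y3) + (x4 - y4) by move=> *; ring.
by rewrite !G // T1 T2 T3 T4; ring.
Qed.

Lemma diff_cont_ring k (a b : R) : (forall z, a <= nm z <= 2 * b -> differentiable k z) -> cont_ring k a b.
Proof. by move=> dk z hz; apply: differentiable_continuous; exact: dk. Qed.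

Lemma dd_inv (z : C) : z != 0 -> dd (fun z : C => z^-1) z (fun h => - z ^-2 * h).
Proof. by move=> z0; exact: ddV (dd_id z) z0. Qed.

Lemma ring_neq0 (a : R) (z : C) : 0 < a -> a <= nm z -> z != 0.
Proof. by move=> a0 az; rewrite -nm_gt0 (lt_le_trans a0). Qed.

(** This constant takes the place of 2 pi i in Cauchy's formula. *)
Definition sqc : C := sqint (fun z => z^-1) 1.

Lemma sqint_inv r : 0 < r -> sqint (fun z => z^-1) r = sqc.
Proof.
move=> r0; have D (a b : R) : 0 < a -> a < b -> sqint (fun z : C => z^-1) a = sqint (fun z : C => z^-1) b.
  move=> a0 ab; apply: (sqint_const a0 ab) => z /andP[h _].
  exact: dd_diff (dd_inv (ring_neq0 a0 h)).
by rewrite /sqc; case: (ltgtP r 1) => [h|h|-> //]; [exact: D | exact/esym/D].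
Qed.

Lemma gam1_neq0 (t : R) : 1 + 'i * ofR t != 0 :> C.
Proof.
by apply/eqP => /(congr1 (@reC R)); rewrite reCD reCM reCi !imC_ofR mul0r mulr0 subr0 addr0 => /eqP; rewrite oner_eq0.
Qed.

Lemma gam_neq0 (r t : R) : 0 < r -> gam r t != 0.
Proof.
by move=> r0; rewrite /gam mulf_neq0 ?gam1_neq0 // -nm_eq0 nm_ofR normr_eq0 gt_eqF.
Qed.

Lemma unit4_neq0 u : unit4 u -> u != 0.
Proof. by move=> /nm_unit4 h; rewrite -nm_eq0 h oner_eq0. Qed.

(** The four sides contribute equally. On one of them the integrand ['i / (1 + 'i t)] has imaginary
    part [1 / (1 + t ^+ 2)], which is positive, so its integral is not zero. *)
Lemma sqc_neq0 : sqc != 0.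
Proof.
pose e := cint (fun t : R => 'i * (1 + 'i * ofR t : C)^-1) (-1) 1.
have E u : unit4 u -> edge (fun z => z^-1) u 1 = e.
  move=> u4; apply: eq_cint => t _; rewrite /gam rmorph1 mulr1 mul1r.
  by field; rewrite gam1_neq0 unit4_neq0.
have -> : sqc = 4 * e by rewrite /sqc /sqint !E //; ring.
rewrite mulf_neq0 ?pnatr_eq0 //.
rewrite /e; have [|F pF ->] := @cint_prim R (fun t : R => 'i * (1 + 'i * ofR t : C)^-1) (-1) 1 leN11.
  move=> t ht; apply: rcontZ.
  have D := rder_dd (rder_aff (1 : C) 'i t) (dd_inv _).
  apply: (rder_rcont (y := - (1 + ofR t * 'i) ^-2 * 'i)).
  apply: rder_ext (D _) => [s|]; first by rewrite /GRing.scale /= mulrC.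
  by rewrite /GRing.scale /= mulrC gam1_neq0.
have [x hx] := mean_value leN11 (fun x hx => rder_im (pF x hx)).
move=> Ex; apply/eqP => F0.
have : imC (F 1 - F (-1)) = 0 by rewrite F0.
rewrite imCB [LHS]Ex => /eqP; rewrite mulf_eq0 opprK -(natrD _ 1 1) pnatr_eq0 orbF => /eqP h.
suff E2 : imC ('i * (1 + 'i * ofR x : C)^-1) = (1 + x ^+ 2)^-1.
  by move: h; rewrite E2 => /eqP; rewrite invr_eq0 gt_eqF // ltr_pwDl // sqr_ge0.
have -> : 'i * (1 + 'i * ofR x : C)^-1 = ofR (1 + x ^+ 2)^-1 * ('i + ofR x).
  have k0 : 1 + x ^+ 2 != 0 by rewrite gt_eqF // ltr_pwDl // sqr_ge0.
  have k1 : ofR (1 + x ^+ 2) != 0 :> C by rewrite -nm_eq0 nm_ofR normr_eq0.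
  rewrite fmorphV /=; apply: (mulfI k1); rewrite mulVKf //.
  apply: (mulIf (gam1_neq0 x)); rewrite -!mulrA mulVf ?gam1_neq0 // mulr1.
  rewrite rmorphD rmorph1 rmorphXn /=.
  have i2 : ('i : C) * 'i = -1 by rewrite -expr2 sqrCi.
  have -> : ('i + ofR x) * (1 + 'i * ofR x) = 'i + ('i * 'i) * ofR x + ofR x + 'i * ofR x ^+ 2 :> C by ring.
  by rewrite i2; ring.
by rewrite imC_ofRM imCD imCi imC_ofR addr0 mulr1.
Qed.

(** Turning a side by [u] multiplies its contribution by [u^-1], and the inverses of the four units
    sum to 0. *)
Lemma sqint_inv2 r : 0 < r -> sqint (fun z => z ^- 2) r = 0.
Proof.
move=> r0; pose e := edge (fun z => z ^- 2) 1 r.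
have ck : cont_ring (fun z : C => z ^- 2) r r.
  apply: diff_cont_ring => z /andP[h _]; have z0 := ring_neq0 r0 h.
  apply: (dd_diff (L := _)); apply: ddV (ddM (dd_id z) (dd_id z)) _.
  by rewrite mulf_neq0.
have E u : unit4 u -> edge (fun z => z ^- 2) u r = u^-1 * e.
  move=> u4; rewrite /e /edge -cintZ ?leN11 //.
    by apply: eq_cint => t _; field; rewrite gam_neq0 // unit4_neq0.
  by apply: (rcont_edge u1 r0 _ ck); rewrite lexx.
by rewrite /sqint !E // invr1 !invrN invr1; ring.
Qed.

(** Cauchy's integral for the derivative of [g] at 0. *)
Definition Lam (r : R) (g : C -> C) : C := sqc^-1 * sqint (fun z => g z * z ^- 2) r.

Definition lamC : R := 16 * nm sqc^-1.

Lemma lamC_ge0 : 0 <= lamC. Proof. by rewrite mulr_ge0 ?nm_ge0. Qed.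

Lemma cont_mul (f g : C -> C) z : {for z, continuous f} -> {for z, continuous g} ->
  {for z, continuous (fun z => f z * g z)}.
Proof. by move=> cf cg; exact: (@cvgM C C (nbhs z) _ f g _ _ cf cg). Qed.

Lemma cont_ringV2 (r : R) : 0 < r -> cont_ring (fun z : C => z ^- 2) r r.
Proof.
move=> r0; apply: diff_cont_ring => z /andP[h _]; have z0 := ring_neq0 r0 h.
apply: (dd_diff (L := _)); apply: ddV (ddM (dd_id z) (dd_id z)) _.
by rewrite mulf_neq0.
Qed.

Lemma cont_ring_lam (g : C -> C) r : 0 < r -> cont_ring g r r -> cont_ring (fun z => g z * z ^- 2) r r.
Proof. by move=> r0 cg z hz; apply: cont_mul; [exact: cg | exact: (cont_ringV2 r0)]. Qed.

Lemma LamD r f g : 0 < r -> cont_ring f r r -> cont_ring g r r ->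
  Lam r (fun z => f z + g z) = Lam r f + Lam r g.
Proof.
move=> r0 cf cg; rewrite /Lam -mulrDr -(sqintD r0 (cont_ring_lam r0 cf) (cont_ring_lam r0 cg)).
by congr (_ * _); apply: eq_sqint => // z _; rewrite mulrDl.
Qed.

Lemma LamZ r c f : 0 < r -> cont_ring f r r -> Lam r (fun z => c * f z) = c * Lam r f.
Proof.
move=> r0 cf; rewrite /Lam mulrCA -(sqintZ c r0 (cont_ring_lam r0 cf)).
by congr (_ * _); apply: eq_sqint => // z _; rewrite mulrA.
Qed.

Lemma eq_Lam r f g : 0 < r -> (forall z, r <= nm z <= 2 * r -> f z = g z) -> Lam r f = Lam r g.
Proof. by move=> r0 E; congr (_ * _); apply: eq_sqint => // z /E ->. Qed.

Lemma Lam_bound r f m : 0 < r -> cont_ring f r r ->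
  (forall z, r <= nm z <= 2 * r -> nm (f z) <= m) -> nm (Lam r f) <= lamC / r * m.
Proof.
move=> r0 cf fm; rewrite /Lam nmM /lamC.
have H : nm (sqint (fun z => f z * z ^- 2) r) <= 16 * r * (m / r ^+ 2).
  apply: (sqint_bound r0 (cont_ring_lam r0 cf)) => z hz.
  rewrite nmM nmV nmX ler_pM ?nm_ge0 ?fm ?invr_ge0 ?exprn_ge0 ?nm_ge0 //.
  case/andP: hz => hz _; rewrite lef_pV2 ?posrE ?exprn_gt0 // ?(lt_le_trans r0) //.
  by rewrite lerXn2r // nnegrE ?nm_ge0 // ltW.
apply: le_trans (ler_wpM2l (nm_ge0 _) H) _; apply: le_of_eq; field.
by rewrite gt_eqF.
Qed.

Lemma small_zero (x k : R) : 0 <= x -> (forall e, 0 < e -> x <= k * e) -> x = 0.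
Proof.
move=> x0 H; apply/eqP; rewrite eq_le x0 andbT leNgt; apply/negP => x1.
have k1 : 0 < `|k| + 1 by rewrite ltr_wpDl.
have := H _ (divr_gt0 x1 (mulr_gt0 (ltr0Sn _ 1) k1)).
have -> : k * (x / (2 * (`|k| + 1))) = x * (k / (`|k| + 1) / 2) by field; rewrite gt_eqF.
rewrite leNgt => /negP; apply; rewrite -[ltRHS]mulr1 ltr_pM2l // ltr_pdivrMr // mul1r ltr_pdivrMr //.
by have := ler_norm k; have := normr_ge0 k; lra.
Qed.

(* The double pole of [(f (a + z) - f a - z f' a) / z^2] is removable, so its integral over
   small squares tends to 0, while it does not depend on the square by Goursat's lemma. *)
Lemma cauchy_derive (f : C -> C) (a : C) (r d : R) : 0 < r -> 2 * r < d ->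
  (forall z, nm (z - a) < d -> differentiable f z) ->
  derive1 f a = Lam r (fun z => f (a + z)).
Proof.
move=> r0 rd df; have d0 : 0 < d by apply: lt_trans rd; rewrite mulr_gt0.
have dfa z : nm z < d -> differentiable (fun z => f (a + z)) z.
  move=> hz; have dz : differentiable f (a + z) by apply: df; rewrite addrC addKr.
  exact: dd_diff (dd_comp (ddD (dd_cst a z) (dd_id z)) (ddP dz)).
pose f1 := derive1 f a.
pose q z := f (a + z) * z ^- 2 + ((- f a) * z ^- 2 + (- f1) * z^-1).
have dV2 z : z != 0 -> differentiable (fun z : C => z ^- 2) z.
  by move=> z0; apply: (dd_diff (L := _)); apply: ddV (ddM (dd_id z) (dd_id z)) _; rewrite mulf_neq0.
have dq z : z != 0 -> nm z < d -> differentiable q z.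
  move=> z0 zd; exact: dd_diff (ddD (ddM (ddP (dfa z zd)) (ddP (dV2 z z0)))
    (ddD (ddMl (- f a) (ddP (dV2 z z0))) (ddMl (- f1) (dd_inv z0)))).
have ringd (e : R) (z : C) : 0 < e -> e <= r -> e <= nm z <= 2 * e -> z != 0 /\ nm z < d.
  move=> e0 er /andP[h1 h2]; split; first exact: (ring_neq0 e0 h1).
  by apply: le_lt_trans h2 (le_lt_trans _ rd); rewrite ler_pM2l.
have cq (e : R) : 0 < e -> e <= r -> cont_ring q e e.
  by move=> e0 er; apply: diff_cont_ring => z /(ringd e z e0 er)[h1 h2]; exact: dq.
have q0 : sqint q r = 0.
  apply/eqP; rewrite -nm_eq0; apply/eqP; apply: (@small_zero _ 16); first exact: nm_ge0.
  move=> eta eta0; have dfA : differentiable f a by apply: df; rewrite subrr nm0.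
  have /diffCP[_ /(_ eta eta0)[del del0 hdel]] := dfA.
  pose e := Num.min (r / 2) (del / 4).
  have e0 : 0 < e by rewrite lt_min !divr_gt0.
  have er : e < r by rewrite gt_min; apply/orP; left; lra.
  have ed : 2 * e < del.
    by have : e <= del / 4 by [rewrite ge_min lexx orbT]; lra.
  have dqr z : e <= nm z <= 2 * r -> differentiable q z.
    move=> /andP[h1 h2]; apply: dq; first exact: (ring_neq0 e0 h1).
    exact: le_lt_trans h2 rd.
  rewrite -(sqint_const e0 er dqr).
  have -> : 16 * eta = 16 * e * (eta / e) by field; rewrite gt_eqF.
  apply: (sqint_bound e0 (cq e e0 (ltW er))) => z /andP[h1 h2]; have z0 := ring_neq0 e0 h1.
  have nz0 : 0 < nm z := lt_le_trans e0 h1.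
  have := hdel z (le_lt_trans h2 ed); rewrite derive1_dd // -/f1 => H.
  have -> : q z = (f (z + a) - f a - z * f1) * z ^- 2.
    by rewrite /q [a + z]addrC; field.
  rewrite nmM nmV nmX; apply: le_trans (_ : eta * nm z * (nm z ^+ 2)^-1 <= _).
    by rewrite ler_wpM2r // invr_ge0 exprn_ge0 // nm_ge0.
  have -> : eta * nm z * (nm z ^+ 2)^-1 = eta / nm z by field; rewrite gt_eqF.
  by rewrite ler_pM2l // lef_pV2.
have rr : r <= r by [].
have cV2 := cont_ringV2 r0.
have cV1 : cont_ring (fun z : C => z^-1) r r.
  by apply: diff_cont_ring => z /(ringd r z r0 rr)[z0 _]; exact: dd_diff (dd_inv z0).
have cf : cont_ring (fun z => f (a + z) * z ^- 2) r r.
  apply: diff_cont_ring => z /(ringd r z r0 rr)[z0 zd].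
  exact: dd_diff (ddM (ddP (dfa z zd)) (ddP (dV2 z z0))).
have cc : cont_ring (fun _ : C => - f a) r r by move=> z _; exact: cst_continuous.
have cc1 : cont_ring (fun _ : C => - f1) r r by move=> z _; exact: cst_continuous.
have c1 : cont_ring (fun z => (- f a) * z ^- 2) r r by move=> z hz; apply: cont_mul; [exact: cc | exact: cV2].
have c2 : cont_ring (fun z : C => (- f1) * z^-1) r r by move=> z hz; apply: cont_mul; [exact: cc1 | exact: cV1].
have c12 : cont_ring (fun z => (- f a) * z ^- 2 + (- f1) * z^-1) r r.
  by move=> z hz; exact: (@cvgD C C _ (nbhs z) _ _ _ _ _ (c1 z hz) (c2 z hz)).
move: q0; rewrite /q (sqintD r0 cf c12) (sqintD r0 c1 c2) (sqintZ _ r0 cV2) (sqintZ _ r0 cV1).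
rewrite (sqint_inv2 r0) (sqint_inv r0) mulr0 add0r mulNr => /eqP; rewrite subr_eq0 => /eqP E.
by rewrite /Lam E mulrC mulfK // sqc_neq0.
Qed.

End SquareIntegral.

(** * Derivatives of holomorphic functions *)

Section HolomorphicDerivatives.
Variable R : realType.
Local Notation C := (Cplx R).
Local Notation K := (lamC R).

Definition hol_ball (V : normedModType C) (f : V -> C) (x : V) (d : R) :=
  forall y, nm (y - x) < d -> differentiable f y.

Lemma segment_mvt (V : normedModType C) (f : V -> C) (x v : V) (m : R) :
  (forall t : R, 0 <= t <= 1 -> differentiable f (x + ofR t *: v)) ->
  (forall t : R, 0 <= t <= 1 -> nm ('d f (x + ofR t *: v) v) <= m) ->
  nm (f (x + v) - f x) <= 2 * m.
Proof.
move=> df dm.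
have D (t : R) : 0 <= t <= 1 -> rder (fun t => f (x + ofR t *: v)) t ('d f (x + ofR t *: v) v).
  by move=> /df dft; exact: (rder_dd (rder_aff x v t) (ddP dft)).
have := rder_mvt ler01 D dm.
by rewrite rmorph1 scale1r rmorph0 scale0r addr0 subr0 mulr1.
Qed.

Lemma ball_segment (V : normedModType C) (x y v : V) (d : R) (t : R) :
  nm (y - x) < d -> nm (y + v - x) < d -> 0 <= t <= 1 -> nm (y + ofR t *: v - x) < d.
Proof.
move=> h1 h2 /andP[t0 t1].
have -> : y + ofR t *: v - x = ofR (1 - t) *: (y - x) + ofR t *: (y + v - x).
  rewrite [y + v - x]addrAC [ofR t *: (_ + v)]scalerDr addrA -scalerDl -rmorphD subrK rmorph1 scale1r.
  by rewrite addrAC.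
apply: le_lt_trans (nmD _ _) _; rewrite !nmZ !nm_ofR !ger0_norm ?subr_ge0 //.
have [t1'|t1'] := eqVneq t 1; first by rewrite t1' subrr mul0r add0r mul1r.
have t1'' : 0 < 1 - t by rewrite subr_gt0 lt_neqAle t1' t1.
have e1 : (1 - t) * nm (y - x) < (1 - t) * d by rewrite ltr_pM2l.
have e2 : t * nm (y + v - x) <= t * d by rewrite ler_wpM2l // ltW.
lra.
Qed.

Lemma line_diff (V : normedModType C) (f : V -> C) (x v : V) (z : C) :
  differentiable f (x + z *: v) ->
  dd (fun z : C => f (x + z *: v)) z (fun h : C => h *: 'd f (x + z *: v) v).
Proof.
move=> df.
have D : dd (fun z : C => x + z *: v) z (fun h : C => h *: v).
  have E : dd (fun z : C => z *: v) z (fun h : C => h *: v).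
    have [d1 d2] := dd_id z; split; first exact: (@differentiableZl C C V id v z d1).
    by rewrite (@diffZl C C V id v z d1) d2.
  by apply: dd_eq (ddD (dd_cst x z) E) _ => h; rewrite add0r.
by apply: dd_eq (dd_comp D (ddP df)) _ => h; rewrite linearZ.
Qed.

Lemma line_derive1 (V : normedModType C) (f : V -> C) (x v : V) (z : C) :
  differentiable f (x + z *: v) ->
  derive1 (fun z : C => f (x + z *: v)) z = 'd f (x + z *: v) v.
Proof. by move=> df; apply: dd_derive1; exact: line_diff. Qed.

(** Cauchy's formula on the complex line through [x] in the direction [v]. The case [v = 0] is
    separate because the disc of the line inside the ball has radius [d / nm v]. *)
Lemma dir_cauchy (V : normedModType C) (f : V -> C) (x v : V) (r d : R) :
  0 < r -> 2 * r * nm v < d -> hol_ball f x d ->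
  'd f x v = Lam r (fun z : C => f (x + z *: v)).
Proof.
move=> r0 rd hf.
have [v0|v0] := eqVneq v 0.
  rewrite v0 linear0; symmetry.
  have -> : Lam r (fun z : C => f (x + z *: 0)) = Lam r (fun z : C => (fun _ : C => f x) (0 + z)).
    by apply: eq_Lam => // z _; rewrite scaler0 addr0.
  rewrite -(@cauchy_derive R (fun _ : C => f x) 0 r (2 * r + 1) r0); first 1 last.
  - by rewrite ltrDl.
  - by move=> z _; exact: dd_diff (dd_cst (f x) z).
  by apply: dd_derive1; apply: dd_eq (dd_cst (f x) 0) _ => h; rewrite scaler0.
have nv : 0 < nm v by rewrite nm_gt0.
have E : 'd f x v = derive1 (fun z : C => f (x + z *: v)) 0.
  by rewrite line_derive1 scale0r addr0 //; apply: hf; rewrite subrr nm0 (le_lt_trans _ rd) // !mulr_ge0 ?nm_ge0 // ltW.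
rewrite E (@cauchy_derive R _ 0 r (d / nm v) r0).
- by apply: eq_Lam => // z _; rewrite add0r.
- by rewrite ltr_pdivlMr.
- move=> z; rewrite subr0 ltr_pdivlMr // => hz.
  have dz : differentiable f (x + z *: v) by apply: hf; rewrite addrC addKr nmZ.
  exact: dd_diff (line_diff dz).
Qed.

Lemma line_cont_ring (V : normedModType C) (f : V -> C) (x v : V) (r d : R) :
  2 * r * nm v < d -> hol_ball f x d -> cont_ring (fun z : C => f (x + z *: v)) r r.
Proof.
move=> rd hf; apply: diff_cont_ring => z /andP[_ hz].
have dz : differentiable f (x + z *: v).
  by apply: hf; rewrite addrC addKr nmZ (le_lt_trans _ rd) // ler_wpM2r ?nm_ge0.
exact: dd_diff (line_diff dz).
Qed.

Section Bounded.
Variables (V : normedModType C) (f : V -> C) (x0 : V) (d M : R).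
Hypotheses (d0 : 0 < d) (hf : hol_ball f x0 d) (fM : forall y, nm (y - x0) < d -> nm (f y) <= M).

Lemma hol_ball_sub x e : nm (x - x0) + e <= d -> hol_ball f x e.
Proof.
move=> xe y hy; apply: hf; apply: le_lt_trans (nm_dist y x0 x) _.
by apply: lt_le_trans xe; rewrite addrC ltrD2l.
Qed.

Lemma M_ge0 : 0 <= M.
Proof. by apply: le_trans (nm_ge0 _) (fM (y := x0) _); rewrite subrr nm0. Qed.

Lemma coef_ge0 (n : nat) : 0 <= n%:R * K ^+ 2 * M / d ^+ 2.
Proof.
apply: divr_ge0; last by apply: exprn_ge0; exact: ltW.
by rewrite mulr_ge0 ?M_ge0 // mulr_ge0 // exprn_ge0 // lamC_ge0.
Qed.

Lemma in_ball y x (z : C) v e : nm (x - x0) + e <= d -> y = x + z *: v -> nm z * nm v < e -> nm (y - x0) < d.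
Proof.
move=> xe -> zv; apply: le_lt_trans (nm_dist _ x0 x) _.
by apply: lt_le_trans xe; rewrite (addrC x) addrK nmZ addrC ltrD2l.
Qed.

(** Cauchy's estimate on a square of the line; taking its half-side inversely proportional to [nm v]
    makes the bound linear in [v]. *)
Lemma dir_bound x v : nm (x - x0) < d / 2 -> nm ('d f x v) <= 8 * K * M / d * nm v.
Proof.
have d0' := d0; move=> hx; have [->|v0] := eqVneq v 0; first by rewrite linear0 !nm0 mulr0.
have nv : 0 < nm v by rewrite nm_gt0.
pose r := d / (8 * nm v).
have r0 : 0 < r by rewrite divr_gt0 // mulr_gt0.
have rv : 2 * r * nm v < d / 2.
  have -> : 2 * r * nm v = d / 4 by rewrite /r; field; rewrite gt_eqF.
  lra.
have hx' : nm (x - x0) + d / 2 <= d by lra.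
have hfx := hol_ball_sub hx'.
rewrite (dir_cauchy r0 rv hfx).
have -> : 8 * K * M / d * nm v = K / r * M by rewrite /r; field; rewrite !gt_eqF.
apply: (Lam_bound r0 (line_cont_ring rv hfx)) => z /andP[_ hz].
by apply: fM; apply: (in_ball hx' (erefl _)); apply: le_lt_trans rv; rewrite ler_wpM2r ?nm_ge0.
Qed.

Lemma f_lipschitz x y : nm (x - x0) < d / 2 -> nm (y - x0) < d / 2 ->
  nm (f y - f x) <= 16 * K * M / d * nm (y - x).
Proof.
have d0' := d0; move=> hx hy; have -> : f y = f (x + (y - x)) by rewrite addrC subrK.
have hy' : nm (x + (y - x) - x0) < d / 2 by rewrite [x + _]addrC subrK.
have hs t := @ball_segment V x0 x (y - x) (d / 2) t hx hy'.
have -> : 16 * K * M / d * nm (y - x) = 2 * (8 * K * M / d * nm (y - x)) by ring.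
apply: segment_mvt => t ht; last by apply: dir_bound; exact: hs.
by apply: hf; apply: lt_trans (hs t ht) _; lra.
Qed.

(** The difference of the two differentials is the Cauchy integral of a difference of values of [f],
    to which the Lipschitz bound for [f] applies. *)
Lemma dir_lipschitz x y v : nm (x - x0) < d / 4 -> nm (y - x0) < d / 4 ->
  nm ('d f y v - 'd f x v) <= 256 * K ^+ 2 * M / d ^+ 2 * nm v * nm (y - x).
Proof.
have d0' := d0; move=> hx hy; have [->|v0] := eqVneq v 0; first by rewrite (linear0 ('d f y)) (linear0 ('d f x)) subrr !nm0 mulr0 mul0r.
have nv : 0 < nm v by rewrite nm_gt0.
pose r := d / (16 * nm v).
have r0 : 0 < r by rewrite divr_gt0 // mulr_gt0.
have rv : 2 * r * nm v < d / 4.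
  have -> : 2 * r * nm v = d / 8 by rewrite /r; field; rewrite gt_eqF.
  lra.
have hx' : nm (x - x0) + d / 4 <= d by lra.
have hy' : nm (y - x0) + d / 4 <= d by lra.
have hfx := hol_ball_sub hx'; have hfy := hol_ball_sub hy'.
have cx := line_cont_ring rv hfx; have cy := line_cont_ring rv hfy.
have cN : cont_ring (fun z : C => -1 * f (x + z *: v)) r r.
  by move=> z hz; apply: cont_mul; [exact: cst_continuous | exact: cx].
have E : 'd f y v - 'd f x v = Lam r (fun z : C => f (y + z *: v) + -1 * f (x + z *: v)).
  by rewrite (LamD r0 cy cN) (LamZ _ r0 cx) mulN1r (dir_cauchy r0 rv hfx) (dir_cauchy r0 rv hfy).
rewrite E.
have cs : cont_ring (fun z : C => f (y + z *: v) + -1 * f (x + z *: v)) r r.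
  by move=> z hz; exact: (@cvgD C C _ (nbhs z) _ _ _ _ _ (cy z hz) (cN z hz)).
have -> : 256 * K ^+ 2 * M / d ^+ 2 * nm v * nm (y - x) = K / r * (16 * K * M / d * nm (y - x)).
  by rewrite /r; field; rewrite !gt_eqF.
apply: (Lam_bound r0 cs) => z /andP[_ hz]; rewrite mulN1r.
have zv : nm z * nm v < d / 4 by apply: le_lt_trans rv; rewrite ler_wpM2r ?nm_ge0.
have I u : nm (u - x0) < d / 4 -> nm (u + z *: v - x0) < d / 2.
  move=> hu; apply: le_lt_trans (nm_dist _ x0 u) _; rewrite (addrC u) addrK nmZ; lra.
apply: le_trans (f_lipschitz (I _ hx) (I _ hy)) _.
by rewrite [y + _]addrC [x + _]addrC opprD addrACA subrr add0r.
Qed.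

(** The mean value inequality is applied to [f] minus its linear part at [x]. The constant is
    uniform in [x], as differentiation under the integral requires. *)
Lemma taylor2 x h : nm (x - x0) < d / 8 -> nm h < d / 8 ->
  nm (f (h + x) - f x - 'd f x h) <= 512 * K ^+ 2 * M / d ^+ 2 * nm h ^+ 2.
Proof.
have d0' := d0; move=> hx hh.
pose g y := f y - 'd f x (y - x).
have dg y : differentiable f y -> dd g y (fun k => 'd f y k - 'd f x k).
  move=> dfy; apply: (ddB (ddP dfy)).
  have dfx : differentiable f x by apply: hf; lra.
  have [m m0 hm] := lin_bounded (diff_continuous dfx).
  apply: dd_eq (dd_comp (ddB (dd_id y) (dd_cst x y)) (dd_lin (L := 'd f x) _ hm)) _ => k.
  by rewrite subr0.
have hin (t : R) : 0 <= t <= 1 -> nm (x + ofR t *: h - x0) < d / 4.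
  move=> /andP[t0 t1]; apply: le_lt_trans (nm_dist _ x0 x) _; rewrite (addrC x) addrK nmZ nm_ofR ger0_norm //.
  have : t * nm h <= 1 * nm h by rewrite ler_wpM2r ?nm_ge0.
  lra.
have D (t : R) : 0 <= t <= 1 -> differentiable f (x + ofR t *: h).
  by move=> /hin ht; apply: hf; lra.
have := @segment_mvt V g x h (256 * K ^+ 2 * M / d ^+ 2 * nm h * nm h).
rewrite /g [x + h]addrC addrK subrr linear0 subr0 addrAC => H.
have -> : 512 * K ^+ 2 * M / d ^+ 2 * nm h ^+ 2 = 2 * (256 * K ^+ 2 * M / d ^+ 2 * nm h * nm h) by ring.
apply: H => t ht; first exact: dd_diff (dg _ (D t ht)).
rewrite (dd_val _ (dg _ (D t ht))).
have hx4 : nm (x - x0) < d / 4 by lra.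
apply: le_trans (dir_lipschitz _ hx4 (hin t ht)) _.
have k0 : 0 <= 256 * K ^+ 2 * M / d ^+ 2 * nm h.
  by rewrite mulr_ge0 ?nm_ge0 ?(coef_ge0 256).
rewrite ler_wpM2l //; rewrite (addrC x) addrK nmZ nm_ofR; case/andP: ht => t0 t1.
by rewrite ger0_norm // ler_piMl ?nm_ge0.
Qed.

End Bounded.

(** By [dir_cauchy] the directional derivative is an integral of [f] over translates of a fixed
    square; the uniform quadratic remainder of [taylor2] justifies differentiation under the
    integral sign. *)
Lemma linear_lam (V : normedModType C) (f : V -> C) (x0 v : V) (d M r : R) :
  0 < d -> hol_ball f x0 d -> (forall y, nm (y - x0) < d -> nm (f y) <= M) ->
  0 < r -> 2 * r * nm v < d / 8 ->
  dd (fun x => 'd f x v) x0 (fun h => Lam r (fun z : C => 'd f (x0 + z *: v) h)).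
Proof.
move=> d0 hf fM r0 rv; pose L h := Lam r (fun z : C => 'd f (x0 + z *: v) h).
change (dd (fun x => 'd f x v) x0 L).
have zin (z : C) : r <= nm z <= 2 * r -> nm (x0 + z *: v - x0) < d / 8.
  by move=> /andP[_ hz]; rewrite addrC addKr nmZ (le_lt_trans _ rv) // ler_wpM2r ?nm_ge0.
have M0 := M_ge0 d0 fM.
have K0 := lamC_ge0 R.
have cL h : cont_ring (fun z : C => 'd f (x0 + z *: v) h) r r.
  move=> z /zin hz; apply/contCP => e e0.
  pose k := 256 * K ^+ 2 * M / d ^+ 2 * nm h * nm v + 1.
  have k0 : 0 < k.
    exact: (ltr_wpDl (mulr_ge0 (mulr_ge0 (coef_ge0 d0 fM 256) (nm_ge0 h)) (nm_ge0 v)) ltr01).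
  have n0 : 0 < nm v + 1 by rewrite ltr_wpDl ?nm_ge0.
  exists (Num.min (e / k) (d / 8 / (nm v + 1))) => [|y].
    by rewrite lt_min !divr_gt0.
  rewrite lt_min => /andP[]; rewrite (ltr_pdivlMr _ _ k0) (ltr_pdivlMr _ _ n0) => y1 y2.
  have yz : nm (y - z) * nm v < d / 8.
    by apply: le_lt_trans y2; rewrite ler_wpM2l ?nm_ge0 // lerDl.
  have hz4 : nm (x0 + z *: v - x0) < d / 4 by lra.
  have hy4 : nm (x0 + y *: v - x0) < d / 4.
    apply: le_lt_trans (nm_dist _ x0 (x0 + z *: v)) _.
    have -> : x0 + y *: v - (x0 + z *: v) = (y - z) *: v.
      by rewrite opprD addrACA subrr add0r scalerBl.
    by rewrite nmZ; lra.
  apply: le_lt_trans (dir_lipschitz d0 hf fM h hz4 hy4) _.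
  have -> : x0 + y *: v - (x0 + z *: v) = (y - z) *: v.
    by rewrite opprD addrACA subrr add0r scalerBl.
  rewrite nmZ; apply: le_lt_trans y1; rewrite /k mulrDr mulr1.
  have := nm_ge0 (y - z).
  have -> : 256 * K ^+ 2 * M / d ^+ 2 * nm h * (nm (y - z) * nm v) =
     nm (y - z) * (256 * K ^+ 2 * M / d ^+ 2 * nm h * nm v) by ring.
  by rewrite lerDl.
have linL : linear L.
  move=> a h k; rewrite /L.
  have cZ : cont_ring (fun z : C => a * 'd f (x0 + z *: v) h) r r.
    by move=> z hz; apply: cont_mul; [exact: cst_continuous | exact: cL].
  rewrite [a *: Lam _ _](esym (LamZ a r0 (cL h))) -(LamD r0 cZ (cL k)).
  by apply: eq_Lam => // z _; rewrite linearP.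
pose L' : {linear V -> C} := HB.pack L (GRing.isLinear.Build C V C _ L linL).
have LE h : L' h = L h by [].
have bL h : nm (L' h) <= K / r * (8 * K * M / d) * nm h.
  rewrite LE -mulrA; apply: (Lam_bound r0 (cL h)) => z /zin hz.
  by apply: (dir_bound d0 hf fM); lra.
have [||D1 D2] := @diffC_intro R V C (fun x => 'd f x v) x0 L'; last by split.
- exact: bounded_lin bL.
- move=> e e0.
  pose k := K / r * (512 * K ^+ 2 * M / d ^+ 2) + 1.
  have k0 : 0 < k.
    exact: (ltr_wpDl (mulr_ge0 (divr_ge0 K0 (ltW r0)) (coef_ge0 d0 fM 512)) ltr01).
  exists (Num.min (d / 8) (e / k)) => [|h]; first by rewrite lt_min !divr_gt0.
  rewrite lt_min => /andP[h1]; rewrite (ltr_pdivlMr _ _ k0) => h2.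
  have hf1 : hol_ball f (h + x0) (d / 8).
    by apply: (hol_ball_sub hf); rewrite addrK; lra.
  have hf2 : hol_ball f x0 (d / 8).
    by apply: (hol_ball_sub hf); rewrite subrr nm0; lra.
  have c1 := line_cont_ring rv hf1; have c2 := line_cont_ring rv hf2.
  have cN g : cont_ring g r r -> cont_ring (fun z : C => -1 * g z) r r.
    by move=> cg z hz; apply: cont_mul; [exact: cst_continuous | exact: cg].
  have cA g g' : cont_ring g r r -> cont_ring g' r r -> cont_ring (fun z : C => g z + g' z) r r.
    by move=> cg cg' z hz; exact: (@cvgD C C _ (nbhs z) _ _ _ _ _ (cg z hz) (cg' z hz)).
  have E : 'd f (h + x0) v - 'd f x0 v - L' h =
    Lam r (fun z : C => f (h + x0 + z *: v) + -1 * (f (x0 + z *: v)) + -1 * 'd f (x0 + z *: v) h).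
    rewrite (LamD r0 (cA _ _ c1 (cN _ c2)) (cN _ (cL h))) (LamD r0 c1 (cN _ c2)).
    rewrite (LamZ _ r0 c2) (LamZ _ r0 (cL h)) !mulN1r LE /L.
    by rewrite (dir_cauchy r0 rv hf1) (dir_cauchy r0 rv hf2).
  rewrite E.
  apply: le_trans (_ : K / r * (512 * K ^+ 2 * M / d ^+ 2 * nm h ^+ 2) <= _).
    apply: (Lam_bound r0 (cA _ _ (cA _ _ c1 (cN _ c2)) (cN _ (cL h)))) => z /zin hz.
    rewrite !mulN1r; have := taylor2 d0 hf fM hz h1.
    by rewrite (addrA h).
  apply: le_trans (_ : nm h * k * nm h <= _); last by rewrite ler_wpM2r ?nm_ge0 // ltW.
  have -> : K / r * (512 * K ^+ 2 * M / d ^+ 2 * nm h ^+ 2) =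
    nm h * (K / r * (512 * K ^+ 2 * M / d ^+ 2)) * nm h by ring.
  by rewrite ler_wpM2r ?nm_ge0 // ler_wpM2l ?nm_ge0 // lerDl.
Qed.

Lemma locally_bounded (V : normedModType C) (f : V -> C) (x : V) (d : R) : 0 < d ->
  hol_ball f x d -> exists e M, [/\ 0 < e, e <= d & forall y, nm (y - x) < e -> nm (f y) <= M].
Proof.
move=> d0 hf; have dfx : differentiable f x by apply: hf; rewrite subrr nm0.
have /contCP/(_ 1 ltr01)[e e0 he] := differentiable_continuous dfx.
exists (Num.min e d), (1 + nm (f x)); split; first by rewrite lt_min e0.
  by rewrite ge_min lexx orbT.
move=> y; rewrite lt_min => /andP[/he h _].
have := nmD (f y - f x) (f x); rewrite subrK; lra.
Qed.

Theorem dir_differentiable (V : normedModType C) (f : V -> C) (x v : V) (d : R) : 0 < d ->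
  hol_ball f x d -> differentiable (fun y => 'd f y v) x.
Proof.
move=> d0 hf; have [e [M [e0 ed fM]]] := locally_bounded d0 hf.
have hfe : hol_ball f x e by move=> y hy; apply: hf; exact: lt_le_trans ed.
have n0 : 0 < nm v + 1 by rewrite ltr_wpDl ?nm_ge0.
have r0 : 0 < e / (32 * (nm v + 1)) by rewrite divr_gt0 // mulr_gt0.
apply: dd_diff (linear_lam e0 hfe fM r0 _).
have -> : 2 * (e / (32 * (nm v + 1))) * nm v = e / 16 * (nm v / (nm v + 1)) by field; rewrite gt_eqF.
apply: le_lt_trans (_ : e / 16 * 1 < _); last lra.
by rewrite ler_wpM2l ?divr_ge0 // ?(ltW e0) // ler_pdivrMr // mul1r lerDl.
Qed.

(** The integral given by [linear_lam] for the left side is also Cauchy's formula, along [v], for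
    the function ['d f y w] of [y]. *)
Theorem dir_symmetric (V : normedModType C) (f : V -> C) (x v w : V) (d : R) : 0 < d ->
  hol_ball f x d -> 'd (fun y => 'd f y v) x w = 'd (fun y => 'd f y w) x v.
Proof.
move=> d0 hf; have [e [M [e0 ed fM]]] := locally_bounded d0 hf.
have hfe : hol_ball f x e by move=> y hy; apply: hf; exact: lt_le_trans ed.
have n0 : 0 < nm v + 1 by rewrite ltr_wpDl ?nm_ge0.
pose r := e / (32 * (nm v + 1)).
have r0 : 0 < r by rewrite divr_gt0 // mulr_gt0.
have rv : 2 * r * nm v < e / 8.
  have -> : 2 * r * nm v = e / 16 * (nm v / (nm v + 1)) by rewrite /r; field; rewrite gt_eqF.
  apply: le_lt_trans (_ : e / 16 * 1 < _); last lra.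
  by rewrite ler_wpM2l ?divr_ge0 // ?(ltW e0) // ler_pdivrMr // mul1r lerDl.
apply: etrans (dd_val w (linear_lam e0 hfe fM r0 rv)) _.
have hg : hol_ball (fun y => 'd f y w) x (e / 8).
  move=> y hy; have e8 : 0 < e / 8 by rewrite divr_gt0.
  apply: (dir_differentiable w e8); apply: (hol_ball_sub hfe); lra.
by symmetry; exact: (dir_cauchy r0 rv hg).
Qed.

End HolomorphicDerivatives.

(** * Identity theorem *)

Section IdentityTheorem.
Variable R : realType.
Local Notation C := (Cplx R).
Local Notation K := (lamC R).

Definition zero_near (V : normedModType C) (f : V -> C) (x : V) :=
  exists2 r : R, 0 < r & forall y, nm (y - x) < r -> f y = 0.

Lemma hol_derive1 (f : C -> C) (a : C) d : hol_ball f a d -> @hol_ball R C (derive1 f) a d.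
Proof.
move=> hf y hy; have e0 : 0 < d - nm (y - a) by rewrite subr_gt0.
have hfy : hol_ball f y (d - nm (y - a)) by apply: (hol_ball_sub hf); lra.
have D : differentiable (fun w : C => 'd f w (1 : C)) y := dir_differentiable (1 : C) e0 hfy.
apply: (@near_diff R C C _ _ y _ D).
by exists (d - nm (y - a)) => // w /hfy dw; rewrite derive1_dd // scale1r.
Qed.

Lemma hol_derive1n (f : C -> C) (a : C) d n : hol_ball f a d -> @hol_ball R C (derive1n n f) a d.
Proof. by move=> hf; elim: n => [//|n IH]; apply: hol_derive1. Qed.

(** Comparison along the segment with a multiple of [t ^+ j.+1]. The gain of the divisor [j.+1] at
    each integration is what later produces a factorial. *)
Lemma half_poly_mvt (g : C -> C) (a h : C) (c d : R) (j : nat) : hol_ball g a d -> nm h < d ->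
  g a = 0 -> (forall y, nm (y - a) < d -> nm (derive1 g y) <= c * nm (y - a) ^+ j) ->
  reC (g (a + h)) <= c * nm h ^+ j.+1 / j.+1%:R.
Proof.
move=> hg hd ga gc.
have inb (t : R) : 0 <= t <= 1 -> nm (a + ofR t *: h - a) = t * nm h.
  by move=> /andP[t0 _]; rewrite (addrC a) addrK nmZ nm_ofR ger0_norm.
have inb' (t : R) : 0 <= t <= 1 -> nm (a + ofR t *: h - a) < d.
  move=> ht; rewrite inb //; case/andP: ht => t0 t1; apply: le_lt_trans hd.
  by rewrite ler_piMl ?nm_ge0.
pose k := c * nm h ^+ j.+1.
have D (t : R) : 0 <= t <= 1 -> is_derive t (1 : R) (fun t : R => reC (g (a + ofR t *: h)) - (k / j.+1%:R) * t ^+ j.+1)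
    (reC ('d g (a + ofR t *: h) h) - k * t ^+ j).
  move=> ht.
  have D1 := rder_re (rder_dd (rder_aff a h t) (ddP (hg _ (inb' t ht)))).
  have D2 : is_derive t (1 : R) (fun t : R => (k / j.+1%:R) * t ^+ j.+1) (k * t ^+ j).
    have D0 : is_derive t (1 : R) (fun t : R => t ^+ j.+1) (j.+1%:R * t ^+ j).
      have -> : (fun t : R => t ^+ j.+1) = (id : R -> R) ^+ j.+1 by rewrite exprfctE.
      apply: is_derive_eq (@is_deriveX R R id j.+1 t 1 1 (is_derive_id t (1 : R))) _.
      by rewrite /GRing.scale /= mulr1.
    apply: is_derive_eq (@is_deriveZ _ _ _ _ (k / j.+1%:R) t 1 _ D0) _.
    by rewrite /GRing.scale /= mulrA mulfVK // pnatr_eq0.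
  exact: is_deriveB.
have [t ht E] := mean_value ler01 D.
have k0 : (k / j.+1%:R) * 0 ^+ j.+1 = 0 by rewrite expr0n /= mulr0.
move: E; rewrite rmorph1 rmorph0 scale1r scale0r addr0 ga raddf0 expr1n k0 mulr1 subr0 !subr0 mulr1.
move=> E; rewrite -subr_le0 -/k E subr_le0.
have dg := hg _ (inb' t ht).
apply: le_trans (ler_norm _) (le_trans (nm_re _) _).
rewrite derive1_dd // nmM.
apply: le_trans (ler_wpM2l (nm_ge0 h) (gc _ (inb' t ht))) _; rewrite inb // exprMn /k exprS.
by apply: le_of_eq; ring.
Qed.

(** Multiplying [g] by the four units bounds its real and imaginary parts from both sides. *)
Lemma poly_mvt (g : C -> C) (a h : C) (c d : R) (j : nat) : hol_ball g a d -> nm h < d ->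
  g a = 0 -> (forall y, nm (y - a) < d -> nm (derive1 g y) <= c * nm (y - a) ^+ j) ->
  nm (g (a + h)) <= 2 * (c * nm h ^+ j.+1 / j.+1%:R).
Proof.
move=> hg hd ga gc.
have H (u : C) : nm u = 1 -> reC (u * g (a + h)) <= c * nm h ^+ j.+1 / j.+1%:R.
  move=> u1; have D y : nm (y - a) < d -> dd (fun z => u * g z) y (fun k => u * (k *: derive1 g y)).
    by move=> hy; exact: ddMl (dd1 (hg y hy)).
  have hu : hol_ball (fun z => u * g z) a d by move=> y /D/dd_diff.
  have ua : u * g a = 0 by rewrite ga mulr0.
  apply: (half_poly_mvt hu hd ua) => y hy; rewrite (@dd_derive1 R C _ y (u * derive1 g y)); last first.
    by apply: dd_eq (D y hy) _ => k; rewrite /GRing.scale /=; ring.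
  by rewrite nmM u1 mul1r gc.
have n1 : nm (-1 : C) = 1 by rewrite nmN nm1.
have n2 : nm (- 'i : C) = 1 by rewrite nmN nm_i.
have := H 1 (nm1 R); have := H (-1) n1; have := H 'i (nm_i R); have := H (- 'i) n2.
have e2 : reC (- 1 * g (a + h)) = - reC (g (a + h)) by rewrite mulN1r raddfN.
have e3 : reC ('i * g (a + h)) = - imC (g (a + h)) by rewrite reCM reCi imCi mul0r mul1r sub0r.
have e4 : reC (- 'i * g (a + h)) = imC (g (a + h)) by rewrite mulNr raddfN /= e3 opprK.
rewrite e2 e3 e4 mul1r => h1 h2 h3 h4.
apply: le_trans (nm_le_reim _) _.
move: h1 h2 h3 h4; move: (c * _ / _) (reC _) (imC _) => B x y h1 h2 h3 h4.
by rewrite mulr2n mulrDl mul1r lerD // ler_norml; apply/andP; split; lra.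
Qed.

(** An elementary form of Stirling's bound: [n ^ n] is at most the falling factorial of [2 n], that
    is [n!] times a binomial coefficient at most [2 ^ (2 n)]. *)
Lemma expn_fact_le (n : nat) : (n ^ n <= 4 ^ n * n`!)%N.
Proof.
have h1 : (n ^ n <= (n + n) ^_ n)%N.
  have G k m : (m ^ k <= (m + k) ^_ k)%N.
    elim: k m => [|k IH] m; first by rewrite ffactn0 expn0.
    rewrite addnS ffactSS expnS leq_mul // ?(leq_trans (leq_addr k m)) //.
  exact: G.
rewrite -bin_ffact in h1; apply: leq_trans h1 _; rewrite leq_mul2r; apply/orP; right.
have -> : (4 ^ n = 2 ^ (n + n))%N by rewrite -[4%N]/(2 ^ 2)%N -expnM mul2n addnn.
rewrite -[2%N]/(1 + 1)%N expnDn (bigD1 (inord n)) //= inordK; last by rewrite ltnS leq_addr.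
by rewrite !exp1n !muln1 leq_addr.
Qed.

(** Each derivative costs a shrinking of the radius by [d / (2 n)] and a factor [8 K] over that
    amount; [n] of them leave half of the radius. *)
Lemma cauchy_iter (f : C -> C) (a : C) (d M : R) (n k : nat) : (0 < n)%N -> (k <= n)%N -> 0 < d ->
  hol_ball f a d -> (forall y, nm (y - a) < d -> nm (f y) <= M) ->
  forall y, nm (y - a) < d - k%:R * (d / (2 * n%:R)) ->
    nm (derive1n k f y) <= (16 * K * n%:R / d) ^+ k * M.
Proof.
move=> n0 + d0 hf fM; have nn : 0 < n%:R :> R by rewrite ltr0n.
have e0 : 0 < d / (2 * n%:R) by rewrite divr_gt0 // mulr_gt0.
elim: k => [|k IH] kn y; first by rewrite mul0r subr0 expr0 mul1r; exact: fM.
move=> hy; set e := d / (2 * n%:R) in e0 hy.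
have hin w : nm (w - y) < e -> nm (w - a) < d - k%:R * e.
  move=> hw; apply: le_lt_trans (nm_dist w a y) _.
  have : (k.+1)%:R * e = k%:R * e + e by rewrite -natr1 mulrDl mul1r.
  lra.
have hin' w : nm (w - y) < e -> nm (w - a) < d.
  move=> /hin h; apply: lt_le_trans h _; rewrite lerBlDr lerDl mulr_ge0 // ltW //.
have hfy : hol_ball (derive1n k f) y e.
  by move=> w /hin' hw; exact: (hol_derive1n k hf).
have fb w : nm (w - y) < e -> nm (derive1n k f w) <= (16 * K * n%:R / d) ^+ k * M.
  by move=> /hin; apply: IH; exact: ltnW.
have hy0 : nm (y - y) < e / 2 by rewrite subrr nm0 divr_gt0.
have := dir_bound e0 hfy fb 1 hy0; rewrite nm1 mulr1.
rewrite derive1_dd ?scale1r; last by apply: hfy; rewrite subrr nm0.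
move=> H; apply: le_trans H _; apply: le_of_eq; rewrite exprS /e; field.
by rewrite !gt_eqF.
Qed.

(** Since all derivatives vanish at [a], the bound on the [n]-th one can be integrated [j] times
    from [a] by [poly_mvt]. *)
Lemma descend (f : C -> C) (a : C) (d B : R) (n j : nat) : (j <= n)%N -> 0 < d -> 0 <= B ->
  hol_ball f a d -> (forall k, derive1n k f a = 0) ->
  (forall y, nm (y - a) < d -> nm (derive1n n f y) <= B) ->
  forall y, nm (y - a) < d -> nm (derive1n (n - j) f y) <= B * 2 ^+ j / j`!%:R * nm (y - a) ^+ j.
Proof.
move=> + d0 B0 hf f0 fB; elim: j => [|j IH] jn y hy.
  by rewrite subn0 !expr0 !mulr1 fact0 divr1; exact: fB.
have hj := IH (ltnW jn).
have E : (n - j)%N = (n - j.+1).+1 by rewrite subnS prednK // subn_gt0.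
rewrite E in hj.
have := @poly_mvt (derive1n (n - j.+1) f) a (y - a) (B * 2 ^+ j / j`!%:R) d j
  (hol_derive1n _ hf) hy (f0 _) hj.
rewrite [a + _]addrC subrK => H; apply: le_trans H _; apply: le_of_eq.
rewrite factS natrM [2 ^+ j.+1]exprS; field.
by rewrite pnatr_eq0 -lt0n fact_gt0 /= addrC natr1 pnatr_eq0.
Qed.

(** Power series are avoided: [cauchy_iter] bounds the [N]-th derivative, [descend] integrates the
    bound [N] times, and by [expn_fact_le] the result is at most [M * q ^+ N] for every positive
    [N], with [q <= 1 / 2] near [a]. *)
Lemma flat_zero (f : C -> C) (a : C) (d : R) : 0 < d -> hol_ball f a d ->
  (forall k, derive1n k f a = 0) -> zero_near f a.
Proof.
move=> d1 hf1 f0; have [e [M [e0 ed fM]]] := locally_bounded d1 hf1.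
have hf : hol_ball f a e by move=> y hy; apply: hf1; exact: lt_le_trans ed.
have K0 := lamC_ge0 R; have M0 := M_ge0 e0 fM.
have c0 : 0 < 256 * K + 2 by exact: (ltr_wpDl (mulr_ge0 (ler0n _ 256) K0) (ltr0Sn _ 1)).
(* The term [256 * K] gives [q <= 1 / 2], where 128 is 16 from [cauchy_iter] times 2 from [descend]
   times 4 from [expn_fact_le]; the term 2 keeps [y] in the half ball. *)
exists (e / (256 * K + 2)) => [|y hy]; first by rewrite divr_gt0.
have ye : nm (y - a) < e / 2.
  apply: lt_le_trans hy _; by rewrite ler_pM2l // lef_pV2 ?posrE // lerDr (mulr_ge0 (ler0n _ 256) K0).
pose q := 128 * K * nm (y - a) / e.
have q0 : 0 <= q by rewrite divr_ge0 ?(ltW e0) // mulr_ge0 ?nm_ge0 // mulr_ge0.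
have q1 : q <= 2^-1.
  move: hy; rewrite ltr_pdivlMr // => hy; rewrite /q ler_pdivrMr //.
  have := nm_ge0 (y - a); have : nm (y - a) * (256 * K + 2) = 256 * K * nm (y - a) + 2 * nm (y - a) by ring.
  lra.
have step n : nm (f y) <= M / 2 ^+ n.+1.
  pose N := n.+1; have NN : 0 < N%:R :> R by rewrite ltr0n.
  have hfe2 : hol_ball f a (e / 2) by move=> w hw; apply: hf; lra.
  have B0 : 0 <= (16 * K * N%:R / e) ^+ N * M.
    by rewrite mulr_ge0 // exprn_ge0 // divr_ge0 ?(ltW e0) // mulr_ge0 // mulr_ge0.
  have bN w : nm (w - a) < e / 2 -> nm (derive1n N f w) <= (16 * K * N%:R / e) ^+ N * M.
    move=> hw; apply: (cauchy_iter (ltn0Sn n) (leqnn N) e0 hf fM).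
    apply: lt_le_trans hw _; apply: le_of_eq; rewrite /N; field.
    by rewrite addrC natr1 pnatr_eq0.
  have e2 : 0 < e / 2 by rewrite divr_gt0.
  have := descend (leqnn N) e2 B0 hfe2 f0 bN ye; rewrite subnn /=.
  move=> H; apply: le_trans H _.
  have fN : 0 < N`!%:R :> R by rewrite ltr0n fact_gt0.
  have hN : N%:R ^+ N <= 4 ^+ N * N`!%:R :> R.
    by rewrite -!natrX -natrM ler_nat expn_fact_le.
  apply: le_trans (_ : q ^+ N * M <= _); last first.
    by rewrite mulrC ler_wpM2l // -exprVn lerXn2r // nnegrE.
  have -> : (16 * K * N%:R / e) ^+ N * M * 2 ^+ N / N`!%:R * nm (y - a) ^+ N =
     (32 * K * nm (y - a) / e) ^+ N * M * (N%:R ^+ N / N`!%:R).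
    have -> : 32 * K * nm (y - a) / e = 2 * (16 * K / e) * nm (y - a) by ring.
    have -> : 16 * K * N%:R / e = 16 * K / e * N%:R by ring.
    by rewrite !exprMn; field; rewrite gt_eqF.
  have -> : q ^+ N * M = (32 * K * nm (y - a) / e) ^+ N * M * 4 ^+ N.
    by rewrite mulrAC -exprMn; congr (_ ^+ N * _); rewrite /q; field; rewrite gt_eqF.
  rewrite ler_wpM2l ?ler_pdivrMr //.
  exact: (mulr_ge0 (exprn_ge0 _ (divr_ge0 (mulr_ge0 (mulr_ge0 (ler0n _ 32) K0) (nm_ge0 _)) (ltW e0))) M0).
apply/eqP; rewrite -nm_eq0; apply/eqP.
apply: (@small_zero R _ M); first exact: nm_ge0.
move=> eps eps0; pose n := Num.truncn eps^-1.
apply: le_trans (step n) _; rewrite ler_wpM2l // -[leRHS]invrK lef_pV2 ?posrE ?invr_gt0 ?exprn_gt0 //.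
have h : eps^-1 < n.+1%:R by apply: truncnS_gt.
by rewrite ltW // (lt_trans h) // -natrX ltr_nat ltn_expl.
Qed.

Lemma zero_near_derive1 (f : C -> C) x : zero_near f x -> @zero_near C (derive1 f) x.
Proof.
move=> [r r0 hr]; exists r => // y hy.
apply: (@dd_derive1 R C f y 0).
have D : dd f y (fun _ : C => 0 : C).
  apply: near_dd (dd_cst (0 : C) y); exists (r - nm (y - x)); first by rewrite subr_gt0.
  by move=> w hw; rewrite hr //; have := nm_dist w x y; lra.
by apply: dd_eq D _ => h; rewrite scaler0.
Qed.

Lemma zero_near_derive1n (f : C -> C) x n : zero_near f x -> derive1n n f x = 0.
Proof.
move=> zf; suff [r r0 hr] : @zero_near C (derive1n n f) x by apply: hr; rewrite subrr nm0.
by elim: n => [//|n IH]; exact: zero_near_derive1.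
Qed.

(** At the supremum of the parameters up to which [f] vanishes locally, all derivatives vanish by
    continuity, and [flat_zero] pushes the supremum further unless it is 1. *)
Lemma segment_identity (f : C -> C) :
  (forall t : R, 0 <= t <= 1 -> exists2 r : R, 0 < r & @hol_ball R C f (ofR t) r) ->
  @zero_near C f 0 -> f 1 = 0.
Proof.
move=> hf z0.
pose S := [set t : R | 0 <= t <= 1 /\ forall u : R, 0 <= u <= t -> @zero_near C f (ofR u)].
have S0 : S 0.
  split; first by rewrite lexx ler01.
  by move=> u /andP[u0 u1]; have -> : u = 0; [apply/le_anti; rewrite u0 u1 | rewrite rmorph0].
have supS : has_sup S by split; [exists 0 | exists 1 => t [/andP[]]].
pose s := sup S.
have s0 : 0 <= s by apply: ub_le_sup => //; case: supS.
have s1 : s <= 1 by apply: ge_sup => [|t [/andP[]]//]; case: supS.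
have [r r0 hr] := hf s (introT andP (conj s0 s1)).
have flat n : derive1n n f (ofR s) = 0.
  apply/eqP/negPn/negP => nz.
  have dn : differentiable (derive1n n f : C -> C) (ofR s : C).
    by apply: (hol_derive1n n hr); rewrite subrr nm0.
  have nz' : 0 < nm (derive1n n f (ofR s) : C) by rewrite nm_gt0.
  have /contCP/(_ _ nz')[d d0 hd] := differentiable_continuous dn.
  have [t [St1 St2] ht] := sup_adherent d0 supS.
  have ts : t <= s by apply: ub_le_sup; [case: supS | split].
  have t0 : 0 <= t by case/andP: St1.
  have := hd (ofR t); rewrite (zero_near_derive1n n (St2 t _)) ?t0 ?lexx //.
  rewrite sub0r nmN ltxx -rmorphB /= nm_ofR ltr_norml => H.
  suff hts : - d < t - s < d by have := H hts.
  by rewrite -/s in ht; clear -ht ts d0; apply/andP; split; lra.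
have [p p0 hp] := flat_zero r0 hr flat.
have [t [St1 St2] ht] := sup_adherent p0 supS.
pose b := Num.min 1 (s + p / 2).
have Sb : S b.
  split; first by rewrite le_min ler01 addr_ge0 ?divr_ge0 ?(ltW p0) // ge_min lexx.
  move=> u /andP[u0]; rewrite le_min => /andP[u1 us].
  case: (leP u t) => ut; first by apply: St2; rewrite u0 ut.
  have us' : `|u - s| < p by rewrite ltr_norml /s; apply/andP; split; rewrite /s in us; lra.
  exists (p - `|u - s|) => [|y hy]; first by rewrite subr_gt0.
  apply: hp; have := nm_dist y (ofR s : C) (ofR u); rewrite -rmorphB nm_ofR; lra.
have bs : b <= s by apply: ub_le_sup => //; case: supS.
have b1 : b = 1.
  move: bs; rewrite /b; case: (leP 1 (s + p / 2)) => h bs; lra.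
case: Sb => _ /(_ 1); rewrite b1 ler01 lexx => /(_ isT)[e e0 he].
by rewrite -(rmorph1 (@ofR R)); apply: he; rewrite subrr nm0.
Qed.

(** A ball is convex, so [f] may be restricted to the complex line through [y0] and [y], where
    [segment_identity] applies. *)
Theorem identity_ball (V : normedModType C) (f : V -> C) (x y0 : V) (d : R) :
  hol_ball f x d -> nm (y0 - x) < d -> zero_near f y0 ->
  forall y, nm (y - x) < d -> f y = 0.
Proof.
move=> hf h0 [r r0 hr] y hy; pose v := y - y0.
have n0 : 0 < nm v + 1 by rewrite ltr_wpDl ?nm_ge0.
have vle : nm v <= nm v + 1 by rewrite lerDl.
have E : f y = f (y0 + (1 : C) *: v) by rewrite scale1r /v addrC subrK.
rewrite E; apply: (@segment_identity (fun z : C => f (y0 + z *: v))).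
  move=> t ht; have hp : nm (y0 + ofR t *: v - x) < d.
    by apply: (ball_segment h0) => //; rewrite /v (addrC y0) subrK.
  have e0 : 0 < d - nm (y0 + ofR t *: v - x) by rewrite subr_gt0.
  exists ((d - nm (y0 + ofR t *: v - x)) / (nm v + 1)); first by rewrite divr_gt0.
  move=> z; rewrite ltr_pdivlMr // => hz.
  have dz : differentiable f (y0 + z *: v).
    apply: hf; apply: le_lt_trans (nm_dist _ x (y0 + ofR t *: v)) _.
    have -> : y0 + z *: v - (y0 + ofR t *: v) = (z - ofR t) *: v.
      by rewrite opprD addrACA subrr add0r scalerBl.
    rewrite nmZ; have := ler_wpM2l (nm_ge0 (z - ofR t)) vle; lra.
  exact: dd_diff (line_diff dz).
exists (r / (nm v + 1)) => [|z]; first by rewrite divr_gt0.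
rewrite subr0 ltr_pdivlMr // => hz; apply: hr; rewrite (addrC y0) addrK nmZ.
have := ler_wpM2l (nm_ge0 z) vle; lra.
Qed.

Lemma rder_zero (f : R -> C) (t : R) c e : rder f t c -> 0 < e ->
  (forall s, `|s - t| < e -> f s = 0) -> c = 0.
Proof.
move=> df e0 f0; apply/eqP; rewrite -nm_eq0; apply/eqP; apply: (@small_zero R _ 1).
  exact: nm_ge0.
move=> k k0; have [d d0 hd] := df _ k0.
pose h := Num.min d e / 2.
have m0 : 0 < Num.min d e by rewrite lt_min d0.
have h0 : 0 < h by rewrite divr_gt0.
have hh : h < Num.min d e by rewrite /h; lra.
move: (hh); rewrite lt_min => /andP[h1 h2].
have := hd h; rewrite gtr0_norm // => /(_ h1).
rewrite (f0 t) ?subrr ?normr0 // (f0 (t + h)); last by rewrite (addrC t) addrK gtr0_norm.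
by rewrite subr0 sub0r nmN nmZ nm_ofR gtr0_norm // mulrC ler_pM2r // mul1r.
Qed.

(** Complex derivatives can be computed along the real direction, so all of them vanish at [a]. *)
Theorem identity_real (f : C -> C) (a : C) (d e : R) : 0 < d -> 0 < e -> hol_ball f a d ->
  (forall t : R, `|t| < e -> f (a + ofR t) = 0) ->
  forall y, nm (y - a) < d -> f y = 0.
Proof.
move=> d0 e0 hf f0.
pose r := Num.min d e; have r0 : 0 < r by rewrite lt_min d0.
have G n (t : R) : `|t| < r -> derive1n n f (a + ofR t) = 0.
  elim: n t => [|n IH] t ht; first by apply: f0; apply: lt_le_trans ht _; rewrite ge_min lexx orbT.
  have hin : nm (a + ofR t - a) < d.
    by rewrite (addrC a) addrK nm_ofR; apply: lt_le_trans ht _; rewrite ge_min lexx.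
  have dn : differentiable (derive1n n f : C -> C) (a + ofR t : C) by exact: (hol_derive1n n hf).
  have D := rder_dd (rder_ext (fun s => congr1 (fun u => a + u) (mulr1 (ofR s : C))) (rder_aff a 1 t))
    (dd1 dn).
  have := rder_zero D (e := r - `|t|); rewrite subr_gt0 scale1r; apply => // s hs.
  apply: IH; have := ler_normD (s - t) t; rewrite subrK; lra.
apply: (identity_ball (y0 := a) hf); first by rewrite subrr nm0.
apply: (flat_zero d0 hf) => k; have := G k 0; rewrite normr0 rmorph0 addr0; exact.
Qed.

Theorem hol_integral (V : normedModType C) (f g : V -> C) (x : V) (d : R) :
  hol_ball f x d -> hol_ball g x d -> (forall y, nm (y - x) < d -> f y * g y = 0) ->
  (forall y, nm (y - x) < d -> f y = 0) \/ (forall y, nm (y - x) < d -> g y = 0).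
Proof.
move=> hf hg fg.
have [|nf] := pselect (forall y, nm (y - x) < d -> f y = 0); [by left | right].
have [y0 [h0 fy0]] : exists y0, nm (y0 - x) < d /\ f y0 != 0.
  apply: contrapT => H; apply: nf => y hy; apply/eqP/negPn/negP => fy; apply: H.
  by exists y.
apply: (identity_ball hg h0).
have nz : 0 < nm (f y0) by rewrite nm_gt0.
have /contCP/(_ _ nz)[r r0 hr] := differentiable_continuous (hf y0 h0).
exists (Num.min r (d - nm (y0 - x))); first by rewrite lt_min r0 subr_gt0.
move=> y; rewrite lt_min => /andP[h1 h2].
have hy : nm (y - x) < d by have := nm_dist y x y0; lra.
have /eqP := fg y hy; rewrite mulf_eq0 => /orP[/eqP fy|/eqP//].
by have := hr y h1; rewrite fy sub0r nmN ltxx.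
Qed.

Lemma hol_prod (V : normedModType C) (f g : V -> C) (x : V) (d : R) :
  hol_ball f x d -> hol_ball g x d -> hol_ball (fun y => f y * g y) x d.
Proof. by move=> hf hg y hy; exact: dd_diff (ddM (ddP (hf y hy)) (ddP (hg y hy))). Qed.

Lemma exists_nonzero (V : normedModType C) (I : finType) (f : I -> V -> C) (x : V) (d : R) :
  0 < d -> (forall i, hol_ball (f i) x d) ->
  (forall i, exists2 y, nm (y - x) < d & f i y != 0) ->
  exists2 y, nm (y - x) < d & forall i, f i y != 0.
Proof.
move=> d0 hf nf.
have H (s : seq I) : hol_ball (fun y => \prod_(i <- s) f i y) x d /\
    exists2 y, nm (y - x) < d & \prod_(i <- s) f i y != 0.
  elim: s => [|i s [IH1 [y0 hy0 IH2]]].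
    split; first by move=> y hy; apply: dd_diff (dd_ext (dd_cst (1 : C) y) _ (fun=> erefl)) => w; rewrite big_nil.
    by exists x; [rewrite subrr nm0 | rewrite big_nil oner_eq0].
  have E y : \prod_(j <- i :: s) f j y = f i y * \prod_(j <- s) f j y by rewrite big_cons.
  split.
    by move=> y hy; apply: dd_diff (dd_ext (ddP (hol_prod (hf i) IH1 hy)) _ (fun=> erefl)) => w; rewrite E.
  apply: contrapT => N.
  have Z y : nm (y - x) < d -> f i y * \prod_(j <- s) f j y = 0.
    move=> hy; apply/eqP/negPn/negP => nz; apply: N; exists y => //.
    by rewrite E.
  case: (hol_integral (hf i) IH1 Z) => {}Z.
  - by have [y hy] := nf i; rewrite Z // eqxx.
  - by move: IH2; rewrite Z // eqxx.
have [_ [y hy nz]] := H (index_enum I); exists y => // i.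
by apply: contraNneq nz => fi; rewrite (bigD1 i) //= fi mul0r.
Qed.

Lemma nm_pair (V W : normedModType C) (v : V) (w : W) : nm ((v, w) : V * W) = Num.max (nm v) (nm w).
Proof.
rewrite /nm; have -> : `|(v, w)| = Num.max `|v| `|w| by [].
rewrite !nmE; rewrite maxElt maxElt ltr_ofR; by case: ifP.
Qed.

Lemma dd_pair (U V W : normedModType C) (f : U -> V) (g : U -> W) x L M :
  dd f x L -> dd g x M -> dd (fun z => (f z, g z)) x (fun h => (L h, M h)).
Proof.
move=> [df <-] [dg <-]; split; first exact: (@differentiable_pair C U V W f g x df dg).
exact: (@diff_pair C U V W f g x df dg).
Qed.

Lemma nm_pair_lt (V W : normedModType C) (v : V) (w : W) d : nm v < d -> nm w < d ->
  nm ((v, w) : V * W) < d.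
Proof. by rewrite nm_pair gt_max => -> ->. Qed.

(* With [z = s + i t] and [w = s - i t], [G] vanishes for real [s] and [t]. *)
Theorem polarize (G : C * C -> C) (a : C) (d : R) : 0 < d ->
  hol_ball G ((a, a^* ) : C * C) d -> (forall z, nm (z - a) < d -> G (z, z^* ) = 0) ->
  forall z w, nm (z - a) < d / 2 -> nm (w - a^* ) < d / 2 -> G (z, w) = 0.
Proof.
move=> d0 hG G0 z w hz hw.
pose P s t : C * C := (a + (s + 'i * t), a^* + (s - 'i * t)).
have inP s t : nm s < d / 2 -> nm t < d / 2 -> nm (P s t - (a, a^* )) < d.
  move=> hs ht; have -> : P s t - (a, a^* ) = (s + 'i * t, s - 'i * t).
    by apply: injective_projections; rewrite /= addrC addKr.
  apply: nm_pair_lt.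
    by have := nmD s ('i * t); rewrite nmM nm_i mul1r; lra.
  by have := nmBD s ('i * t); rewrite nmM nm_i mul1r; lra.
have d2 : 0 < d / 2 by rewrite divr_gt0.
have conj_ofR (x : R) : (ofR x : C)^* = ofR x by exact: conjc_real.
have real0 (s t : R) : `|s| < d / 2 -> `|t| < d / 2 -> G (P (ofR s) (ofR t)) = 0.
  move=> hs ht; have -> : P (ofR s) (ofR t) = (a + (ofR s + 'i * ofR t), (a + (ofR s + 'i * ofR t))^* ).
    by rewrite /P !rmorphD rmorphM /= conjCi !conj_ofR mulNr.
  apply: G0; rewrite (addrC a) addrK; have := nmD (ofR s : C) ('i * ofR t).
  by rewrite nmM nm_i mul1r !nm_ofR; lra.
have half (s : R) t : `|s| < d / 2 -> nm t < d / 2 -> G (P (ofR s) t) = 0.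
  move=> hs; have hs' : nm (ofR s : C) < d / 2 by rewrite nm_ofR.
  have h : @hol_ball R C (fun t => G (P (ofR s) t)) 0 (d / 2).
    move=> u; rewrite subr0 => hu.
    have D1 := ddD (dd_cst a u) (ddD (dd_cst (ofR s : C) u) (ddMl 'i (dd_id u))).
    have D2 := ddD (dd_cst a^* u) (ddB (dd_cst (ofR s : C) u) (ddMl 'i (dd_id u))).
    exact: dd_diff (dd_comp (dd_pair D1 D2) (ddP (hG _ (inP _ _ hs' hu)))).
  move=> ht; apply: (identity_real d2 d2 h); last by rewrite subr0.
  by move=> x hx; rewrite add0r; exact: real0.
have full s t : nm s < d / 2 -> nm t < d / 2 -> G (P s t) = 0.
  move=> + ht.
  have h : @hol_ball R C (fun s => G (P s t)) 0 (d / 2).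
    move=> u; rewrite subr0 => hu.
    have D1 := ddD (dd_cst a u) (ddD (dd_id u) (dd_cst ('i * t) u)).
    have D2 := ddD (dd_cst a^* u) (ddB (dd_id u) (dd_cst ('i * t) u)).
    exact: dd_diff (dd_comp (dd_pair D1 D2) (ddP (hG _ (inP _ _ hu ht)))).
  move=> hs; apply: (identity_real d2 d2 h); last by rewrite subr0.
  by move=> x hx; rewrite add0r; exact: half.
pose s := ((z - a) + (w - a^* )) / 2; pose t := - 'i * ((z - a) - (w - a^* )) / 2.
have n2 : nm (2 : C) = 2.
  have -> : (2 : C) = ofR 2 by rewrite rmorph_nat.
  by rewrite nm_ofR gtr0_norm.
have -> : (z, w) = P s t.
  have e1 : 'i * t = ((z - a) - (w - a^* )) / 2.
    by rewrite /t !mulrA mulrN -expr2 sqrCi opprK mul1r.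
  by rewrite /P e1 /s; congr pair; field.
apply: full; rewrite ?nmM nmV n2 ltr_pdivrMr //.
  by have := nmD (z - a) (w - a^* ); lra.
by rewrite nmN nm_i mul1r; have := nmBD (z - a) (w - a^* ); lra.
Qed.

End IdentityTheorem.

(** * Algebraic functions *)

Section MultivariatePolynomials.

Lemma muni_eval n (F : comNzRingType) (v : 'I_n.+1 -> F) (p : mpoly n.+1 F) :
  meval v p =
  (map_poly (meval (fun i => v (widen_ord (leqnSn n) i))) (muni p)).[v ord_max].
Proof.
rewrite muniE mevalE raddf_sum horner_sum; apply: eq_bigr => m _.
rewrite [X in X.[_]]map_polyZ map_polyXn hornerZ hornerXn /= mevalZ mevalX big_ord_recr /= -mulrA.
by congr (_ * (_ * _)); apply: eq_bigr => i _; rewrite mnmE; congr (v _ ^+ m _); apply/val_inj.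
Qed.

Lemma muni_inj n (F : nzRingType) (p : mpoly n.+1 F) : muni p = 0 -> p = 0.
Proof.
move=> p0; apply/mpolyP => m; rewrite mcoeff0.
have : mcoeff (Multinom [tuple m (widen_ord (leqnSn n) i) | i < n]) (muni p)`_(m ord_max) = 0.
  by rewrite p0 coef0 mcoeff0.
rewrite muniE coef_sum raddf_sum /=.
have [ms|ms _] := boolP (m \in msupp p); last by rewrite memN_msupp_eq0.
rewrite (bigD1_seq m) ?msupp_uniq //= big1 ?addr0.
  rewrite coefZ coefXn eqxx mulr1 mcoeffZ mcoeffX.
  by rewrite eqxx mulr1.
move=> m' mm'; rewrite coefZ coefXn; case: eqP => [e|_]; last by rewrite mulr0 mcoeff0.
rewrite mulr1 mcoeffZ mcoeffX; case: eqP => [e'|_]; last by rewrite mulr0.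
case/eqP: mm'; apply/mnmP => i.
have [->|ni] := eqVneq i ord_max; first by rewrite e.
have lt_i : (i < n)%N by rewrite ltn_neqAle -ltnS ltn_ord andbT; apply: contraNneq ni => e''; apply/eqP/val_inj.
have := congr1 (fun q : multinom n => q (Ordinal lt_i)) e'; rewrite !mnmE.
have -> : widen_ord (leqnSn n) (Ordinal lt_i) = i by apply/val_inj.
by [].
Qed.

Lemma infinite_nonroot (F : numDomainType) (p : {poly F}) : p != 0 -> exists x, p.[x] != 0.
Proof.
move=> p0; apply: contrapT => H.
have rt x : root p x by apply/rootP/eqP/negPn/negP => h; apply: H; exists x.
pose s := [seq (i%:R : F) | i <- iota 0 (size p)].
have us : uniq s by rewrite map_inj_uniq ?iota_uniq // => i j /eqP; rewrite eqr_nat => /eqP.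
have := max_poly_roots p0 _ us; rewrite size_map size_iota ltnn => H1.
by have /H1 : all (root p) s by apply/allP => x _; exact: rt.
Qed.

Lemma meval_nonzero n (F : numFieldType) (p : mpoly n F) : p != 0 -> exists v, meval v p != 0.
Proof.
elim: n p => [|n IH] p p0.
  exists (fun=> 0); apply: contraNneq p0; rewrite mevalE => h; apply/eqP/mpolyP => m.
  rewrite mcoeff0; have [ms|] := boolP (m \in msupp p); last exact: memN_msupp_eq0.
  have un (m1 : multinom 0) : m1 = m by apply/mnmP; case.
  move: h; rewrite (bigD1_seq m) ?msupp_uniq //= [X in _ + X]big1 => [|m1]; last by rewrite (un m1) eqxx.
  by rewrite addr0 big1 ?mulr1 // => -[].
have u0 : muni p != 0 by apply: contraNneq p0 => /muni_inj ->.
have l0 : lead_coef (muni p) != 0 by rewrite lead_coef_eq0.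
have [v hv] := IH _ l0.
have q0 : map_poly (meval v) (muni p) != 0.
  by rewrite -lead_coef_eq0 lead_coef_map_eq.
have [x hx] := infinite_nonroot q0.
exists (fun i => if unlift ord_max i is Some j then v j else x).
rewrite muni_eval unlift_none.
rewrite (_ : map_poly _ _ = map_poly (meval v) (muni p)) //.
apply: eq_map_poly => q; apply: meval_eq => i.
by have -> : widen_ord (leqnSn n) i = lift ord_max i; [apply/val_inj; rewrite /= /bump leqNgt ltn_ord | rewrite liftK].
Qed.

Lemma rmorph_mmap n (F : nzRingType) (S S' : comNzRingType) (f : F -> S) (h : 'I_n -> S)
  (g : {rmorphism S -> S'}) (p : mpoly n F) : g (mmap f h p) = mmap (g \o f) (g \o h) p.
Proof.
rewrite /mmap rmorph_sum; apply: eq_bigr => m _.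
rewrite rmorphM /= /mmap1 rmorph_prod; congr (_ * _).
by apply: eq_bigr => i _; rewrite rmorphXn.
Qed.

End MultivariatePolynomials.

(** * Algebraicity over a base ring of functions *)

Section AlgebraicFunctions.
Variables (A : idomainType) (K : comNzRingType) (ev : {rmorphism A -> K}).

(* [K] will be a ring of functions, hence need not be a domain. *)
Definition Alg (y : K) := exists2 p : {poly A}, p != 0 & (map_poly ev p).[y] = 0.

Local Notation int := (integralOver ev).

Lemma int0 : int 0. Proof. by rewrite -(rmorph0 ev); exact: integral_id. Qed.

Lemma int1 : int 1. Proof. by rewrite -(rmorph1 ev); exact: integral_id. Qed.

(* Multiplying a root by the leading coefficient turns the equation into a monic one. *)
Definition monicize (B : nzRingType) (p : {poly B}) : {poly B} :=
  \poly_(i < size p) (if i == (size p).-1 then 1 else p`_i * lead_coef p ^+ ((size p).-1 - i).-1).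

Lemma monicize_monic (B : nzRingType) (p : {poly B}) : p != 0 -> monicize p \is monic.
Proof.
move=> p0; have sp : (0 < size p)%N by rewrite size_poly_gt0.
rewrite monicE lead_coefE /monicize size_poly_eq ?eqxx ?oner_neq0 //.
by rewrite coef_poly prednK // leqnn eqxx.
Qed.

Lemma horner_monicize (B : comNzRingType) (p : {poly B}) (y : B) : (1 < size p)%N ->
  (monicize p).[lead_coef p * y] = lead_coef p ^+ (size p).-2 * p.[y].
Proof.
move=> sp; have sp0 : (0 < size p)%N by apply: ltn_trans sp.
rewrite horner_poly horner_coef big_distrr /=; apply: eq_bigr => i _.
have lead : p`_(size p).-1 = lead_coef p by [].
rewrite exprMn; case: eqP => [e|/eqP ne].
  rewrite e lead mul1r.
  have -> : (size p).-1 = (size p).-2.+1 by case: (size p) sp => [|[]].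
  by rewrite exprSr !mulrA.
have lt_i : (i < (size p).-1)%N by rewrite ltn_neqAle ne -ltnS prednK // ltn_ord.
have -> : (size p).-2 = (((size p).-1 - i).-1 + i)%N.
  by move: (nat_of_ord i) lt_i => j; case: (size p) => [|[|k]] //= h; rewrite subSn // subnK.
by rewrite exprD; ring.
Qed.

Lemma Alg_int y : Alg y -> exists2 a, a != 0 & int (ev a * y).
Proof.
move=> [p p0 py]; exists (lead_coef p); first by rewrite lead_coef_eq0.
have [sp|sp] := leqP (size p) 1.
  have E := size1_polyC sp; rewrite E map_polyC hornerC in py.
  rewrite E lead_coefC /= py mul0r; exact: int0.
exists (monicize p); first exact: monicize_monic.
have -> : map_poly ev (monicize p) = \poly_(i < size p)
    (ev (if i == (size p).-1 then 1 else p`_i * lead_coef p ^+ ((size p).-1 - i).-1)).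
  by apply/polyP => i; rewrite coef_map !coef_poly; case: ifP => // _; exact: rmorph0.
rewrite /root horner_poly.
have E : \sum_(i < size p) ev p`_i * y ^+ i = 0.
  rewrite -[RHS]py (@horner_coef_wide _ (size p)); last exact: size_poly.
  by apply: eq_bigr => i _; rewrite coef_map.
have sp0 : (0 < size p)%N by apply: ltn_trans sp.
have := congr1 (fun u => ev (lead_coef p) ^+ (size p).-2 * u) E; rewrite mulr0 big_distrr /= => E'.
apply/eqP; rewrite -[RHS]E'.
apply: eq_bigr => i _; rewrite exprMn; case: eqP => [e|/eqP ne].
  rewrite rmorph1 mul1r e -lead_coefE.
  have -> : (size p).-1 = (size p).-2.+1 by case: (size p) sp => [|[]].
  by rewrite exprSr !mulrA.
have lt_i : (i < (size p).-1)%N by rewrite ltn_neqAle ne -ltnS prednK // ltn_ord.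
have -> : (size p).-2 = (((size p).-1 - i).-1 + i)%N.
  by move: (nat_of_ord i) lt_i => j; case: (size p) => [|[|k]] //= h; rewrite subSn // subnK.
by rewrite rmorphM rmorphXn exprD; ring.
Qed.

Lemma int_Alg y a : a != 0 -> int (ev a * y) -> Alg y.
Proof.
move=> a0 [q qm /rootP qy]; exists (q \Po (a *: 'X)).
  rewrite -size_poly_eq0 size_comp_poly2 ?size_poly_eq0 ?monic_neq0 //.
  by rewrite size_scale // size_polyX.
rewrite map_comp_poly horner_comp map_polyZ map_polyX hornerZ hornerX; exact: qy.
Qed.

Lemma Alg_ev a : Alg (ev a).
Proof. by apply: (@int_Alg _ 1); rewrite ?oner_eq0 // rmorph1 mul1r; exact: integral_id. Qed.

Lemma AlgD x y : Alg x -> Alg y -> Alg (x + y).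
Proof.
move=> /Alg_int[a a0 ax] /Alg_int[b b0 biy]; apply: (@int_Alg _ (a * b)); first by rewrite mulf_neq0.
rewrite rmorphM mulrDr -mulrA mulrCA [ev a * ev b * y]mulrC [y * _]mulrC -mulrA.
by apply: integral_add; apply: integral_mul => //; exact: integral_id.
Qed.

Lemma AlgM x y : Alg x -> Alg y -> Alg (x * y).
Proof.
move=> /Alg_int[a a0 ax] /Alg_int[b b0 biy]; apply: (@int_Alg _ (a * b)); first by rewrite mulf_neq0.
by rewrite rmorphM mulrACA; exact: integral_mul.
Qed.

Lemma AlgN x : Alg x -> Alg (- x).
Proof. by move=> ax; rewrite -mulN1r; apply: AlgM => //; rewrite -(rmorphN1 ev); exact: Alg_ev. Qed.

Lemma Alg_sum (I : Type) (s : seq I) (P : pred I) (f : I -> K) :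
  (forall i, P i -> Alg (f i)) -> Alg (\sum_(i <- s | P i) f i).
Proof.
move=> H; apply: big_ind => //; [rewrite -(rmorph0 ev); exact: Alg_ev | exact: AlgD].
Qed.

Lemma AlgX x n : Alg x -> Alg (x ^+ n).
Proof.
move=> ax; elim: n => [|n IH]; first by rewrite expr0 -(rmorph1 ev); exact: Alg_ev.
by rewrite exprS; exact: AlgM.
Qed.

Section Domain.
(** A domain inside the ring [K], containing the base ring; in the applications, the holomorphic
    functions on a ball. *)
Variable H : K -> Prop.
Hypotheses (H_ev : forall a, H (ev a)) (HD : forall x y, H x -> H y -> H (x + y))
  (HM : forall x y, H x -> H y -> H (x * y))
  (Hdom : forall x y, H x -> H y -> x * y = 0 -> x = 0 \/ y = 0)
  (ev_inj : forall a, ev a = 0 -> a = 0).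

Lemma HX x n : H x -> H (x ^+ n).
Proof.
move=> hx; elim: n => [|n IH]; first by rewrite expr0 -(rmorph1 ev); exact: H_ev.
by rewrite exprS; exact: HM.
Qed.

Lemma H_horner (p : {poly K}) x : (forall i, H p`_i) -> H x -> H p.[x].
Proof.
move=> hp hx; rewrite horner_coef; apply: big_ind => //; first by rewrite -(rmorph0 ev); exact: H_ev.
by move=> i _; apply: HM => //; exact: HX.
Qed.

(* Dividing an equation of [x] by the largest power of the unknown. *)
Lemma nonzero_constant (p : {poly A}) x : H x -> p != 0 -> (map_poly ev p).[x] = 0 ->
  x = 0 \/ exists2 q : {poly A}, q`_0 != 0 & (map_poly ev q).[x] = 0.
Proof.
move=> hx; elim: {p}(size p) {-2}p (leqnn (size p)) => [|n IH] p sp p0 px.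
  by rewrite leqn0 size_poly_eq0 (negbTE p0) in sp.
have [c0|c0] := eqVneq p`_0 0; last by right; exists p.
have [q Eq] : exists q, p = q * 'X.
  exists (Poly (behead p)); apply/polyP => -[|i]; rewrite coefMX //= coef_Poly nth_behead //.
have q0 : q != 0 by apply: contraNneq p0; rewrite Eq => ->; rewrite mul0r.
rewrite Eq rmorphM /= map_polyX hornerMX in px.
have hq : H (map_poly ev q).[x].
  by apply: H_horner => // i; rewrite coef_map; exact: H_ev.
have [qx|->] := Hdom hq hx px; last by left.
by apply: (IH q) => //; rewrite Eq size_mulX // ltnS in sp.
Qed.

(** In an equation of [c] with nonzero constant term, that term is a multiple of [c] with integral
    cofactor; multiplying [y] by it therefore gives an integral element, with a denominator from
    [A]. *)
Lemma int_unit_Alg c y : H c -> c != 0 -> int c -> int (c * y) -> Alg y.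
Proof.
move=> hc c0 [r rm /rootP rc] icy.
have [/eqP|[q q0 qc]] := nonzero_constant hc (monic_neq0 rm) rc; first by rewrite (negbTE c0).
have ic : int c by exists r => //; apply/rootP.
have [s Es] : exists s, q = (q`_0)%:P + s * 'X.
  exists (Poly (behead q)); apply/polyP => -[|i]; rewrite coefD coefC coefMX //= ?addr0 ?add0r //.
  by rewrite coef_Poly nth_behead.
apply: (int_Alg q0).
have E : ev q`_0 = - ((map_poly ev s).[c] * c).
  apply/eqP; rewrite -addr_eq0; move: qc; rewrite Es rmorphD rmorphM /= map_polyC map_polyX.
  by rewrite hornerD hornerC hornerMX -Es => ->.
rewrite E mulNr -mulrA; apply: integral_opp; apply: integral_mul => //.
apply: integral_horner => //; apply/integral_poly => i; rewrite coef_map; exact: integral_id.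
Qed.

Lemma common_denominator (p : {poly K}) : (forall i, Alg p`_i) ->
  exists2 a, a != 0 & forall i, int (ev a * p`_i).
Proof.
move=> ap; have {}ap i : exists2 a, a != 0 & int (ev a * p`_i) := Alg_int (ap i).
have [f hf] := choice (fun i => let: ex_intro2 a h1 h2 := ap i in ex_intro _ a (conj h1 h2)).
exists (\prod_(i < size p) f i); first by apply/prodf_neq0 => i _; have [] := hf i.
move=> i; have [h|h] := ltnP i (size p); last by rewrite nth_default // mulr0; exact: int0.
rewrite (bigD1 (Ordinal h)) //= rmorphM mulrAC; apply: integral_mul; last exact: integral_id.
by have [] := hf i.
Qed.

(** After clearing denominators, [y] times the leading coefficient is integral, and [int_unit_Alg]
    removes that coefficient. Only the coefficients lie in [H]: [y] may be a limit whose holomorphy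
    is not yet known. *)
Theorem Alg_trans (p : {poly K}) y : (forall i, Alg p`_i) -> (forall i, H p`_i) -> p != 0 ->
  p.[y] = 0 -> Alg y.
Proof.
move=> ap hp p0 py; have [a a0 ha] := common_denominator ap.
pose p' := ev a *: p.
have p'i i : p'`_i = ev a * p`_i by rewrite coefZ.
have hp' i : H p'`_i by rewrite p'i; exact: HM.
have lc0 : ev a * lead_coef p != 0.
  apply/eqP => h; have [/ev_inj/eqP|/eqP] := Hdom (H_ev a) (hp _) h; first by rewrite (negbTE a0).
  by rewrite lead_coef_eq0 (negbTE p0).
have sp' : size p' = size p.
  apply/eqP; rewrite eqn_leq size_scale_leq /=.
  have sp : (0 < size p)%N by rewrite size_poly_gt0.
  rewrite leqNgt; apply/negP => h; move/eqP: lc0; apply.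
  by rewrite lead_coefE -p'i nth_default // -ltnS prednK.
have lp' : lead_coef p' = ev a * lead_coef p by rewrite lead_coefE sp' p'i.
have p'0 : p' != 0 by rewrite -lead_coef_eq0 lp'.
have p'y : p'.[y] = 0 by rewrite hornerZ py mulr0.
have ic : int (lead_coef p') by rewrite lp'; exact: ha.
have lp'0 : lead_coef p' != 0 by rewrite lead_coef_eq0.
apply: (int_unit_Alg (hp' _) lp'0 ic).
have [s1|s1] := leqP (size p') 1.
  have E := size1_polyC s1; rewrite E hornerC in p'y.
  by move: p'0; rewrite E p'y eqxx.
apply: (@integral_root_monic _ _ _ _ (monicize p')); first exact: monicize_monic.
  by apply/rootP; rewrite horner_monicize // p'y mulr0.
apply/integral_poly => i; rewrite coef_poly; case: ifP => _; last exact: int0.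
case: ifP => _; first exact: int1.
apply: integral_mul; first by rewrite p'i; exact: ha.
elim: (_.-1) => [|k IH]; first by rewrite expr0; exact: int1.
by rewrite exprS; exact: integral_mul.
Qed.

End Domain.

End AlgebraicFunctions.

Section PolynomialPredicates.

Record subsemi (B : nzRingType) (G : B -> Prop) : Prop := Subsemi {
  ss0 : G 0; ss1 : G 1;
  ssD : forall x y, G x -> G y -> G (x + y);
  ssM : forall x y, G x -> G y -> G (x * y) }.

(** Meant to be nested: [coefs (coefs G)] concerns polynomials in two variables. *)
Definition coefs (B : nzRingType) (G : B -> Prop) (p : {poly B}) := forall i, G p`_i.

Lemma ss_sum (B : nzRingType) (G : B -> Prop) (I : Type) (r : seq I) (P : pred I) (F : I -> B) :
  subsemi G -> (forall i, G (F i)) -> G (\sum_(i <- r | P i) F i).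
Proof. by move=> [? ? hD _] hF; apply: big_ind => //; exact: hD. Qed.

Lemma ss_prod (B : nzRingType) (G : B -> Prop) (I : Type) (r : seq I) (P : pred I) (F : I -> B) :
  subsemi G -> (forall i, G (F i)) -> G (\prod_(i <- r | P i) F i).
Proof. by move=> [? ? _ hM] hF; apply: big_ind => //; exact: hM. Qed.

Lemma ssX (B : nzRingType) (G : B -> Prop) x n : subsemi G -> G x -> G (x ^+ n).
Proof.
move=> [h0 h1 hD hM] gx; elim: n => [|n IH]; first by rewrite expr0.
by rewrite exprS; exact: hM.
Qed.

Lemma coefsC (B : nzRingType) (G : B -> Prop) c : subsemi G -> G c -> coefs G c%:P.
Proof. by move=> [h0 _ _ _] gc i; rewrite coefC; case: ifP. Qed.

Lemma coefsX (B : nzRingType) (G : B -> Prop) : subsemi G -> coefs G 'X.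
Proof. by move=> [h0 h1 _ _] i; rewrite coefX; case: eqP. Qed.

Lemma coefs_subsemi (B : nzRingType) (G : B -> Prop) : subsemi G -> subsemi (coefs G).
Proof.
move=> hG; have [h0 h1 hD hM] := hG; split.
- by move=> i; rewrite coef0.
- by move=> i; rewrite coef1; case: eqP.
- by move=> p q hp hq i; rewrite coefD; exact: hD.
- by move=> p q hp hq i; rewrite coefM; apply: ss_sum => // j; exact: hM.
Qed.

Lemma lowest_term (B : nzRingType) (p : {poly B}) : p != 0 ->
  exists q n, p = q * 'X^n /\ q`_0 != 0.
Proof.
elim: {p}(size p) {-2}p (leqnn (size p)) => [|n IH] p sp p0.
  by rewrite leqn0 size_poly_eq0 (negbTE p0) in sp.
have [c0|c0] := eqVneq p`_0 0; last by exists p, 0%N; rewrite expr0 mulr1.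
have [q Eq] : exists q, p = q * 'X.
  exists (Poly (behead p)); apply/polyP => -[|i]; rewrite coefMX //= coef_Poly nth_behead //.
have q0 : q != 0 by apply: contraNneq p0; rewrite Eq => ->; rewrite mul0r.
have [|r [k [Er r0]]] := IH q _ q0; first by rewrite Eq size_mulX // ltnS in sp.
by exists r, k.+1; split=> //; rewrite Eq Er exprSr mulrA.
Qed.

End PolynomialPredicates.

(** * Limits and derivatives of algebraic functions remain algebraic *)

Section LimitsOfAlgebraicFunctions.
Variable R : realType.
Local Notation C := (Cplx R).
Variable T : pointedType.
Local Notation K := (T -> C).

Definition at_point (x : T) (f : K) : C := f x.

Lemma at_point_zmod x : zmod_morphism (at_point x). Proof. by []. Qed.
Lemma at_point_monoid x : monoid_morphism (at_point x). Proof. by []. Qed.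
HB.instance Definition _ x := GRing.isZmodMorphism.Build K C (at_point x) (at_point_zmod x).
HB.instance Definition _ x := GRing.isMonoidMorphism.Build K C (at_point x) (at_point_monoid x).

Lemma horner_at (p : {poly K}) (y : K) x : p.[y] x = (map_poly (at_point x) p).[y x].
Proof. by rewrite -[LHS]/(at_point x p.[y]) -horner_map. Qed.

(** The outer variable is the path parameter [s] and the inner one the unknown [u], so the constant
    coefficient is an equation for the unknown at [s = 0]. *)
Definition ev2 (x : T) (s u : C) : {poly {poly K}} -> C :=
  horner_eval u \o horner_eval s%:P \o map_poly (map_poly (at_point x)).

HB.instance Definition _ x s u := GRing.RMorphism.on (ev2 x s u).

Lemma ddX (V : normedModType C) (f : V -> C) x n : differentiable f x ->
  differentiable (fun z => f z ^+ n) x.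
Proof.
move=> df; elim: n => [|n IH].
  by apply: dd_diff (dd_ext (dd_cst (1 : C) x) _ (fun=> erefl)) => z; rewrite expr0.
by apply: dd_diff (dd_ext (ddM (ddP df) (ddP IH)) _ (fun=> erefl)) => z; rewrite exprS.
Qed.

Lemma diff_horner (V : normedModType C) (p : {poly C}) (f : V -> C) x :
  differentiable f x -> differentiable (fun z => p.[f z]) x.
Proof.
move=> df.
have D (i : 'I_(size p)) := ddMl p`_i (ddP (ddX i df)).
by apply: dd_diff (dd_ext (dd_sum D) _ (fun=> erefl)) => z; rewrite horner_coef.
Qed.

Lemma dd_fst (V W : normedModType C) (p : V * W) : dd fst p fst.
Proof.
apply: (@dd_lin R (V * W)%type V fst 1) => -[v w] /=.
by rewrite mul1r nm_pair le_max lexx.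
Qed.

Lemma dd_snd (V W : normedModType C) (p : V * W) : dd snd p snd.
Proof.
apply: (@dd_lin R (V * W)%type W snd 1) => -[v w] /=.
by rewrite mul1r nm_pair le_max lexx orbT.
Qed.

Lemma diff_horner2 (P : {poly {poly C}}) (p : C * C) :
  differentiable (fun p : C * C => P.[p.1%:P].[p.2]) p.
Proof.
have D (i : 'I_(size P)) := ddM (ddP (diff_horner P`_i (dd_diff (dd_snd p)))) (ddP (ddX i (dd_diff (dd_fst p)))).
apply: dd_diff (dd_ext (dd_sum D) _ (fun=> erefl)) => z.
rewrite -[RHS]/(P.[z.1%:P].[z.2]) (horner_coef P) horner_sum; apply: eq_bigr => i _.
by rewrite hornerM horner_exp hornerC.
Qed.

Lemma horner2_limit (P : {poly {poly C}}) (u : C) (us : C -> C) :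
  (exists2 r : R, 0 < r & forall s : C, s != 0 -> nm s < r -> P.[s%:P].[us s] = 0) ->
  (forall e : R, 0 < e -> exists2 d : R, 0 < d & forall s : C, s != 0 -> nm s < d -> nm (us s - u) < e) ->
  P.[0].[u] = 0.
Proof.
move=> [r r0 hr] cu; apply/eqP; rewrite -nm_eq0; apply/eqP.
apply: (@small_zero R _ 1); first exact: nm_ge0.
move=> e e0; have /contCP/(_ e e0)[d d0 hd] := differentiable_continuous (diff_horner2 P (0, u)).
have [d' d'0 hd'] := cu d d0.
pose m := Num.min r (Num.min d d'); have m0 : 0 < m by rewrite !lt_min r0 d0.
pose s : C := ofR (m / 2).
have ns : nm s = m / 2 by rewrite nm_ofR gtr0_norm // divr_gt0.
have s0 : s != 0 by rewrite -nm_gt0 ns divr_gt0.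
have : nm s < m by rewrite ns; lra.
rewrite !lt_min => /and3P[h1 h2 h3].
have := hd (s, us s); rewrite hr // sub0r nmN mul1r => H; apply: ltW; apply: H.
have -> : (s, us s) - (0, u) = (s, us s - u) by apply: injective_projections; rewrite //= subr0.
by apply: nm_pair_lt => //; exact: hd'.
Qed.

Variables (A : idomainType) (ev : {rmorphism A -> K}) (H : K -> Prop) (cA : C -> A).
Hypotheses (H_ev : forall a, H (ev a)) (HD : forall x y, H x -> H y -> H (x + y))
  (HM : forall x y, H x -> H y -> H (x * y))
  (Hdom : forall x y, H x -> H y -> x * y = 0 -> x = 0 \/ y = 0)
  (ev_inj : forall a, ev a = 0 -> a = 0) (ev_cst : forall c, ev (cA c) = (fun=> c)).

Definition AlgIn (y : K) := Alg ev y /\ H y.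

Lemma AlgIn_ev a : AlgIn (ev a).
Proof. by split; [exact: Alg_ev | exact: H_ev]. Qed.

Lemma AlgIn_cst c : AlgIn (fun=> c).
Proof. by rewrite -ev_cst; exact: AlgIn_ev. Qed.

Lemma AlgIn_subsemi : subsemi AlgIn.
Proof.
split.
- by rewrite -(rmorph0 ev); exact: AlgIn_ev.
- by rewrite -(rmorph1 ev); exact: AlgIn_ev.
- by move=> x y [a1 h1] [a2 h2]; split; [exact: AlgD | exact: HD].
- by move=> x y [a1 h1] [a2 h2]; split; [exact: AlgM | exact: HM].
Qed.

(* [Q] is an equation of [ys s] over the algebraic functions; after division by a power
   of [s] it remains non trivial at [s = 0], where it is satisfied by the limit. *)
Theorem limit_Alg (Q : {poly {poly K}}) (y : K) (ys : C -> K) : Q != 0 ->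
  coefs (coefs AlgIn) Q ->
  (forall x : T, exists2 r : R, 0 < r & forall s : C, s != 0 -> nm s < r -> ev2 x s (ys s x) Q = 0) ->
  (forall (x : T) (e : R), 0 < e -> exists2 d : R, 0 < d & forall s : C, s != 0 -> nm s < d -> nm (ys s x - y x) < e) ->
  Alg ev y.
Proof.
move=> Q0 hQ hz hl; have [Q' [n [EQ Q'0]]] := lowest_term Q0.
have hQ' : coefs AlgIn Q'`_0 by move=> j; have := hQ n j; rewrite EQ coefMXn ltnn subnn.
apply: (Alg_trans H_ev HD HM Hdom ev_inj (p := Q'`_0)).
- by move=> j; case: (hQ' j).
- by move=> j; case: (hQ' j).
- exact: Q'0.
apply/funext => x; rewrite horner_at.
pose P := map_poly (map_poly (at_point x)) Q'.
have -> : map_poly (at_point x) Q'`_0 = P.[0].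
  by rewrite horner_coef0 /P coef_map.
apply: (horner2_limit (us := fun s => ys s x)); last exact: hl.
have [r r0 hr] := hz x; exists r => // s s0 sr.
have := hr s s0 sr; rewrite EQ rmorphM rmorphXn /=.
have -> : ev2 x s (ys s x) 'X = s.
  by rewrite /ev2 /= map_polyX /horner_eval hornerX hornerC.
by move=> /eqP; rewrite mulf_eq0 (negbTE (expf_neq0 _ s0)) orbF => /eqP.
Qed.

(* The terms [s ^+ 2 * e j], with generic [e], prevent [P] from vanishing identically
   along the path without changing derivatives at [s = 0]. *)
Theorem nash_Alg k (P : mpoly (k + 1) C) (a : 'I_k -> K) (d0 : K) (b : 'I_k -> C) (w : nat) :
  P != 0 -> (forall i, AlgIn (a i)) -> AlgIn d0 ->
  exists e : 'I_k -> C, forall (y : K) (ys : C -> K),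
  (forall x : T, exists2 r : R, 0 < r & forall s : C, s != 0 -> nm s < r ->
     meval (fun i : 'I_(k + 1) => match fintype.split i with
                     | inl j => a j x + s * b j + s ^+ 2 * e j
                     | inr _ => d0 x + s ^+ w * ys s x end) P = 0) ->
  (forall (x : T) (e : R), 0 < e -> exists2 d : R, 0 < d & forall s : C, s != 0 -> nm s < d -> nm (ys s x - y x) < e) ->
  Alg ev y.
Proof.
move=> P0 ha hd0; have [v hv] := meval_nonzero P0.
pose x0 : T := point.
(* With this [e], the path at [x0] passes at [s = 1] through the point [v] where [P] does not
   vanish. *)
pose e j := v (lshift 1 j) - a j x0 - b j.
exists e => y ys hz hl.
pose cc (f : K) : {poly {poly K}} := f%:P%:P.
pose h (i : 'I_(k + 1)) : {poly {poly K}} := match fintype.split i with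
  | inl j => cc (a j) + 'X * cc (fun=> b j) + 'X ^+ 2 * cc (fun=> e j)
  | inr _ => cc d0 + 'X ^+ w * 'X%:P end.
pose Q := mmap (fun c => cc (fun=> c)) h P.
have evc x s u f : ev2 x s u (cc f) = f x.
  rewrite /ev2 /cc /= !map_polyC /= /horner_eval. by rewrite hornerC map_polyC /= hornerC.
have evX x s u : ev2 x s u 'X = s.
  by rewrite /ev2 /= map_polyX /horner_eval hornerX hornerC.
have evY x s u : ev2 x s u 'X%:P = u.
  by rewrite /ev2 /= map_polyC /= /horner_eval hornerC map_polyX hornerX.
have evD x s u p q : ev2 x s u (p + q) = ev2 x s u p + ev2 x s u q by exact: rmorphD.
have evM x s u p q : ev2 x s u (p * q) = ev2 x s u p * ev2 x s u q by exact: rmorphM.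
have evE x s u p i : ev2 x s u (p ^+ i) = ev2 x s u p ^+ i by exact: rmorphXn.
have evQ x s u : ev2 x s u Q = meval (fun i : 'I_(k + 1) => match fintype.split i with
                     | inl j => a j x + s * b j + s ^+ 2 * e j
                     | inr _ => d0 x + s ^+ w * u end) P.
  rewrite /Q rmorph_mmap /meval /mmap; apply: eq_bigr => m _ /=; rewrite evc; congr (_ * _).
  apply: eq_bigr => i _; congr (_ ^+ _); rewrite /= /h; case: (fintype.split i) => j.
    by rewrite !evD !evM !evc evX.
  by rewrite evD evM evE evc evX evY.
have sA := AlgIn_subsemi; have s2 := coefs_subsemi (coefs_subsemi sA).
have gcc f : AlgIn f -> coefs (coefs AlgIn) (cc f).
  by move=> hf; exact: (coefsC (coefs_subsemi sA) (coefsC sA hf)).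
have gX : coefs (coefs AlgIn) 'X by exact: (coefsX (coefs_subsemi sA)).
have gY : coefs (coefs AlgIn) 'X%:P by exact: (coefsC (coefs_subsemi sA) (coefsX sA)).
apply: (@limit_Alg Q y ys).
- apply: contraNneq hv => Qz.
  (* At [s = 1] the last coordinate can also be adjusted to [v], whatever [w] is; a zero [Q] would
     give [P] the value 0 at [v]. *)
  have := evQ x0 1 (v (rshift k ord0) - d0 x0); rewrite Qz rmorph0 => E; rewrite {}E; apply/eqP.
  apply: meval_eq => i; rewrite -{1}(splitK i); case: (fintype.split i) => j /=.
    by rewrite /e expr1n !mul1r; ring.
  by rewrite expr1n mul1r [j]ord1; ring.
- apply: ss_sum => // m; apply: (ssM s2); first exact: (gcc _ (AlgIn_cst _)).
  apply: ss_prod => // i; apply: (ssX _ s2); rewrite /h; case: (fintype.split i) => j.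
    apply: (ssD s2); first apply: (ssD s2).
    + exact: gcc.
    + exact: (ssM s2 gX (gcc _ (AlgIn_cst _))).
    + by apply: (ssM s2); [exact: (ssX 2 s2 gX) | apply: gcc; exact: AlgIn_cst].
  by apply: (ssD s2); [exact: gcc | apply: (ssM s2) => //; exact: (ssX w s2 gX)].
- by move=> x; have [r r0 hr] := hz x; exists r => // s s0 sr; rewrite evQ; exact: hr.
- exact: hl.
Qed.

(** A nonzero [y] has an equation with nonzero constant term; at zeros of [y] that term vanishes, so
    it is zero on [Z] and hence zero. *)
Theorem Alg_dense_zero (Z : T -> Prop) (y : K) : AlgIn y ->
  (forall a, (forall x, Z x -> ev a x = 0) -> a = 0) -> (forall x, Z x -> y x = 0) -> y = 0.
Proof.
move=> [[p p0 py] hy] hZ yZ.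
have [//|[q q0 qy]] := nonzero_constant H_ev HD HM Hdom hy p0 py.
case/eqP: q0; apply: hZ => x /yZ yx.
have := congr1 (fun f => f x) qy; rewrite horner_at yx horner_coef0 !coef_map /=; exact.
Qed.

End LimitsOfAlgebraicFunctions.

(** * Transcendence of exponentials *)

Section RetractedBall.
Variable R : realType.
Local Notation C := (Cplx R).
Variables (V : normedModType C) (x0 : V) (d : R).
Hypothesis d0 : 0 < d.

(* Functions on a ball are made total by composing them with a retraction. *)
Definition retract_ball (x : V) : V := if nm (x - x0) < d then x else x0.

Lemma retract_ball_in x : nm (retract_ball x - x0) < d.
Proof. by rewrite /retract_ball; case: ifP => //; rewrite subrr nm0. Qed.

Lemma retract_ball_id x : nm (x - x0) < d -> retract_ball x = x.
Proof. by rewrite /retract_ball => ->. Qed.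

Definition on_ball (f : V -> C) : V -> C := f \o retract_ball.

Lemma on_ball_eq (f g : V -> C) :
  on_ball f = on_ball g <-> forall x, nm (x - x0) < d -> f x = g x.
Proof.
split=> [E x xd|E].
  by have := congr1 (fun h => h x) E; rewrite /on_ball /= retract_ball_id.
by apply/funext => x; apply: E; exact: retract_ball_in.
Qed.

Lemma on_ball_zero (f : V -> C) : on_ball f = 0 <-> forall x, nm (x - x0) < d -> f x = 0.
Proof. exact: (on_ball_eq f 0). Qed.

Definition hol_germ (f : V -> C) := exists2 g : V -> C, hol_ball g x0 d & f = on_ball g.

Lemma hol_germD f g : hol_germ f -> hol_germ g -> hol_germ (f + g).
Proof.
move=> [f' hf ->] [g' hg ->]; exists (fun x => f' x + g' x) => // x xd.
exact: dd_diff (ddD (ddP (hf x xd)) (ddP (hg x xd))).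
Qed.

Lemma hol_germM f g : hol_germ f -> hol_germ g -> hol_germ (f * g).
Proof.
move=> [f' hf ->] [g' hg ->]; exists (fun x => f' x * g' x); last by [].
exact: hol_prod.
Qed.

Lemma hol_germ_integral f g : hol_germ f -> hol_germ g -> f * g = 0 -> f = 0 \/ g = 0.
Proof.
move=> [f' hf ->] [g' hg ->] fg.
have /on_ball_zero fg' : on_ball (fun x => f' x * g' x) = 0 by exact: fg.
by case: (hol_integral hf hg fg') => H; [left|right]; apply/on_ball_zero.
Qed.

Lemma hol_germ_cst c : hol_germ (fun=> c).
Proof. by exists (fun=> c) => // x _; exact: dd_diff (dd_cst c x). Qed.

Lemma hol_germX f n : hol_germ f -> hol_germ (f ^+ n).
Proof.
move=> hf; elim: n => [|n IH]; first by rewrite expr0; exact: hol_germ_cst.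
by rewrite exprS; exact: hol_germM.
Qed.

Lemma hol_germ_expf0 f n : hol_germ f -> f ^+ n = 0 -> f = 0.
Proof.
move=> hf; elim: n => [|n IH].
  rewrite expr0 => /(congr1 (fun h : V -> C => h x0)) E.
  by have /eqP := E : (1 : C) = 0; rewrite oner_eq0.
rewrite exprS => H; case: (hol_germ_integral hf _ H) => //; exact: hol_germX.
Qed.

Lemma fctX (f : V -> C) n x : (f ^+ n) x = f x ^+ n.
Proof. by elim: n => [|n IH]; rewrite ?expr0 // !exprS -IH. Qed.

End RetractedBall.

Lemma deriv0_const (F : numDomainType) (p : {poly F}) : p^`() = 0 -> p = (p`_0)%:P.
Proof.
move=> p'; apply/polyP => -[|i]; rewrite coefC //=.
by have /eqP := congr1 (fun q : {poly F} => q`_i) p'; rewrite coef_deriv coef0 mulrn_eq0 => /eqP.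
Qed.

Lemma dd_horner (R : realType) (V : normedModType (Cplx R)) (p : {poly Cplx R}) (f : V -> Cplx R) x L :
  dd f x L -> dd (fun z => p.[f z]) x (fun h => p^`().[f x] * L h).
Proof.
move=> df; elim/poly_ind: p => [|p c IH].
  apply: dd_ext (dd_cst (0 : Cplx R) x) _ _ => z; first by rewrite horner0.
  by rewrite deriv0 horner0 mul0r.
apply: (dd_ext (ddD (ddM IH df) (dd_cst c x))) => z; first by rewrite hornerMXaddC.
by rewrite derivD derivM derivX derivC !hornerE /=; ring.
Qed.

(** * Algebraic solutions of [g' = h' g] *)

Section Ax.
Variable R : realType.
Local Notation C := (Cplx R).
Variables (t0 : C) (d : R).
Hypothesis d0 : 0 < d.
Local Notation K := (C -> C).
Local Notation rb := (@retract_ball R C t0 d).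
Local Notation hol_germ := (@hol_germ R C t0 d).

Lemma horner_monoid (f : K) : monoid_morphism (fun p : {poly C} => (fun t => p.[f t]) : K).
Proof.
split=> [|p q]; apply/funext => t; first by rewrite hornerC.
by rewrite hornerM.
Qed.
Lemma horner_zmod (f : K) : zmod_morphism (fun p : {poly C} => (fun t => p.[f t]) : K).
Proof. by move=> p q; apply/funext => t; rewrite hornerD hornerN. Qed.

(** With [f = rb] the base ring is C[t], with [f = ph] it is C[h]; the argument passes from the
    first to the second. *)
Definition poly_in (f : K) (p : {poly C}) : K := fun t => p.[f t].
HB.instance Definition _ f := GRing.isZmodMorphism.Build {poly C} K (poly_in f) (horner_zmod f).
HB.instance Definition _ f := GRing.isMonoidMorphism.Build {poly C} K (poly_in f) (horner_monoid f).

Lemma poly_in_germ f p : hol_germ f -> hol_germ (poly_in f p).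
Proof.
move=> [g hg ->]; exists (fun t => p.[g t]) => // x xd.
exact: dd_diff (dd_horner p (ddP (hg x xd))).
Qed.

Lemma rb_germ : hol_germ rb.
Proof. by exists id => // x xd; exact: dd_diff (dd_id x). Qed.

Lemma poly_rb_inj p : poly_in rb p = 0 -> p = 0.
Proof.
move=> p0; apply/eqP; apply/negPn/negP => /infinite_nonroot[x].
have z : @zero_near R C (fun t => p.[t]) t0.
  by exists d => // y yd; have := congr1 (fun h : K => h y) p0; rewrite /poly_in /= retract_ball_id.
rewrite (@identity_ball R C (fun t => p.[t]) t0 t0 (nm (x - t0) + 1)) ?eqxx //.
- by move=> t _; exact: dd_diff (dd_horner p (dd_id t)).
- by rewrite subrr nm0; have := nm_ge0 (x - t0); lra.
- by have := nm_ge0 (x - t0); lra.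
Qed.

Variables (g h : C -> C).
Hypotheses (hg : @hol_ball R C g t0 d) (hh : @hol_ball R C h t0 d).
Hypothesis ode : forall t, nm (t - t0) < d -> derive1 g t = derive1 h t * g t.
Local Notation th := (g \o rb).
Local Notation ph := (h \o rb).
Lemma ball_sub_in (t y : C) : nm (t - t0) < d -> nm (y - t) < d - nm (t - t0) -> nm (y - t0) < d.
Proof.
move=> td yd; have -> : y - t0 = (y - t) + (t - t0) by ring.
by apply: le_lt_trans (nmD _ _) _; rewrite -ltrBrDr.
Qed.

Hypothesis h'0 : exists2 t, nm (t - t0) < d & derive1 h t != 0.

Lemma th_germ : hol_germ th. Proof. by exists g. Qed.
Lemma ph_germ : hol_germ ph. Proof. by exists h. Qed.
Lemma h'_germ : hol_germ (derive1 h \o rb). Proof. by exists (derive1 h) => //; exact: hol_derive1. Qed.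

Lemma cancel_h' (f : K) : hol_germ f -> (derive1 h \o rb) * f = 0 -> f = 0.
Proof.
move=> hf H; case: (hol_germ_integral d0 h'_germ hf H) => //.
have [t td ht] := h'0 => /(congr1 (fun h => h t)) E; case/eqP: ht.
by move: E; rewrite /= retract_ball_id.
Qed.

Lemma ball_derive1_zero (f : C -> C) (c : C) t : on_ball t0 d f = 0 -> nm (t - t0) < d ->
  dd f t (fun s => s * c) -> c = 0.
Proof.
move=> /(on_ball_zero _ d0) f0 td df.
have : dd (fun=> 0) t (fun s : C => s * c).
  apply: (near_dd _ df); exists (d - nm (t - t0)); first by rewrite subr_gt0.
  by move=> y yd; apply: f0; apply: ball_sub_in yd.
move=> /(dd_val (1 : C)); rewrite mul1r => <-; exact: (dd_val (1 : C) (dd_cst (0 : C) t)).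
Qed.

Lemma ph_transcendental q : poly_in ph q = 0 -> q = 0.
Proof.
elim: {q}(size q) {-2}q (leqnn (size q)) => [|n IH] q sq.
  by move: sq; rewrite leqn0 size_poly_eq0 => /eqP.
move=> q0.
have q'0 : q^`() = 0.
  apply: IH.
    by have [->|qn0] := eqVneq q 0; [rewrite deriv0 size_poly0 | rewrite -ltnS (leq_trans (lt_size_deriv qn0))].
  apply: cancel_h'; first by apply: poly_in_germ; exact: ph_germ.
  have /(on_ball_zero _ d0) H : on_ball t0 d (fun t => derive1 h t * q^`().[h t]) = 0.
    apply/(on_ball_zero _ d0) => t td.
    apply: (@ball_derive1_zero (fun t => q.[h t]) _ t q0 td).
    by apply: dd_ext (dd_horner q (dd1 (hh td))) _ _ => // s; rewrite /= -[_ *: _]/(_ * _); ring.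
  by apply/funext => t; apply: H; exact: retract_ball_in.
move: q0; rewrite (deriv0_const q'0) => /(congr1 (fun f : K => f t0)).
by rewrite /poly_in /= hornerC => ->.
Qed.

Lemma biv_eval (P : {poly {poly C}}) (f k : K) t :
  (map_poly (poly_in f) P).[k] t = P.[(k t)%:P].[f t].
Proof.
elim/poly_ind: P => [|P c IH]; first by rewrite rmorph0 !horner0.
by rewrite rmorphD rmorphM /= map_polyX map_polyC !hornerMXaddC hornerD hornerM hornerC -IH.
Qed.

(** An equation between [t] and [h] can be read with either of them as the unknown. *)
Lemma rb_Alg : Alg (poly_in rb) ph -> Alg (poly_in ph) rb.
Proof.
move=> [P P0 HP]; exists (swapXY P); first by rewrite swapXY_eq0.
by apply/funext => t; rewrite biv_eval horner2_swapXY -biv_eval HP.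
Qed.

Lemma poly_rb_Alg p : Alg (poly_in ph) rb -> Alg (poly_in ph) (poly_in rb p).
Proof.
move=> rA.
have -> : poly_in rb p = \sum_(i < size p) poly_in ph (p`_i)%:P * rb ^+ i.
  apply/funext => t; rewrite fct_sumE /poly_in horner_coef; apply: eq_bigr => i _.
  by rewrite -[RHS]/(_ * _) fctX hornerC.
apply: Alg_sum => i _; apply: AlgM; [exact: Alg_ev | exact: AlgX].
Qed.

(** Transitivity: [g] is algebraic over C[t], and [t] is algebraic over C[h]. *)
Lemma th_Alg : Alg (poly_in rb) ph -> Alg (poly_in rb) th -> Alg (poly_in ph) th.
Proof.
move=> /rb_Alg rA [p p0 Hp].
apply: (Alg_trans (H := hol_germ) _ _ _ _ _ _ _ _ Hp).
- by move=> a; apply: poly_in_germ; exact: ph_germ.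
- by move=> x y; exact: hol_germD.
- by move=> x y; exact: hol_germM.
- by move=> x y; exact: hol_germ_integral.
- exact: ph_transcendental.
- by move=> i; rewrite coef_map; exact: poly_rb_Alg.
- by move=> i; rewrite coef_map; apply: poly_in_germ; exact: rb_germ.
- by apply: contra p0 => /eqP pz; rewrite -lead_coef_eq0; apply/eqP/poly_rb_inj; rewrite lead_coefE -coef_map pz coef0.
Qed.

(* The derivation [s d/ds + d/dy] of C[y][s]. *)
Definition euler_derivation (P : {poly {poly C}}) : {poly {poly C}} :=
  map_poly (@deriv C) P + 'X * P^`().

Lemma coef_euler P i : (euler_derivation P)`_i = (P`_i)^`() + P`_i *+ i.
Proof. by rewrite coefD coef_map coefXM coef_deriv; case: i. Qed.

Lemma euler_MXaddC P c :
  euler_derivation (P * 'X + c%:P) = (euler_derivation P + P) * 'X + (c^`())%:P.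
Proof.
apply/polyP => -[|i]; rewrite coef_euler !coefD !coefMX !coefC /= ?coef_euler.
  by rewrite !add0r mulr0n addr0.
by rewrite !addr0 coefD coef_euler mulrS addrCA addrC.
Qed.

Lemma dd_biv (P : {poly {poly C}}) t : nm (t - t0) < d ->
  dd (fun t => P.[(g t)%:P].[h t]) t
    (fun s : C => s * (derive1 h t * (euler_derivation P).[(g t)%:P].[h t])).
Proof.
move=> td; elim/poly_ind: P => [|P c IH].
  apply: dd_ext (dd_cst (0 : C) t) _ _ => s; first by rewrite !horner0.
  have -> : euler_derivation 0 = 0 by apply/polyP => i; rewrite coef_euler !coef0 deriv0 mul0rn addr0.
  by rewrite !horner0 !mulr0.
apply: dd_ext (ddD (ddM IH (dd1 (hg td))) (dd_horner c (dd1 (hh td)))) _ _ => s /=.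
  by rewrite hornerMXaddC hornerD hornerM hornerC.
rewrite euler_MXaddC; move: (euler_derivation P) => E; rewrite !hornerMXaddC !hornerD !hornerM !hornerC !hornerD ode //.
by rewrite -![_ *: _]/(_ * _); ring.
Qed.

Lemma euler_rel (P : {poly {poly C}}) :
  (map_poly (poly_in ph) P).[th] = 0 -> (map_poly (poly_in ph) (euler_derivation P)).[th] = 0.
Proof.
move=> HP; apply: cancel_h'.
  apply: (@H_horner _ _ (poly_in ph) hol_germ).
  - by move=> a; apply: poly_in_germ; exact: ph_germ.
  - by move=> x y; exact: hol_germD.
  - by move=> x y; exact: hol_germM.
  - by move=> i; rewrite coef_map; apply: poly_in_germ; exact: ph_germ.
  - exact: th_germ.
apply/funext => t; rewrite -[LHS]/(derive1 h (rb t) * _) biv_eval.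
apply: ball_derive1_zero (retract_ball_in _ d0 t) (dd_biv _ (retract_ball_in _ d0 t)).
by apply/funext => s; rewrite -[RHS](congr1 (fun k : K => k s) HP) biv_eval.
Qed.

(* A relation of minimal total size between [g] and [h] is an eigenvector of the Euler
   derivation, hence a monomial in [g]. *)
Lemma no_relation N n (P : {poly {poly C}}) : th != 0 ->
  (size P <= N)%N -> (\sum_(i < N) size (P`_i)%R <= n)%N -> P != 0 ->
  (map_poly (poly_in ph) P).[th] = 0 -> False.
Proof.
move=> th0; elim: n P => [|n IH] P sP mP P0 HP.
  move: mP; rewrite leqn0 sum_nat_eq0 => /forallP z; case/eqP: P0.
  apply/polyP => i; rewrite coef0; apply/eqP; rewrite -size_poly_eq0.
  have [iN|Ni] := ltnP i N; first exact: (z (Ordinal iN)).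
  by rewrite nth_default ?size_poly0 // (leq_trans sP).
pose a := (size P).-1.
have sP0 : (0 < size P)%N by rewrite size_poly_gt0.
have aN : (a < N)%N by rewrite (leq_trans _ sP) // /a prednK.
have Pa0 : P`_a != 0 by rewrite -lead_coefE lead_coef_eq0.
(* The relation [Q] has its coefficient of index [a] replaced by the derivative, which is strictly
   shorter, while no other coefficient grows; the total size drops. *)
pose Q := euler_derivation P - P *+ a.
have cQ i : Q`_i = (P`_i)^`() + P`_i *+ i - P`_i *+ a by rewrite coefB coefMn coef_euler.
have HQ : (map_poly (poly_in ph) Q).[th] = 0.
  by rewrite rmorphB rmorphMn /= hornerD hornerN hornerMn HP euler_rel // mul0rn subr0.
have cQa i : Q`_i = (P`_i)^`() + (i%:R - a%:R : C) *: P`_i.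
  by rewrite cQ -addrA scalerBl !scaler_nat.
have sd (p : {poly C}) : (size p^`() <= size p)%N.
  by have [->|p0] := eqVneq p 0; [rewrite deriv0 | exact: ltnW (lt_size_deriv p0)].
have sQ i : (size (Q`_i)%R <= size (P`_i)%R)%N.
  rewrite cQa; apply: leq_trans (size_polyD _ _) _; rewrite geq_max sd.
  exact: size_scale_leq.
have Qa : Q`_a = (P`_a)^`() by rewrite cQa subrr scale0r addr0.
have sQP : (size Q <= N)%N.
  apply: leq_trans sP; apply/leq_sizeP => j Pj.
  by rewrite cQ nth_default // deriv0 !mul0rn subr0 addr0.
have [Q0|Q0] := eqVneq Q 0; last first.
  apply: (IH Q sQP _ Q0 HQ); rewrite -ltnS; apply: leq_trans mP.
  rewrite (bigD1 (Ordinal aN)) //= [X in (_ < X)%N](bigD1 (Ordinal aN)) //= -addSn.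
  by apply: leq_add; [rewrite Qa lt_size_deriv | apply: leq_sum].
(* When [Q = 0], the coefficient of index [a] is constant, and any other one is an eigenvector of
   [deriv] for the nonzero value [a - i], hence zero by degree. *)
have EP : P = (P`_a`_0)%:P%:P * 'X^a.
  apply/polyP => i; rewrite coefCM coefXn; case: eqP => [->|/eqP ia].
    by rewrite mulr1; apply: deriv0_const; rewrite -Qa Q0 coef0.
  rewrite mulr0; apply/eqP/negPn/negP => Pi0.
  have := lt_size_deriv Pi0; rewrite ltnNge => /negP; apply.
  have /eqP : Q`_i = 0 by rewrite Q0 coef0.
  rewrite cQa addr_eq0 => /eqP ->; rewrite size_polyN size_scale //.
  by rewrite subr_eq0 eqr_nat.
move: HP; rewrite EP rmorphM /= map_polyC /= map_polyXn hornerCM hornerXn => HP.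
case/eqP: th0; apply: (hol_germ_expf0 d0 th_germ (n := a)).
apply/funext => t; have := congr1 (fun k : K => k t) HP.
rewrite -[LHS]/(_ * _) /poly_in hornerC => /eqP; rewrite mulf_eq0 => /orP[/eqP c0|/eqP //].
by case/eqP: P0; rewrite EP c0 !polyC0 mul0r.
Qed.

End Ax.

(* [g] behaves like [exp h]. *)
Theorem algebraic_exponential (R : realType) (t0 : Cplx R) (d : R) (g h : Cplx R -> Cplx R) :
  0 < d -> hol_ball g t0 d -> hol_ball h t0 d ->
  (forall t, nm (t - t0) < d -> derive1 g t = derive1 h t * g t) ->
  Alg (poly_in (retract_ball t0 d)) (on_ball t0 d g) ->
  Alg (poly_in (retract_ball t0 d)) (on_ball t0 d h) ->
  (exists2 t, nm (t - t0) < d & g t != 0) ->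
  forall t, nm (t - t0) < d -> derive1 h t = 0.
Proof.
move=> d0 hg hh ode Ag Ah [u ud gu] t td; apply/eqP/negPn/negP => h't.
have [P P0 HP] := th_Alg d0 hh (ex_intro2 _ _ t td h't) Ah Ag.
apply: (no_relation d0 hg hh ode (ex_intro2 _ _ t td h't) _ (leqnn _) (leqnn _) P0 HP).
by apply: contra gu => /eqP/(on_ball_zero _ d0)/(_ u ud) ->.
Qed.

(** * Implicit roots and transcendence bases *)

Section ImplicitRoot.
Variable R : realType.
Local Notation C := (Cplx R).

(** The logarithmic derivative of [p] at [y] is the sum of the [(y - r)^-1], each of modulus at most
    [m^-1]; the inequality is written without division. *)
Lemma near_root_bound (rs : seq C) (y : C) (m : R) (p := \prod_(r <- rs) ('X - r%:P)) :
  0 <= m -> (forall r, r \in rs -> m <= nm (y - r)) ->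
  nm p^`().[y] * m <= (size rs)%:R * nm p.[y].
Proof.
move=> m0; rewrite {}/p; elim: rs => [|r rs IH] H.
  by rewrite big_nil -[1]/(1%:P) derivC horner0 nm0 !mul0r.
rewrite big_cons; set q := \prod_(_ <- _) _ in IH *.
have {}IH : nm q^`().[y] * m <= (size rs)%:R * nm q.[y].
  by apply: IH => s sr; apply: H; rewrite inE sr orbT.
have hr : m <= nm (y - r) by apply: H; rewrite mem_head.
rewrite derivM derivXsubC mul1r hornerD !hornerM hornerXsubC nmM.
apply: (@le_trans _ _ (nm q.[y] * nm (y - r) + nm (y - r) * ((size rs)%:R * nm q.[y]))); last first.
  by rewrite le_eqVlt; apply/orP; left; apply/eqP; rewrite /= -natr1; ring.
apply: (@le_trans _ _ (nm q.[y] * m + nm (y - r) * (nm q^`().[y] * m))).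
  by apply: le_trans (ler_wpM2r m0 (nmD _ _)) _; rewrite nmM mulrDl mulrA.
by apply: lerD; apply: ler_wpM2l => //; exact: nm_ge0.
Qed.

Lemma root_near (p : {poly C}) (y : C) (N : nat) : (size p <= N)%N -> p^`().[y] != 0 ->
  exists2 r, p.[r] = 0 & nm (r - y) * nm p^`().[y] <= N%:R * nm p.[y].
Proof.
move=> sp p'0.
have p0 : p != 0 by apply: contraNneq p'0 => ->; rewrite deriv0 horner0.
have [rs Ep] := closed_field_poly_normal p.
have l0 : lead_coef p != 0 by rewrite lead_coef_eq0.
have srs : (size rs < N)%N by move: sp; rewrite {1}Ep size_scale // size_prod_XsubC.
have n'0 : 0 < nm p^`().[y] by rewrite nm_gt0.
have [py0|py0] := eqVneq p.[y] 0.
  by exists y => //; rewrite py0 subrr !nm0 mul0r mulr0.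
pose m := N%:R * nm p.[y] / nm p^`().[y].
have [/hasP[r rr rm]|/hasPn H] := boolP (has (fun r => nm (y - r) <= m) rs).
  exists r; last by rewrite -ler_pdivlMr // nmB.
  rewrite Ep hornerZ; apply/eqP; rewrite mulf_eq0; apply/orP; right.
  by rewrite -rootE root_prod_XsubC.
have m0 : 0 <= m by rewrite divr_ge0 ?nm_ge0 // mulr_ge0 ?nm_ge0.
have {}H r : r \in rs -> m <= nm (y - r) by move=> /H; rewrite -ltNge => /ltW.
exfalso; have := near_root_bound m0 H; set q := \prod_(_ <- _) _ => Hq.
have Eq : p = lead_coef p *: q by [].
have E1 : nm p.[y] = nm (lead_coef p) * nm q.[y] by rewrite {1}Eq hornerZ nmM.
have E2 : nm p^`().[y] = nm (lead_coef p) * nm q^`().[y] by rewrite {1}Eq derivZ hornerZ nmM.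
have lc0 : 0 < nm (lead_coef p) by rewrite nm_gt0.
have q0 : 0 < nm p.[y] by rewrite nm_gt0.
have Em : nm p^`().[y] * m = N%:R * nm p.[y] by rewrite /m mulrC divfK ?gt_eqF.
have := ler_wpM2l (ltW lc0) Hq; rewrite mulrA -E2 Em (mulrCA (nm (lead_coef p))) -E1.
by rewrite ler_pM2r // ler_nat leqNgt srs.
Qed.

(** At a zero of [f] the factor [u] needs only continuity, because its variation is multiplied by a
    quantity of first order. An implicit root is differentiated in this way. *)
Lemma dd_caratheodory (V : normedModType C) (f u : V -> C) x : differentiable f x -> f x = 0 ->
  {for x, continuous u} -> differentiable (fun z => f z * u z) x.
Proof.
move=> df fx cu.
suff H : differentiable (fun z => f z * (u z - u x)) x.
  by apply: dd_diff (dd_ext (ddD (ddP H) (ddMl (u x) (ddP df))) _ (fun=> erefl)) => z; ring.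
have [dc /(_ 1 ltr01)[r r0 hr]] := (diffCP f x).1 df.
have [m m0 hm] := lin_bounded dc.
have Z := dd_cst (0 : C) x.
have [ZC _] := (diffCP _ x).1 (dd_diff Z).
apply: (proj1 (diffC_intro (L := 'd (fun _ : V => 0 : C) x) ZC _)) => e e0.
have m1 : 0 < m + 1 by rewrite addr_gt0.
have /contCP/(_ _ (divr_gt0 e0 m1))[r' r'0 hr'] := cu.
exists (Num.min r r'); first by rewrite lt_min r0 r'0.
move=> h; rewrite lt_min => /andP[h1 h2].
rewrite (dd_val h Z) fx mul0r !subr0 nmM.
have fh : nm (f (h + x)) <= (m + 1) * nm h.
  have -> : f (h + x) = (f (h + x) - f x - 'd f x h) + 'd f x h by rewrite fx; ring.
  rewrite mulrDl mul1r addrC; apply: le_trans (nmD _ _) (lerD (hm _) _).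
  by have := hr h h1; rewrite mul1r.
have uh : nm (u (h + x) - u x) <= e / (m + 1).
  by apply/ltW/hr'; rewrite addrK.
apply: le_trans (ler_pM (nm_ge0 _) (nm_ge0 _) fh uh) _.
by rewrite le_eqVlt mulrC mulrA divfK ?eqxx // gt_eqF.
Qed.

Variables (V : normedModType C) (N : nat) (c : 'I_N -> V -> C) (x0 : V) (d : R).
Hypotheses (d0 : 0 < d) (hc : forall i, hol_ball (c i) x0 d).

Definition poly_at (x : V) : {poly C} := \sum_(i < N) c i x *: 'X^i.
(** The divided difference of [poly_at x] between two values of the unknown, as a polynomial
    expression that also makes sense when they coincide. *)
Definition quotient_at (p : V * (C * C)) : C :=
  \sum_(i < N) c i p.1 * \sum_(j < i) p.2.1 ^+ (i.-1 - j) * p.2.2 ^+ j.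

Lemma horner_poly_at x y : (poly_at x).[y] = \sum_(i < N) c i x * y ^+ i.
Proof. by rewrite /poly_at horner_sum; apply: eq_bigr => i _; rewrite hornerZ hornerXn. Qed.

Lemma quotient_atE x y y' :
  (poly_at x).[y] - (poly_at x).[y'] = (y - y') * quotient_at (x, (y, y')).
Proof.
rewrite !horner_poly_at -sumrB mulr_sumr; apply: eq_bigr => i _ /=.
by rewrite -mulrBr subrXX mulrCA.
Qed.

Lemma quotient_at_diag x y : quotient_at (x, (y, y)) = (poly_at x)^`().[y].
Proof.
rewrite /quotient_at /poly_at raddf_sum horner_sum; apply: eq_bigr => i _ /=.
rewrite derivZ hornerZ derivXn hornerMn hornerXn; congr (_ * _).
rewrite (eq_bigr (fun=> y ^+ i.-1)) => [|j _]; first by rewrite sumr_const card_ord.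
by rewrite -exprD subnK // -ltnS (leq_trans (ltn_ord j)) // leqSpred.
Qed.

Lemma quotient_diff x y y' : nm (x - x0) < d -> differentiable quotient_at (x, (y, y')).
Proof.
move=> xd.
have D1 (p : V * (C * C)) : dd (fun p : V * (C * C) => p.2.1) p (fun p => p.2.1).
  exact: dd_comp (dd_snd p) (dd_fst _).
have D2 (p : V * (C * C)) : dd (fun p : V * (C * C) => p.2.2) p (fun p => p.2.2).
  exact: dd_comp (dd_snd p) (dd_snd _).
have E (i : 'I_N) (j : 'I_i) := ddM (ddP (ddX (i.-1 - j) (dd_diff (D1 (x, (y, y')))))) (ddP (ddX j (dd_diff (D2 (x, (y, y')))))).
have F (i : 'I_N) : dd (fun p : V * (C * C) => c i p.1) (x, (y, y')) _ :=
  dd_comp (dd_fst (x, (y, y'))) (ddP (hc i xd)).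
exact: dd_diff (dd_sum (fun i => ddM (F i) (dd_sum (E i)))).
Qed.

Lemma poly_at_diff x y : nm (x - x0) < d -> differentiable (fun x => (poly_at x).[y]) x.
Proof.
move=> xd; have D i := ddM (ddP (hc i xd)) (dd_cst (y ^+ i) x).
by apply: dd_diff (dd_ext (dd_sum D) _ (fun=> erefl)) => z; rewrite horner_poly_at.
Qed.

(** On the diagonal the divided difference is the derivative, so it stays away from 0 nearby. This
    forces uniqueness of the root and expresses its increment as a quotient. *)
Theorem simple_root_branch (y0 : C) : (poly_at x0).[y0] = 0 -> (poly_at x0)^`().[y0] != 0 ->
  exists (e r : R) (l : V -> C), [/\ 0 < e /\ 0 < r, e <= d, hol_ball l x0 e,
    forall x, nm (x - x0) < e -> (poly_at x).[l x] = 0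
  & forall x y, nm (x - x0) < e -> nm (y - y0) < r -> (poly_at x).[y] = 0 -> y = l x].
Proof.
move=> Fy0 F'y0.
set k := nm (poly_at x0)^`().[y0]; have k0 : 0 < k by rewrite nm_gt0.
have xx0 : nm (x0 - x0) < d by rewrite subrr nm0.
have /contCP/(_ (k / 2))[|r r0 hr] := differentiable_continuous (quotient_diff y0 y0 xx0).
  by rewrite divr_gt0.
have Klow x y y' : nm (x - x0) < r -> nm (y - y0) < r -> nm (y' - y0) < r ->
    k / 2 < nm (quotient_at (x, (y, y'))).
  move=> hx hy hy'; have := hr (x, (y, y')) (nm_pair_lt hx (nm_pair_lt hy hy')).
  rewrite quotient_at_diag; rewrite -/k.
  have := nmD (quotient_at (x, (y, y'))) ((poly_at x0)^`().[y0] - quotient_at (x, (y, y'))).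
  by rewrite addrC subrK nmB -/k; lra.
have N0 : 0 < N%:R + 1 :> R by rewrite ltr_wpDl.
(* Within [e], [N] times the value at [y0] is below [r * k / 2] while the derivative there exceeds
   [k / 2], so [root_near] finds a root closer than [r]. *)
have /contCP/(_ (r * k / 2 / (N%:R + 1)))[|e e0 he] := differentiable_continuous (poly_at_diff y0 xx0).
  by rewrite !divr_gt0 // mulr_gt0.
pose e' := Num.min e (Num.min r d).
have e'0 : 0 < e' by rewrite !lt_min e0 r0 d0.
have ed x : nm (x - x0) < e' -> [/\ nm (x - x0) < e, nm (x - x0) < r & nm (x - x0) < d].
  by rewrite !lt_min => /and3P[].
have y00 : nm (y0 - y0) < r by rewrite subrr nm0.
have root x : exists y, nm (x - x0) < e' -> (poly_at x).[y] = 0 /\ nm (y - y0) < r.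
  have [/ed[h1 h2 h3]|_] := boolP (nm (x - x0) < e'); last by exists y0.
  have sN : (size (poly_at x) <= N)%N.
    apply: (leq_trans (size_sum _ _ _)); apply/bigmax_leqP => i _.
    by apply: (leq_trans (size_scale_leq _ _)); rewrite size_polyXn.
  have K1 := Klow x y0 y0 h2 y00 y00; rewrite quotient_at_diag in K1.
  have p'0 : (poly_at x)^`().[y0] != 0.
    by rewrite -nm_gt0; apply: lt_trans K1; rewrite divr_gt0.
  have [y y1 y2] := root_near sN p'0; exists y => _; split=> //.
  have := he x h1; rewrite Fy0 subr0 ltr_pdivlMr // => H.
  have k2 : 0 < k / 2 by rewrite divr_gt0.
  rewrite -(ltr_pM2r k2); apply: le_lt_trans (_ : N%:R * nm (poly_at x).[y0] < _).
    by apply: le_trans y2; apply: ler_wpM2l; [exact: nm_ge0 | exact: ltW].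
  rewrite mulrA; apply: le_lt_trans H; rewrite mulrC; apply: ler_wpM2l; [exact: nm_ge0|].
  by rewrite lerDl.
have [l hl] := choice root.
have uniq x y : nm (x - x0) < e' -> nm (y - y0) < r -> (poly_at x).[y] = 0 -> y = l x.
  move=> xe yr Fy; have [Fl lr] := hl x xe; have [_ h2 _] := ed x xe.
  have := quotient_atE x y (l x); rewrite Fy Fl subrr => /esym/eqP.
  rewrite mulf_eq0 subr_eq0 => /orP[/eqP //|/eqP K0].
  by have := Klow x y (l x) h2 yr lr; rewrite K0 nm0 pmulr_llt0 // ltNge ltW.
exists e', r, l; split=> //; first by rewrite /e' !ge_min lexx !orbT.
  2: by move=> x /hl[].
move=> x1 x1e; have [Fl1 lr1] := hl x1 x1e; have [_ g2 g3] := ed x1 x1e.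
set y1 := l x1 in Fl1 lr1 *.
have k2 : 0 < k / 2 by rewrite divr_gt0.
have diffl x : nm (x - x0) < e' -> (l x - y1) * quotient_at (x, (l x, y1)) = - (poly_at x).[y1].
  by move=> xe; have [Fl lr] := hl x xe; rewrite -quotient_atE Fl sub0r.
have e1 : 0 < e' - nm (x1 - x0) by rewrite subr_gt0.
have near x : nm (x - x1) < e' - nm (x1 - x0) -> nm (x - x0) < e'.
  by move=> xe; apply: le_lt_trans (nm_dist _ _ x1) _; rewrite -ltrBrDr.
have cl : {for x1, continuous l}.
  apply/contCP => z z0.
  have /contCP/(_ (z * (k / 2)))[|w w0 hw] := differentiable_continuous (poly_at_diff y1 g3).
    exact: mulr_gt0.
  exists (Num.min w (e' - nm (x1 - x0))); first by rewrite lt_min w0.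
  move=> x; rewrite lt_min => /andP[xw /near xe]; have [Fl lr] := hl x xe; have [_ h2 _] := ed x xe.
  have := hw x xw; rewrite Fl1 subr0 -nmN -diffl // nmM => H.
  rewrite -(ltr_pM2r k2); apply: le_lt_trans H; apply: ler_wpM2l; first exact: nm_ge0.
  by apply/ltW/Klow.
have cq : {for x1, continuous (fun x => quotient_at (x, (l x, y1)))}.
  apply/contCP => z z0.
  have /contCP/(_ z z0)[w w0 hw] := differentiable_continuous (quotient_diff y1 y1 g3).
  have /contCP/(_ w w0)[w' w'0 hw'] := cl.
  exists (Num.min w w'); first by rewrite lt_min w0.
  move=> x; rewrite lt_min => /andP[xw xw']; apply: hw.
  by apply: nm_pair_lt xw (nm_pair_lt (hw' x xw') _); rewrite subrr nm0.
have q1 : quotient_at (x1, (y1, y1)) != 0.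
  by rewrite -nm_gt0; apply: lt_trans k2 _; exact: Klow.
have cu : {for x1, continuous (fun x => - (quotient_at (x, (l x, y1)))^-1)}.
  exact: cvgN (cvgV q1 cq).
(* Near [x1], [l x - y1] is the value of the polynomial at the fixed [y1], which vanishes at [x1],
   times a factor so far known only to be continuous. *)
have D := dd_caratheodory (poly_at_diff y1 g3) Fl1 cu.
have D' := ddD (dd_cst y1 x1) (ddP D).
apply: near_diff (dd_diff D'); exists (e' - nm (x1 - x0)) => // x /near xe.
have [Fl lr] := hl x xe; have [_ h2 _] := ed x xe.
have qn0 : quotient_at (x, (l x, y1)) != 0 by rewrite -nm_gt0; apply: lt_trans k2 _; exact: Klow.
by rewrite mulrN -mulNr -diffl // mulfK // addrC subrK.
Qed.

End ImplicitRoot.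

Section RowVectors.
Variable R : realType.
Local Notation C := (Cplx R).

Lemma nm_row_ltP r (x : 'rV[C]_r) (e : R) : 0 < e -> nm x < e <-> forall j, nm (x 0 j) < e.
Proof.
move=> e0.
have B (V : normedModType C) (y : V) : ball 0 (ofR e) y <-> nm y < e.
  by rewrite -ball_normE /= sub0r normrN nmE ltr_ofR.
split=> [/B[_ H] j|H]; first by apply/B; have := H 0 j; rewrite mxE.
by apply/B; split=> [|i j]; [rewrite ltr_ofR | rewrite mxE ord1; apply/B].
Qed.

Lemma nm_coord r (x : 'rV[C]_r) j : nm (x 0 j) <= nm x.
Proof.
apply/ler_addgt0Pr => e e0; apply/ltW.
have xe : nm x < nm x + e by rewrite ltrDl.
exact: (nm_row_ltP x (le_lt_trans (nm_ge0 x) xe)).1.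
Qed.

Lemma dd_coord r (x : 'rV[C]_r) j : dd (fun x : 'rV[C]_r => x 0 j) x (fun x => x 0 j).
Proof.
have lf : linear (fun x : 'rV[C]_r => x 0 j : C) by move=> a u v; rewrite !mxE.
pose fM := GRing.isLinear.Build _ _ _ _ _ lf.
pose f : {linear 'rV[C]_r -> C} := HB.pack (fun x : 'rV[C]_r => x 0 j : C) fM.
apply: (@dd_lin R _ _ f 1) => v; rewrite mul1r; exact: nm_coord.
Qed.

Lemma ddZl (V W : normedModType C) (f : V -> C) (v : W) x L : dd f x L ->
  dd (fun z => f z *: v) x (fun h => L h *: v).
Proof.
move=> [df <-]; split; first exact: (@differentiableZl C V W f v x df).
exact: (@diffZl C V W f v x df).
Qed.

Lemma dd_row (V : normedModType C) r (f L : 'I_r -> V -> C) x :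
  (forall j, dd (f j) x (L j)) -> dd (fun z => \row_j f j z) x (fun h => \row_j L j h).
Proof.
move=> H.
have E (g : 'I_r -> C) : \sum_j g j *: (delta_mx 0 j : 'rV[C]_r) = \row_j g j.
  by rewrite [RHS]row_sum_delta; apply: eq_bigr => j _; rewrite mxE.
exact: dd_ext (dd_sum (fun j => ddZl (delta_mx 0 j : 'rV[C]_r) (H j))) (fun z => E _) (fun h => E _).
Qed.

Lemma nm_conj (z : C) : nm z^* = nm z.
Proof. by rewrite /nm norm_conjC. Qed.

(** The two conjugations, inside and outside, compensate and leave a C-linear differential. *)
Lemma dd_star (h : C -> C) (w c : C) : dd h w^* (fun k => k * c) ->
  dd (fun w => (h w^* )^* ) w (fun k => k * c^* ).
Proof.
move=> D; have D' := ddMl c^* (dd_id w).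
have [cL _] := (diffCP _ w).1 (dd_diff D').
have [_ H] := (diffCP _ _).1 (dd_diff D).
have [dh Eh] : differentiable (fun w => (h w^* )^* ) w /\
   ('d (fun w => (h w^* )^* ) w = 'd (fun z : C => c^* * id z) w :> (C -> C)).
  apply: diffC_intro cL _ => e e0; have [r r0 hr] := H e e0.
  exists r; first exact: r0.
  move=> k kr; rewrite (dd_val k D').
  have E : (h (k + w)^* )^* - (h w^* )^* - c^* * k = (h (k^* + w^* ) - h w^* - 'd h (w^* ) k^* )^*.
    have kc : (k^* * c)^* = c^* * k by rewrite rmorphM /= conjCK mulrC.
    by rewrite (dd_val _ D) (rmorphD _ k w) !rmorphB /= kc.
  by rewrite E nm_conj -(nm_conj k); apply: hr; rewrite nm_conj.
split; first exact: dh.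
rewrite Eh; apply/funext => k; by rewrite (dd_val k D') mulrC.
Qed.

Lemma fin_min (I : finType) (e : I -> R) : (forall i, 0 < e i) ->
  exists2 e0, 0 < e0 & forall i, e0 <= e i.
Proof.
move=> he; suff [e0 h1 h2] : exists2 e0, 0 < e0 & forall i, i \in enum I -> e0 <= e i.
  by exists e0 => // i; apply: h2; rewrite mem_enum.
elim: (enum I) => [|i s [e0 h1 h2]]; first by exists 1.
exists (Num.min e0 (e i)) => [|j]; first by rewrite lt_min h1 he.
by rewrite inE ge_min => /orP[/eqP ->|/h2 ->]; rewrite ?lexx ?orbT.
Qed.
End RowVectors.

(** * Transcendence bases of finite families of functions *)

Section TranscendenceBasis.
Variable R : realType.
Local Notation C := (Cplx R).
Variables (N : nat) (x : 'I_N -> C -> C) (z0 : C) (d : R).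

Definition independent r (s : 'I_r -> 'I_N) :=
  forall p : mpoly r C, (forall z, nm (z - z0) < d -> meval (fun i => x (s i) z) p = 0) -> p = 0.

Definition relation r (s : 'I_r -> 'I_N) j (P : {poly (mpoly r C)}) :=
  forall z, nm (z - z0) < d -> (map_poly (meval (fun i => x (s i) z)) P).[x j z] = 0.

Lemma independent_inj r (s : 'I_r -> 'I_N) : independent s -> injective s.
Proof.
move=> h i j ij; apply/eqP/negPn/negP => nij.
have := h (mpolyX C (mnm1 i) - mpolyX C (mnm1 j)) => E.
have /(congr1 (meval (fun k => (k == i)%:R))) : mpolyX C (mnm1 i) - mpolyX C (mnm1 j) = 0.
  by apply: E => z _; rewrite mevalB !mevalXU ij subrr.
by rewrite mevalB !mevalXU eqxx eq_sym (negbTE nij) subr0 meval0 => /eqP; rewrite oner_eq0.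
Qed.

Lemma mpoly_deriv0 r (P : {poly (mpoly r C)}) : P^`() = 0 -> P = (P`_0)%:P.
Proof.
move=> P'; apply/polyP => -[|i]; rewrite coefC //=.
have := congr1 (fun q : {poly (mpoly r C)} => q`_i) P'; rewrite coef_deriv coef0 => E.
apply/mpolyP => m; have := congr1 (mcoeff m) E; rewrite mcoeffMn mcoeff0 => /eqP.
by rewrite mulrn_eq0 => /eqP.
Qed.

(** While the derivative is still a relation, it replaces [P]. The descent stops before a constant
    polynomial, which independence excludes as a nonzero relation. *)
Lemma separable_relation r (s : 'I_r -> 'I_N) j P : independent s -> P != 0 -> relation s j P ->
  exists P, [/\ P != 0, relation s j P &
    exists2 z, nm (z - z0) < d & (map_poly (meval (fun i => x (s i) z)) P^`()).[x j z] != 0].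
Proof.
move=> hs; elim: {P}(size P) {-2}P (leqnn (size P)) => [|n IH] P sP P0 hP.
  by move: sP; rewrite leqn0 size_poly_eq0 (negbTE P0).
have [H|H] := pselect (relation s j P^`()); last first.
  exists P; split=> //; apply/not_exists2P => H'; apply: H => z zd.
  by case: (H' z) => // /negP; rewrite negbK => /eqP.
have [P'0|P'0] := eqVneq P^`() 0; last first.
  by apply: (IH _ _ P'0 H); rewrite -ltnS (leq_trans (lt_size_deriv P0)).
exfalso; case/eqP: P0; rewrite (mpoly_deriv0 P'0) (hs P`_0) ?polyC0 // => z zd.
by have := hP z zd; rewrite (mpoly_deriv0 P'0) map_polyC hornerC coefC.
Qed.

(** An independent family of maximal size. The last clause makes each component a simple root at
    some point, as the implicit function theorem requires. *)
Lemma transcendence_basis : 0 < d -> exists r (s : 'I_r -> 'I_N), independent s /\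
  forall j, exists P, [/\ P != 0, relation s j P &
    exists2 z, nm (z - z0) < d & (map_poly (meval (fun i => x (s i) z)) P^`()).[x j z] != 0].
Proof.
move=> d0; pose Ind r := `[< exists s : 'I_r -> 'I_N, independent s >].
have I0 : exists r, Ind r.
  exists 0%N; apply/asboolP; have s : 'I_0 -> 'I_N by case.
  exists s => p Hp; apply/eqP/negPn/negP => /meval_nonzero[v].
  have -> : v = (fun i => x (s i) z0) by apply/funext; case.
  by rewrite Hp ?eqxx // subrr nm0.
have IN r : Ind r -> (r <= N)%N.
  move=> /asboolP[s /independent_inj sI].
  by have := leq_card s sI; rewrite !card_ord.
case: (ex_maxnP I0 IN) => r /asboolP[s hs] hr; exists r, s; split=> // j.
(* The new component takes the last variable, which [muni] turns into the indeterminate of a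
   univariate polynomial. *)
pose s' (i : 'I_r.+1) := if unlift ord_max i is Some k then s k else j.
have H : ~ exists s : 'I_r.+1 -> 'I_N, independent s.
  by move=> /asboolP /hr; rewrite ltnn.
have [p Hp p0] : exists2 p : mpoly r.+1 C,
    (forall z, nm (z - z0) < d -> meval (fun i => x (s' i) z) p = 0) & p != 0.
  apply: contrapT => H'; apply: H; exists s' => p Hp; apply/eqP/negPn/negP => p0.
  by apply: H'; exists p.
apply: (@separable_relation r s j (muni p) hs).
  by apply: contra p0 => /eqP/muni_inj ->.
move=> z zd; have := Hp z zd; rewrite muni_eval /s' unlift_none => <-.
congr (_.[_]); congr (map_poly _ _); apply/funext => q; apply: meval_eq => i.
by have -> : widen_ord (leqnSn r) i = lift ord_max i; [apply/val_inj; rewrite /= /bump leqNgt ltn_ord|rewrite liftK].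
Qed.

End TranscendenceBasis.

(** * Nash functions along algebraic maps *)

Section NashComposition.
Variable R : realType.
Local Notation C := (Cplx R).

Lemma dd_path k (a b e : 'I_k -> C) :
  dd (fun s : C => \row_i (a i + s * b i + s ^+ 2 * e i)) 0 (fun h : C => h *: \row_i b i).
Proof.
have D i := ddD (ddD (dd_cst (a i) 0) (ddM (dd_id 0) (dd_cst (b i) 0)))
  (ddM (ddM (dd_id 0) (dd_id 0)) (dd_cst (e i) 0)).
apply: dd_ext (dd_row D) _ _ => h; apply/rowP => i; rewrite !mxE /= ?expr2 //.
by ring.
Qed.

Variables (T : pointedType) (A : idomainType) (ev : {rmorphism A -> (T -> C)}) (H : (T -> C) -> Prop)
  (cA : C -> A).
Hypotheses (H_ev : forall a, H (ev a)) (HD : forall x y, H x -> H y -> H (x + y))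
  (HM : forall x y, H x -> H y -> H (x * y))
  (Hdom : forall x y, H x -> H y -> x * y = 0 -> x = 0 \/ y = 0)
  (ev_inj : forall a, ev a = 0 -> a = 0) (ev_cst : forall c, ev (cA c) = (fun=> c)).
Variables (k : nat) (Psi : 'rV[C]_k -> C) (p0 : 'rV[C]_k) (d : R) (P : mpoly (k + 1) C).
Hypotheses (hPsi : hol_ball Psi p0 d) (P0 : P != 0)
  (hP : forall p, nm (p - p0) < d -> meval (fun i => row_mx p (Psi p)%:M 0 i) P = 0).
Variable a : 'I_k -> T -> C.
Hypotheses (ha : forall i, AlgIn ev H (a i)) (a_in : forall x, nm (\row_i a i x - p0) < d).

Let path (b e : 'I_k -> C) x (s : C) : 'rV[C]_k := \row_i (a i x + s * b i + s ^+ 2 * e i).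

Let path0 b e x : path b e x 0 = \row_i a i x.
Proof. by apply/rowP => i; rewrite !mxE expr2 !mul0r !addr0. Qed.

Let path_in b e x : exists2 r : R, 0 < r & forall s, nm s < r -> nm (path b e x s - p0) < d.
Proof.
have dx : 0 < d - nm (\row_i a i x - p0) by rewrite subr_gt0.
have /contCP/(_ _ dx)[r r0 hr] := differentiable_continuous (dd_diff (dd_path (fun i => a i x) b e)).
exists r => // s sr; apply: le_lt_trans (nm_dist _ _ (\row_i a i x)) _.
rewrite -ltrBrDr; have := hr s; rewrite subr0 => /(_ sr).
by have E0 := path0 b e x; rewrite /path in E0 *; rewrite E0.
Qed.

Let dd_psi b e x : dd (fun s => Psi (path b e x s)) 0
  (fun h => h * 'd Psi (\row_i a i x) (\row_i b i)).
Proof.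
have DP : dd Psi (path b e x 0) ('d Psi (\row_i a i x)).
  by rewrite path0; exact: ddP (hPsi (a_in x)).
apply: dd_eq (dd_comp (dd_path (fun i => a i x) b e) DP) _ => h.
exact: (linearZZ ('d Psi (\row_i a i x))).
Qed.

Let AH0 : AlgIn ev H 0.
Proof. exact: ss0 (AlgIn_subsemi H_ev HD HM). Qed.

Theorem nash_comp_Alg : Alg ev (fun x => Psi (\row_i a i x)).
Proof.
(* Order 0 and direction 0: the limit at [s = 0] is the value of [Psi] itself. *)
have [e He] := nash_Alg H_ev HD HM Hdom ev_inj ev_cst (fun=> 0) 0 P0 ha AH0.
apply: (He _ (fun s x => Psi (path (fun=> 0) e x s))) => x.
  have [r r0 hr] := path_in (fun=> 0) e x; exists r => // s _ sr.
  rewrite -[RHS](hP (hr s sr)); apply: meval_eq => i; rewrite mxE.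
  case: (fintype.split i) => j; rewrite mxE //.
  by rewrite [j]ord1 eqxx mulr1n expr0 mul1r add0r.
move=> z z0; have /contCP/(_ z z0)[r r0 hr] := differentiable_continuous (dd_diff (dd_psi (fun=> 0) e x)).
by exists r => // s _ sr; have := hr s; rewrite subr0 path0 => /(_ sr).
Qed.

Theorem nash_derive_Alg (b : 'rV[C]_k) : H (fun x => Psi (\row_i a i x)) ->
  Alg ev (fun x => 'd Psi (\row_i a i x) b).
Proof.
move=> HPsi.
have AP : AlgIn ev H (fun x => Psi (\row_i a i x)) by split=> //; exact: nash_comp_Alg.
(* Order 1 around the value of [Psi], already known to be algebraic: the limit is that of the
   difference quotients in the direction [b]. *)
have [e He] := nash_Alg H_ev HD HM Hdom ev_inj ev_cst (fun i => b 0 i) 1 P0 ha AP.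
have Eb : \row_i b 0 i = b by apply/rowP => i; rewrite mxE.
pose p := path (fun i => b 0 i) e.
apply: (He _ (fun s x => (Psi (p x s) - Psi (\row_i a i x)) / s)) => x.
  have [r r0 hr] := path_in (fun i => b 0 i) e x; exists r => // s s0 sr.
  rewrite -[RHS](hP (hr s sr)); apply: meval_eq => i; rewrite mxE.
  case: (fintype.split i) => j; rewrite mxE //.
  by rewrite [j]ord1 eqxx mulr1n expr1 mulrC divfK // addrC subrK.
move=> z z0; have [_ /(_ _ (divr_gt0 z0 (ltr0Sn _ 1)))[r r0 hr]] := (diffCP _ _).1 (dd_diff (dd_psi (fun i => b 0 i) e x)).
exists r => // s s0 sr; have := hr s sr; rewrite (dd_val s (dd_psi _ _ _)) addr0 path0 Eb => B.
have ns : 0 < nm s by rewrite nm_gt0.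
rewrite -(ltr_pM2r ns) -nmM mulrBl divfK // [_ * s]mulrC; apply: le_lt_trans B _.
by rewrite ltr_pM2r // ltr_pdivrMr // ltr_pMr // ltr1n.
Qed.

End NashComposition.

Section PartialDerivatives.
Variable R : realType.
Local Notation C := (Cplx R).

Lemma direction_constant (V : normedModType C) (f : V -> C) x d v y : hol_ball f x d ->
  (forall y, nm (y - x) < d -> 'd f y v = 0) ->
  nm (y - x) < d -> nm (y + v - x) < d -> f (y + v) = f y.
Proof.
move=> hf f0 hy hyv; apply/eqP; rewrite -subr_eq0 -nm_eq0; apply/eqP/le_anti; rewrite nm_ge0 andbT.
rewrite -(mulr0 2); apply: segment_mvt => t ht; have yt := ball_segment hy hyv ht.
  exact: hf.
by rewrite f0 // nm0.
Qed.

(** Symmetry of the second derivatives of log F - b T, written without choosing a logarithm. *)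
Lemma mixed_log_symmetric (V : normedModType C) (F T : V -> C) (b : C) x d (u v : V) : 0 < d ->
  hol_ball F x d -> hol_ball T x d -> F x != 0 ->
  'd (fun p => 'd F p u / F p - b * 'd T p u) x v =
  'd (fun p => 'd F p v / F p - b * 'd T p v) x u.
Proof.
move=> d0 hF hT Fx.
have xx : nm (x - x) < d by rewrite subrr nm0.
have D w := ddB (ddM (ddP (dir_differentiable w d0 hF)) (ddV (ddP (hF x xx)) Fx))
  (ddMl b (ddP (dir_differentiable w d0 hT))).
apply: etrans (dd_val v (D u)) _; apply: etrans _ (esym (dd_val u (D v))).
have E (p q g i s s' t t' : C) : s = s' -> t = t' ->
    p * (g * q) + i * s - b * t = q * (g * p) + i * s' - b * t'.
  by move=> -> ->; ring.
exact: E (dir_symmetric u v d0 hF) (dir_symmetric u v d0 hT).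
Qed.

Lemma mixed_log_hol (V : normedModType C) (F T : V -> C) (b : C) x d (u : V) :
  hol_ball F x d -> hol_ball T x d -> (forall y, nm (y - x) < d -> F y != 0) ->
  hol_ball (fun p => 'd F p u / F p - b * 'd T p u) x d.
Proof.
move=> hF hT F0 y yd.
have e0 : 0 < d - nm (y - x) by rewrite subr_gt0.
have hs (G : V -> C) : hol_ball G x d -> hol_ball G y (d - nm (y - x)).
  by move=> hG z zd; apply: hG; apply: le_lt_trans (nm_dist _ _ y) _; rewrite -ltrBrDr.
exact: dd_diff (ddB (ddM (ddP (dir_differentiable u e0 (hs _ hF))) (ddV (ddP (hF y yd)) (F0 y yd)))
  (ddMl b (ddP (dir_differentiable u e0 (hs _ hT))))).
Qed.

Lemma hol_dir (V : normedModType C) (f : V -> C) x d v :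
  hol_ball f x d -> hol_ball (fun p => 'd f p v) x d.
Proof.
move=> hf y yd; have e0 : 0 < d - nm (y - x) by rewrite subr_gt0.
apply: (dir_differentiable v e0) => z zd.
by apply: hf; apply: le_lt_trans (nm_dist _ _ y) _; rewrite -ltrBrDr.
Qed.

End PartialDerivatives.

Section BaseRings.
Variable R : realType.
Local Notation C := (Cplx R).

Lemma diff_sum_seq (V : normedModType C) (I : Type) (s : seq I) (f : I -> V -> C) x :
  (forall i, differentiable (f i) x) -> differentiable (fun z => \sum_(i <- s) f i z) x.
Proof.
move=> H; elim: s => [|i s IH].
  by apply: dd_diff (dd_ext (dd_cst (0 : C) x) _ (fun=> erefl)) => z; rewrite big_nil.
by apply: dd_diff (dd_ext (ddD (ddP (H i)) (ddP IH)) _ (fun=> erefl)) => z; rewrite big_cons.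
Qed.

Lemma diff_prod_seq (V : normedModType C) (I : Type) (s : seq I) (f : I -> V -> C) x :
  (forall i, differentiable (f i) x) -> differentiable (fun z => \prod_(i <- s) f i z) x.
Proof.
move=> H; elim: s => [|i s IH].
  by apply: dd_diff (dd_ext (dd_cst (1 : C) x) _ (fun=> erefl)) => z; rewrite big_nil.
by apply: dd_diff (dd_ext (ddM (ddP (H i)) (ddP IH)) _ (fun=> erefl)) => z; rewrite big_cons.
Qed.

Lemma diff_meval (V : normedModType C) r (p : mpoly r C) (f : 'I_r -> V -> C) x :
  (forall i, differentiable (f i) x) -> differentiable (fun z => meval (fun i => f i z) p) x.
Proof.
move=> H.
have D m : differentiable (fun z => mcoeff m p * \prod_(i <- index_enum 'I_r) f i z ^+ m i) x.
  exact: dd_diff (ddMl _ (ddP (diff_prod_seq _ (fun i => ddX (m i) (H i))))).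
apply: dd_diff (dd_ext (ddP (diff_sum_seq (msupp p) D)) _ (fun=> erefl)) => z.
by rewrite mevalE.
Qed.

Lemma hol_meval_coord r (p : mpoly r C) (x : 'rV[C]_r) d :
  hol_ball (fun y : 'rV[C]_r => meval (fun i => y 0 i) p) x d.
Proof. by move=> y _; apply: diff_meval => i; exact: dd_diff (dd_coord y i). Qed.

Section MPoly.
Variables (r : nat) (x0 : 'rV[C]_r) (d : R).
Hypothesis d0 : 0 < d.
Local Notation K := ('rV[C]_r -> C).

Definition mpoly_on_ball (p : mpoly r C) : K :=
  fun x => meval (fun i => retract_ball x0 d x 0 i) p.

Lemma mpoly_on_ball_monoid : monoid_morphism mpoly_on_ball.
Proof.
split=> [|p q]; apply/funext => t; first by rewrite /mpoly_on_ball rmorph1.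
by rewrite /mpoly_on_ball rmorphM.
Qed.
Lemma mpoly_on_ball_zmod : zmod_morphism mpoly_on_ball.
Proof. by move=> p q; apply/funext => t; rewrite /mpoly_on_ball rmorphB. Qed.
HB.instance Definition _ := GRing.isZmodMorphism.Build (mpoly r C) K mpoly_on_ball mpoly_on_ball_zmod.
HB.instance Definition _ := GRing.isMonoidMorphism.Build (mpoly r C) K mpoly_on_ball mpoly_on_ball_monoid.

Lemma mpoly_germ p : hol_germ x0 d (mpoly_on_ball p).
Proof. by exists (fun y : 'rV[C]_r => meval (fun i => y 0 i) p) => //; exact: hol_meval_coord. Qed.

Lemma mpoly_on_ball_inj p : mpoly_on_ball p = 0 -> p = 0.
Proof.
move=> p0; apply/eqP/negPn/negP => /meval_nonzero[v].
pose x : 'rV[C]_r := \row_i v i.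
have -> : meval v p = meval (fun i => x 0 i) p by apply: meval_eq => i; rewrite mxE.
have z : zero_near (fun y : 'rV[C]_r => meval (fun i => y 0 i) p) x0.
  by exists d => // y yd; have := congr1 (fun h : K => h y) p0; rewrite /mpoly_on_ball retract_ball_id.
rewrite (identity_ball (@hol_meval_coord r p x0 (nm (x - x0) + 1)) _ z) ?eqxx //.
- by rewrite subrr nm0; have := nm_ge0 (x - x0); lra.
- by lra.
Qed.

Lemma mpoly_on_ball_cst c : mpoly_on_ball (mpolyC r c) = (fun=> c).
Proof. by apply/funext => x; rewrite /mpoly_on_ball mevalC. Qed.

End MPoly.

Lemma poly_in_cst (f : C -> C) c : poly_in f c%:P = (fun=> c).
Proof. by apply/funext => x; rewrite /poly_in hornerC. Qed.

End BaseRings.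

(** * The polarized space form norm and Nash potential *)

Section Potentials.
Variable R : realType.
Local Notation C := (Cplx R).

Definition join_row m (u v : 'I_m -> C) : 'rV[C]_(m + m) := row_mx (\row_j u j) (\row_j v j).

(** Holomorphic in [w] and equal to the conjugate of [h z] at [w = z^*]: the polarization of the
    conjugate of [h]. *)
Definition star (h : C -> C) (w : C) : C := (h w^* )^*.
Definition dstar (h : C -> C) (w : C) : C := (derive1 h w^* )^*.

Lemma dd_starD (h : C -> C) w : differentiable h w^* -> dd (star h) w (fun k => k * dstar h w).
Proof. by move=> dh; apply: dd_star; exact: dd1. Qed.

Lemma dd_join_row (V : normedModType C) m (u v Lu Lv : 'I_m -> V -> C) x :
  (forall j, dd (u j) x (Lu j)) -> (forall j, dd (v j) x (Lv j)) ->
  dd (fun z => join_row (fun j => u j z) (fun j => v j z)) x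
     (fun h => join_row (fun j => Lu j h) (fun j => Lv j h)).
Proof.
move=> Du Dv.
pose F (f g : 'I_m -> V -> C) (i : 'I_(m + m)) : V -> C :=
  match fintype.split i with inl j => f j | inr j => g j end.
have D i : dd (F u v i) x (F Lu Lv i) by rewrite /F; case: (fintype.split i).
have E f g z : \row_i F f g i z = join_row (fun j => f j z) (fun j => g j z).
  by apply/rowP => i; rewrite !mxE /F; case: (fintype.split i) => j; rewrite mxE.
exact: dd_ext (dd_row D) (E u v) (E Lu Lv).
Qed.

Variables (n m : nat) (f : 'I_n -> C -> C) (l : 'I_m -> C -> C).
Variables (alpha : C) (beta : 'I_n -> C) (Psi : 'rV[C]_(m + m) -> C).

(** The first argument is free instead of being [f(z)], so that branches over the transcendence
    basis can be inserted; [fs_dw] and [pot_dw] are the derivatives in [w] of [fs_val] and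
    [pot_val]. *)
Definition fs_val (g : 'I_n -> C) (w : C) : C := alpha + \sum_k beta k * (g k * star (f k) w).
Definition fs_dw (g : 'I_n -> C) (w : C) : C := \sum_k beta k * (g k * dstar (f k) w).
Definition pot_val (u : 'I_m -> C) (w : C) : C := Psi (join_row u (fun j => star (l j) w)).
Definition pot_dw (u : 'I_m -> C) (w : C) : C :=
  'd Psi (join_row u (fun j => star (l j) w)) (join_row (fun=> 0) (fun j => dstar (l j) w)).

Definition fs_on (V : Type) (g : 'I_n -> V -> C) (p : V * C) : C := fs_val (fun k => g k p.1) p.2.
Definition pot_on (V : Type) (u : 'I_m -> V -> C) (p : V * C) : C := pot_val (fun k => u k p.1) p.2.

Section V.
Variables (V : normedModType C) (g : 'I_n -> V -> C) (u : 'I_m -> V -> C).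

Lemma dd_fs_on (p : V * C) : (forall k, differentiable (g k) p.1) ->
  (forall k, differentiable (f k) p.2^* ) ->
  dd (fs_on g) p (fun h : V * C => \sum_k beta k * (g k p.1 * (h.2 * dstar (f k) p.2) +
                                           star (f k) p.2 * 'd (g k) (p.1) h.1)).
Proof.
move=> hg hf.
have D k := ddMl (beta k) (ddM (dd_comp (dd_fst p) (ddP (hg k))) (dd_comp (dd_snd p) (dd_starD (hf k)))).
by apply: dd_ext (ddD (dd_cst alpha p) (dd_sum D)) _ _ => h //=; rewrite add0r.
Qed.

Lemma dd_pot_on (p : V * C) : (forall k, differentiable (u k) p.1) ->
  (forall k, differentiable (l k) p.2^* ) ->
  differentiable Psi (join_row (fun k => u k p.1) (fun j => star (l j) p.2)) ->
  dd (pot_on u) p (fun h : V * C => 'd Psi (join_row (fun k => u k p.1) (fun j => star (l j) p.2))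
     (join_row (fun j => 'd (u j) (p.1) h.1) (fun j => h.2 * dstar (l j) p.2))).
Proof.
move=> hu hl hP.
have D1 k := dd_comp (dd_fst p) (ddP (hu k)).
have D2 k := dd_comp (dd_snd p) (dd_starD (hl k)).
exact: dd_comp (dd_join_row D1 D2) (ddP hP).
Qed.

Lemma d_fs_on (p : V * C) : (forall k, differentiable (g k) p.1) ->
  (forall k, differentiable (f k) p.2^* ) ->
  'd (fs_on g) p ((0, 1) : V * C) = fs_dw (fun k => g k p.1) p.2.
Proof.
move=> hg hf; rewrite (dd_val ((0, 1) : V * C) (dd_fs_on hg hf)); apply: eq_bigr => k _ /=.
by rewrite (linear0 ('d (g k) (p.1))) mulr0 addr0 mul1r.
Qed.

Lemma d_pot_on (p : V * C) : (forall k, differentiable (u k) p.1) ->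
  (forall k, differentiable (l k) p.2^* ) ->
  differentiable Psi (join_row (fun k => u k p.1) (fun j => star (l j) p.2)) ->
  'd (pot_on u) p ((0, 1) : V * C) = pot_dw (fun k => u k p.1) p.2.
Proof.
move=> hu hl hP; rewrite (dd_val ((0, 1) : V * C) (dd_pot_on hu hl hP)) /pot_dw; congr ('d _ _ _).
by congr row_mx; apply/rowP => j; rewrite !mxE /= ?mul1r // (linear0 ('d (u j) (p.1))).
Qed.

End V.

Section Algebraicity.
Variables (T : pointedType) (A : idomainType) (ev : {rmorphism A -> (T -> C)}) (H : (T -> C) -> Prop)
  (cA : C -> A).
Hypotheses (H_ev : forall a, H (ev a)) (HD : forall x y, H x -> H y -> H (x + y))
  (HM : forall x y, H x -> H y -> H (x * y))
  (Hdom : forall x y, H x -> H y -> x * y = 0 -> x = 0 \/ y = 0)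
  (ev_inj : forall a, ev a = 0 -> a = 0) (ev_cst : forall c, ev (cA c) = (fun=> c)).
Variables (p0 : 'rV[C]_(m + m)) (d : R) (P : mpoly (m + m + 1) C).
Hypotheses (hPsi : hol_ball Psi p0 d) (P0 : P != 0)
  (hP : forall p, nm (p - p0) < d -> meval (fun i => row_mx p (Psi p)%:M 0 i) P = 0).

Lemma AlgIn_lin (c : 'I_n -> C) (g : 'I_n -> T -> C) a : (forall k, AlgIn ev H (g k)) ->
  AlgIn ev H (fun x => a + \sum_k c k * g k x).
Proof.
move=> hg; have S := AlgIn_subsemi H_ev HD HM.
have -> : (fun x => a + \sum_k c k * g k x) = (fun=> a) + \sum_k (fun=> c k) * g k.
  by apply/funext => x; rewrite -[RHS]/(_ + _) fct_sumE.
apply: (ssD S); first exact: (AlgIn_cst H_ev ev_cst).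
by apply: (ss_sum _ _ S) => k; apply: (ssM S) => //; exact: (AlgIn_cst H_ev ev_cst).
Qed.

Lemma fs_val_AH (g : 'I_n -> T -> C) w : (forall k, AlgIn ev H (g k)) ->
  AlgIn ev H (fun x => fs_val (fun k => g k x) w).
Proof.
move=> /(AlgIn_lin (fun k => beta k * star (f k) w) alpha) HL.
have -> // : (fun x => fs_val (fun k => g k x) w) = (fun x => alpha + \sum_k (beta k * star (f k) w) * g k x).
by apply/funext => x; congr (_ + _); apply: eq_bigr => k _; ring.
Qed.

Lemma fs_dw_AH (g : 'I_n -> T -> C) w : (forall k, AlgIn ev H (g k)) ->
  AlgIn ev H (fun x => fs_dw (fun k => g k x) w).
Proof.
move=> /(AlgIn_lin (fun k => beta k * dstar (f k) w) 0) HL.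
have -> // : (fun x => fs_dw (fun k => g k x) w) = (fun x => 0 + \sum_k (beta k * dstar (f k) w) * g k x).
by apply/funext => x; rewrite add0r; apply: eq_bigr => k _; ring.
Qed.

Variables (u : 'I_m -> T -> C) (w : C).
Hypotheses (hu : forall j, AlgIn ev H (u j))
  (u_in : forall x, nm (join_row (fun j => u j x) (fun j => star (l j) w) - p0) < d).

Let a (i : 'I_(m + m)) : T -> C := 
  match fintype.split i with inl j => u j | inr j => fun=> star (l j) w end.

Let aE x : \row_i a i x = join_row (fun j => u j x) (fun j => star (l j) w).
Proof. by apply/rowP => i; rewrite !mxE /a; case: (fintype.split i) => j; rewrite mxE. Qed.

Let ha i : AlgIn ev H (a i).
Proof. by rewrite /a; case: (fintype.split i) => j //; exact: (AlgIn_cst H_ev ev_cst). Qed.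

Let a_in x : nm (\row_i a i x - p0) < d. Proof. by rewrite aE. Qed.

Lemma pot_val_Alg : Alg ev (fun x => pot_val (fun j => u j x) w).
Proof.
have := nash_comp_Alg H_ev HD HM Hdom ev_inj ev_cst hPsi P0 hP ha a_in.
by have -> : (fun x => Psi (\row_i a i x)) = (fun x => pot_val (fun j => u j x) w) by apply/funext => x; rewrite aE.
Qed.

(** As [w] is fixed, the direction of differentiation is a constant vector, as [nash_derive_Alg]
    demands. *)
Lemma pot_dw_Alg : H (fun x => pot_val (fun j => u j x) w) -> Alg ev (fun x => pot_dw (fun j => u j x) w).
Proof.
move=> HPsi; have := nash_derive_Alg H_ev HD HM Hdom ev_inj ev_cst hPsi P0 hP ha a_in
  (join_row (fun=> 0) (fun j => dstar (l j) w)).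
have -> : (fun x => Psi (\row_i a i x)) = (fun x => pot_val (fun j => u j x) w) by apply/funext => x; rewrite aE.
move=> /(_ HPsi).
move=> X; apply: (eq_ind _ (Alg ev) X); apply/funext => x; rewrite /pot_dw aE; exact: erefl.
Qed.

End Algebraicity.
End Potentials.

(** * Local rigidity *)

Section MoreCalculus.
Variable R : realType.
Local Notation C := (Cplx R).

Lemma const_dir (V W : normedModType C) (f : V -> W) x v : differentiable f x ->
  (exists2 r : R, 0 < r & forall s : C, nm s < r -> f (x + s *: v) = f x) -> 'd f x v = 0.
Proof.
move=> df [r r0 H].
have D0 : dd f (x + 0 *: v) ('d f x) by rewrite scale0r addr0; exact: ddP.
have DL : dd (fun s : C => x + s *: v) 0 (fun s : C => s *: v).
  by apply: dd_eq (ddD (dd_cst x 0) (ddZl v (dd_id 0))) _ => h; rewrite add0r.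
have D := dd_comp DL D0.
have D' := dd_cst (f x) (0 : C).
have : dd (fun s : C => f (x + s *: v)) 0 (fun=> 0).
  by apply: (near_dd _ D'); exists r => // s; rewrite subr0 => /H.
move=> /(dd_val (1 : C)) <-; by rewrite (dd_val (1 : C) D) scale1r.
Qed.

Lemma nm_pair_ltP (V W : normedModType C) (p q : V * W) (d : R) :
  nm (p - q) < d <-> nm (p.1 - q.1) < d /\ nm (p.2 - q.2) < d.
Proof.
case: p q => [p1 p2] [q1 q2]; rewrite (_ : _ - _ = (p1 - q1, p2 - q2)) // nm_pair gt_max.
by split=> [/andP[]|[-> ->]].
Qed.

Lemma Alg_inv (A : idomainType) (K : comNzRingType) (ev : {rmorphism A -> K}) (H : K -> Prop) y y' :
  (forall a, H (ev a)) -> (forall x y, H x -> H y -> H (x + y)) ->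
  (forall x y, H x -> H y -> H (x * y)) ->
  (forall x y, H x -> H y -> x * y = 0 -> x = 0 \/ y = 0) ->
  (forall a, ev a = 0 -> a = 0) -> Alg ev y -> H y -> y * y' = 1 -> Alg ev y'.
Proof.
move=> H_ev HD HM Hdom ev_inj Ay Hy yy'.
pose p : {poly K} := y *: 'X - 1.
have cp i : p`_i = if i == 0%N then ev (-1) else if i == 1%N then y else ev 0.
  rewrite /p coefB coefZ coefX coef1; case: i => [|[|i]] /=.
  - by rewrite mulr0 sub0r rmorphN1.
  - by rewrite mulr1 subr0.
  - by rewrite mulr0 subr0 rmorph0.
apply: (Alg_trans H_ev HD HM Hdom ev_inj (p := p)).
- by move=> i; rewrite cp; do 2?case: ifP => _ //; exact: Alg_ev.
- by move=> i; rewrite cp; do 2?case: ifP => _ //; exact: H_ev.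
- apply/eqP => /(congr1 (fun q : {poly K} => q`_0)); rewrite cp coef0 /= rmorphN1 => /eqP.
  by rewrite oppr_eq0 oner_eq0.
- by rewrite /p hornerD hornerN hornerZ hornerX hornerC yy' subrr.
Qed.

Variables (r : nat) (X1 v : 'rV[C]_r) (e tau : R) (y : 'rV[C]_r -> C) (P : {poly (mpoly r C)}).
Hypothesis (yP : forall x, nm (x - X1) < e -> (map_poly (meval (fun i => x 0 i)) P).[y x] = 0).

Lemma branch_Alg : 0 < e -> P != 0 -> Alg (mpoly_on_ball X1 e) (on_ball X1 e y).
Proof.
move=> e0 P0; exists P => //; apply/funext => x; rewrite horner_at.
rewrite -[RHS](yP (retract_ball_in X1 e0 x)); congr (_.[_]).
by apply/polyP => i; rewrite !coef_map.
Qed.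

(** Substituting the line into the equation of [y] gives an equation over C[t]; it is nonzero
    because it is already so at [t = 0], that is at [X1]. *)
Lemma line_Alg : 0 < tau -> (forall t : C, nm t < tau -> nm (t *: v) < e) ->
  map_poly (meval (fun i => X1 0 i)) P != 0 ->
  Alg (poly_in (retract_ball (0 : C) tau)) (on_ball (0 : C) tau (fun t : C => y (X1 + t *: v))).
Proof.
move=> t0 tv P0.
pose h (i : 'I_r) : {poly C} := (X1 0 i)%:P + v 0 i *: 'X.
pose F : mpoly r C -> {poly C} := mmap polyC h.
have ht t q : (F q).[t] = meval (fun i => (X1 + t *: v) 0 i) q.
  rewrite -[LHS]/(horner_eval t (F q)) /F rmorph_mmap /meval /mmap.
  apply: eq_bigr => m _; rewrite /= /horner_eval hornerC; congr (_ * _).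
  apply: eq_bigr => i _; congr (_ ^+ _); rewrite /= /h /horner_eval !mxE.
  by rewrite hornerD hornerZ hornerX hornerC mulrC.
have F0 : F 0 = 0 by rewrite /F rmorph0.
exists (map_poly F P).
  apply: contra P0 => /eqP E; apply/eqP/polyP => i; rewrite coef0 coef_map_id0 ?meval0 //.
  have := congr1 (fun q : {poly {poly C}} => (q`_i).[0]) E; rewrite coef_map_id0 // coef0 horner0 ht => <-.
  by apply: meval_eq => j; rewrite scale0r addr0.
apply/funext => t; rewrite horner_at.
set s := retract_ball (0 : C) tau t.
have sd : nm s < tau by have := retract_ball_in (0 : C) t0 t; rewrite subr0.
have := yP (x := X1 + s *: v); rewrite [_ - X1]addrC addKr => /(_ (tv s sd)) E.
rewrite -[RHS]E; congr (_.[_]); apply/polyP => i.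
by rewrite !coef_map -[RHS]ht.
Qed.
End MoreCalculus.

(** * From the curve to the whole space of the transcendence basis *)

Section Branches.
Variable R : realType.
Local Notation C := (Cplx R).
Variables (n m r : nat) (f : 'I_n -> C -> C) (l : 'I_m -> C -> C) (alpha b : C) (beta : 'I_n -> C).
Variables (Psi : 'rV[C]_(m + m) -> C) (p0 : 'rV[C]_(m + m)) (rho : R) (P : mpoly (m + m + 1) C).
Hypotheses (hPsi : hol_ball Psi p0 rho) (P0 : P != 0)
  (hP : forall p, nm (p - p0) < rho -> meval (fun i => row_mx p (Psi p)%:M 0 i) P = 0).
Local Notation V := 'rV[C]_r.
Variables (X1 : V) (w1 : C) (e : R) (g : 'I_n -> V -> C) (u : 'I_m -> V -> C).
Variables (Pg : 'I_n -> {poly (mpoly r C)}) (Pu : 'I_m -> {poly (mpoly r C)}).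
Hypotheses (e0 : 0 < e) (b0 : b != 0).
Hypotheses (hg : forall k, hol_ball (g k) X1 e) (hu : forall j, hol_ball (u j) X1 e).
Hypotheses (Pg0 : forall k, map_poly (meval (fun i => X1 0 i)) (Pg k) != 0)
  (Pu0 : forall j, map_poly (meval (fun i => X1 0 i)) (Pu j) != 0).
Hypotheses (gP : forall k x, nm (x - X1) < e -> (map_poly (meval (fun i => x 0 i)) (Pg k)).[g k x] = 0)
  (uP : forall j x, nm (x - X1) < e -> (map_poly (meval (fun i => x 0 i)) (Pu j)).[u j x] = 0).
Local Notation fsv := (fs_val f alpha beta).
Local Notation ptv := (pot_val l Psi).
Local Notation fsw := (fs_dw f beta).
Local Notation ptw := (pot_dw l Psi).
Local Notation fso := (@fs_on R n f alpha beta V g).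
Local Notation pto := (@pot_on R m l Psi V u).
Local Notation gx x := (fun k => g k x).
Local Notation ux x := (fun j => u j x).
Hypotheses (in_rho : forall x w, nm (x - X1) < e -> nm (w - w1) < e ->
    nm (join_row (ux x) (fun j => star (l j) w) - p0) < rho)
  (fs0 : forall x w, nm (x - X1) < e -> nm (w - w1) < e -> fsv (gx x) w != 0).
Hypotheses (hf : forall k w, nm (w - w1) < e -> differentiable (f k) w^* )
  (hl : forall j w, nm (w - w1) < e -> differentiable (l j) w^* ).
(** [Z] stands for the image of the curve under the transcendence basis: only a curve, yet Zariski
    dense. *)
Variables (Z : V -> Prop) (q : C -> C).
Hypotheses (Z_in : forall x, Z x -> nm (x - X1) < e)
  (Z_dense : forall p : mpoly r C, (forall x, Z x -> meval (fun i => x 0 i) p = 0) -> p = 0).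
Hypothesis hq : forall x w, Z x -> nm (w - w1) < e ->
  fsw (gx x) w / fsv (gx x) w - b * ptw (ux x) w = q w.

Let ball0 := ((X1, w1) : V * C).

Let fs_hol : hol_ball fso ball0 e.
Proof.
move=> p /nm_pair_ltP[h1 h2].
exact: dd_diff (dd_fs_on _ _ (fun k => hg k h1) (fun k => hf k h2)).
Qed.

Let pt_hol : hol_ball pto ball0 e.
Proof.
move=> p /nm_pair_ltP[h1 h2].
exact: dd_diff (dd_pot_on (fun k => hu k h1) (fun k => hl k h2) (hPsi (in_rho h1 h2))).
Qed.

Let d_fs (p : V * C) : nm (p - ball0) < e -> 'd fso p ((0, 1) : V * C) = fsw (gx p.1) p.2.
Proof. by move=> /nm_pair_ltP[h1 h2]; exact: (d_fs_on _ _ (fun k => hg k h1) (fun k => hf k h2)). Qed.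

Let d_pt (p : V * C) : nm (p - ball0) < e -> 'd pto p ((0, 1) : V * C) = ptw (ux p.1) p.2.
Proof.
move=> /nm_pair_ltP[h1 h2].
exact: (d_pot_on (fun k => hu k h1) (fun k => hl k h2) (hPsi (in_rho h1 h2))).
Qed.

(** Multiplied by the norm, the defect of the identity is holomorphic and algebraic over the
    polynomials in [x] and vanishes on [Z]; [Alg_dense_zero] makes it zero. *)
Let dw_constant x w : nm (x - X1) < e -> nm (w - w1) < e ->
  fsw (gx x) w / fsv (gx x) w - b * ptw (ux x) w = q w.
Proof.
move=> xe we.
pose ev : {rmorphism mpoly r C -> (V -> C)} := @mpoly_on_ball R r X1 e; pose H := @hol_germ R V X1 e.
pose AHv := @AlgIn R V (mpoly r C) ev H.
have H_ev a : H (ev a) := @mpoly_germ R r X1 e a.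
have HD x' y' : H x' -> H y' -> H (x' + y') := @hol_germD R V X1 e x' y'.
have HM x' y' : H x' -> H y' -> H (x' * y') := @hol_germM R V X1 e x' y'.
have Hdom x' y' : H x' -> H y' -> x' * y' = 0 -> x' = 0 \/ y' = 0 := @hol_germ_integral R V X1 e e0 x' y'.
have ev_inj a : ev a = 0 -> a = 0 := @mpoly_on_ball_inj R r X1 e e0 a.
have ev_cst c : ev (mpolyC r c) = (fun=> c) := @mpoly_on_ball_cst R r X1 e c.
pose rb := @retract_ball R V X1 e.
have rbe y : nm (rb y - X1) < e by exact: retract_ball_in.
have neq0 (p : {poly (mpoly r C)}) : map_poly (meval (fun i => X1 0 i)) p != 0 -> p != 0.
  by apply: contraNneq => ->; rewrite rmorph0.
have Ag k : AHv (on_ball X1 e (g k)).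
  exact: (conj (branch_Alg (gP k) e0 (neq0 _ (Pg0 k))) (ex_intro2 _ _ (g k) (hg k) erefl)).
have Au j : AHv (on_ball X1 e (u j)).
  exact: (conj (branch_Alg (uP j) e0 (neq0 _ (Pu0 j))) (ex_intro2 _ _ (u j) (hu j) erefl)).
have A1 := fs_val_AH f alpha beta H_ev HD HM ev_cst w Ag.
have A2 := fs_dw_AH f beta H_ev HD HM ev_cst w Ag.
have inr y : nm (join_row (fun j => on_ball X1 e (u j) y) (fun j => star (l j) w) - p0) < rho.
  exact: in_rho (rbe y) we.
have H3 : H (fun y => ptv (fun j => on_ball X1 e (u j) y) w).
  exists (fun x => pto (x, w)) => // y ye.
  have D := dd_pair (dd_id y) (dd_cst w y).
  have py : nm ((y, w) - ball0) < e by apply/nm_pair_ltP.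
  exact: dd_diff (dd_comp D (ddP (pt_hol py))).
have H4 : H (fun y => ptw (fun j => on_ball X1 e (u j) y) w).
  exists (fun x => 'd pto (x, w) ((0, 1) : V * C)).
    move=> y ye; have py : nm ((y, w) - ball0) < e by apply/nm_pair_ltP.
    have D := dd_pair (dd_id y) (dd_cst w y).
    exact: dd_diff (dd_comp D (ddP (hol_dir _ pt_hol py))).
  by apply/funext => y; rewrite /on_ball /= d_pt //; apply/nm_pair_ltP; split=> //; exact: rbe.
have A4 : AHv (fun y => ptw (fun j => on_ball X1 e (u j) y) w).
  exact: (conj (pot_dw_Alg H_ev HD HM Hdom ev_inj ev_cst hPsi P0 hP Au inr H3) H4).
have S := AlgIn_subsemi H_ev HD HM; have K c := AlgIn_cst H_ev ev_cst c.
have := ssD S A2 (ssM S (K (-1)) (ssM S A1 (ssD S (ssM S (K b) A4) (K (q w))))).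
set y := (_ + _) => Ay.
have yE z : y z = fsw (gx (rb z)) w - fsv (gx (rb z)) w * (b * ptw (ux (rb z)) w + q w).
  by rewrite -[LHS]/(_ + -1 * _) mulN1r.
have y0 : y = 0.
  apply: (Alg_dense_zero H_ev HD HM Hdom (Z := Z) Ay).
    move=> a Ha; apply: Z_dense => z zZ; rewrite -(Ha z zZ).
    by rewrite -[RHS]/(meval _ a) retract_ball_id //; exact: Z_in.
  move=> z zZ; rewrite yE /rb retract_ball_id; last exact: Z_in.
  rewrite -(hq zZ we) [_ + (_ - _)]addrC subrK mulrCA divff ?mulr1 ?subrr //.
  by apply: fs0 => //; exact: Z_in.
have := congr1 (fun k : V -> C => k x) y0; rewrite yE /rb retract_ball_id // => /eqP.
rewrite -[X in _ == X]/0 subr_eq0 => /eqP ->; rewrite mulrAC divff ?mul1r; last exact: fs0.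
by rewrite [b * _ + _]addrC addrK.
Qed.

Let L v (p : V * C) : C := 'd fso p ((v, 0) : V * C) / fso p - b * 'd pto p ((v, 0) : V * C).

Let fso0 (p : V * C) : nm (p - ball0) < e -> fso p != 0.
Proof. by move=> /nm_pair_ltP[h1 h2]; exact: fs0. Qed.

(** By [dw_constant] the derivative of log N - b T in [w] does not depend on [x]; by symmetry its
    derivative along [v] does not depend on [w]. *)
Let log_dir_constant v x w w' : nm (x - X1) < e -> nm (w - w1) < e -> nm (w' - w1) < e ->
  L v (x, w) = L v (x, w').
Proof.
move=> xe we we'.
have pin y z : nm (y - X1) < e -> nm (z - w1) < e -> nm ((y, z) - ball0) < e.
  by move=> ? ?; apply/nm_pair_ltP.
pose Q (p : V * C) : C := 'd fso p ((0, 1) : V * C) / fso p - b * 'd pto p ((0, 1) : V * C).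
have Qq (p : V * C) : nm (p - ball0) < e -> Q p = q p.2.
  move=> pe; have [h1 h2] := (nm_pair_ltP _ _ _).1 pe.
  have E (A A' B B' D : C) : A = A' -> B = B' -> A / D - b * B = A' / D - b * B' by move=> -> ->.
  exact: etrans (E _ _ _ _ (fso p) (d_fs pe) (d_pt pe)) (dw_constant h1 h2).
have sub (p : V * C) : nm (p - ball0) < e -> 0 < e - nm (p - ball0) /\
    forall p', nm (p' - p) < e - nm (p - ball0) -> nm (p' - ball0) < e.
  move=> pe; rewrite subr_gt0; split=> // p' pp'; apply: le_lt_trans (nm_dist _ _ p) _.
  by rewrite -ltrBrDr.
have dL (p : V * C) : nm (p - ball0) < e -> 'd (L v) p ((0, 1) : V * C) = 0.
  move=> pe; have [pe0 pin'] := sub p pe.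
  have hF : hol_ball fso p (e - nm (p - ball0)) by move=> p' /pin'; exact: fs_hol.
  have hT : hol_ball pto p (e - nm (p - ball0)) by move=> p' /pin'; exact: pt_hol.
  rewrite (mixed_log_symmetric b _ _ pe0 hF hT (fso0 pe)).
  apply: (@const_dir R (V * C)%type C Q).
    exact: (mixed_log_hol b _ fs_hol pt_hol fso0 pe).
  have [h1 h2] := (nm_pair_ltP _ _ _).1 pe.
  have v1 : 0 < nm v + 1 by rewrite ltr_wpDl // nm_ge0.
  have ep : 0 < e - nm (p.1 - X1) by rewrite subr_gt0.
  exists ((e - nm (p.1 - X1)) / (nm v + 1)); first exact: divr_gt0.
  move=> s sr; rewrite !Qq //; first by rewrite /= scaler0 addr0.
  apply/nm_pair_ltP; rewrite /= scaler0 addr0; split=> //.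
  have sv : nm (s *: v) < e - nm (p.1 - X1).
    have vv : nm v <= nm v + 1 by rewrite lerDl.
    by rewrite nmZ; apply: le_lt_trans (ler_wpM2l (nm_ge0 s) vv) _; rewrite -ltr_pdivlMr.
  have -> : p.1 + s *: v - X1 = s *: v + (p.1 - X1) by rewrite [p.1 + _]addrC addrA.
  by apply: le_lt_trans (nmD _ _) _; rewrite -ltrBrDr.
have Lh := mixed_log_hol b ((v, 0) : V * C) fs_hol pt_hol fso0.
have dLv (p : V * C) : nm (p - ball0) < e -> 'd (L v) p ((0, w' - w) : V * C) = 0.
  move=> pe; have -> : ((0, w' - w) : V * C) = (w' - w) *: ((0, 1) : V * C).
    by apply: injective_projections; rewrite /= ?scaler0 // -[RHS]/(_ * _) mulr1.
  by rewrite (linearZZ ('d (L v) p)) (dL p pe) scaler0.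
have E : ((x, w) : V * C) + (0, w' - w) = (x, w').
  by apply: injective_projections; rewrite /= ?addr0 // addrC subrK.
have pw : nm (((x, w) : V * C) + (0, w' - w) - ball0) < e by rewrite E; exact: pin.
have G (F : V * C -> C) : F ((x, w) + (0, w' - w)) = F (x, w) -> F (x, w) = F (x, w').
  by rewrite E => ->.
exact: (G (L v) (direction_constant Lh dLv (pin _ _ xe we) pw)).
Qed.

Theorem potential_difference x w w' : nm (x - X1) < e -> nm (w - w1) < e -> nm (w' - w1) < e ->
  ptv (ux x) w - ptv (ux x) w' = ptv (ux X1) w - ptv (ux X1) w'.
Proof.
move=> xe we we'; have [->//|xX] := eqVneq x X1.
pose v := x - X1; have v0 : 0 < nm v by rewrite nm_gt0 subr_eq0.
(* The line reaches [x] at [t = 1], and [tau > 1] because [x] lies in the ball. *)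
pose tau := e / nm v; have tau0 : 0 < tau by rewrite divr_gt0.
have tau1 : 1 < tau by rewrite ltr_pdivlMr // mul1r.
have tv (t : C) : nm t < tau -> nm (t *: v) < e by rewrite nmZ -ltr_pdivlMr.
have te (t : C) : nm t < tau -> nm (X1 + t *: v - X1) < e by rewrite addrAC subrr add0r; exact: tv.
have pin (t z : C) : nm t < tau -> nm (z - w1) < e -> nm (((X1, z) : V * C) + t *: ((v, 0) : V * C) - ball0) < e.
  by move=> h1 h2; apply/nm_pair_ltP; rewrite /= scaler0 addr0; split=> //; exact: te.
have lineE (z t : C) : ((X1, z) : V * C) + t *: ((v, 0) : V * C) = (X1 + t *: v, z).
  by apply: injective_projections; rewrite //= scaler0 addr0.
have D (F : V * C -> C) (z t : C) : hol_ball F ball0 e -> nm t < tau -> nm (z - w1) < e ->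
    dd (fun t : C => F (X1 + t *: v, z)) t (fun h : C => h * 'd F (X1 + t *: v, z) ((v, 0) : V * C)).
  move=> hF h1 h2; have := line_diff (hF _ (pin t z h1 h2)); rewrite lineE => DD.
  by apply: dd_ext DD _ (fun=> erefl) => s; rewrite lineE.
pose G (t : C) := fso (X1 + t *: v, w) / fso (X1 + t *: v, w').
pose Hh (t : C) := b * (pto (X1 + t *: v, w) - pto (X1 + t *: v, w')).
have t0 (t : C) : nm (t - 0) < tau -> nm t < tau by rewrite subr0.
have F0 (t z : C) : nm t < tau -> nm (z - w1) < e -> fso (X1 + t *: v, z) != 0.
  by move=> h1 h2; apply: fs0 => //; exact: te.
have DG (t : C) (h : nm t < tau) := ddM (D _ _ _ fs_hol h we) (ddV (D _ _ _ fs_hol h we') (F0 t w' h we')).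
have DH (t : C) (h : nm t < tau) := ddMl b (ddB (D _ _ _ pt_hol h we) (D _ _ _ pt_hol h we')).
have hG : @hol_ball R C G 0 tau by move=> t /t0 h; exact: dd_diff (DG t h).
have hH : @hol_ball R C Hh 0 tau by move=> t /t0 h; exact: dd_diff (DH t h).
have dH (t : C) (h : nm t < tau) : derive1 Hh t = b * ('d pto (X1 + t *: v, w) ((v, 0) : V * C) - 'd pto (X1 + t *: v, w') ((v, 0) : V * C)).
  have E (s A B : C) : b * (s * A - s * B) = s * (b * (A - B)) by ring.
  by apply: dd_derive1; apply: dd_eq (DH t h) _ => s; exact: E.
(* Equality of the logarithmic derivatives at [w] and [w']: the terms independent of [w] cancel in
   the quotient [G] and the difference [Hh]. *)
have ode (t : C) : nm (t - 0) < tau -> derive1 G t = derive1 Hh t * G t.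
  move=> /t0 h; rewrite dH //.
  have E (s A1 A2 D1 D2 T1 T2 : C) : A1 != 0 -> A2 != 0 ->
      D1 / A1 - b * T1 = D2 / A2 - b * T2 ->
      A1 * (- A2 ^- 2 * (s * D2)) + A2^-1 * (s * D1) = s * ((b * (T1 - T2)) * (A1 / A2)).
    move=> a1 a2 LE; have {}LE : D1 / A1 = D2 / A2 - b * T2 + b * T1 by rewrite -LE subrK.
    have -> : D1 = A1 * (D2 / A2 - b * T2 + b * T1) by rewrite -LE mulrC divfK.
    by field.
  apply: dd_derive1; apply: dd_eq (DG t h) _ => s.
  exact: (E _ _ _ _ _ _ _ (F0 t w h we) (F0 t w' h we') (log_dir_constant v (te t h) we we')).
pose rb := @retract_ball R C 0 tau.
pose H := @hol_germ R C 0 tau.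
have H_ev a : H (poly_in rb a) := @poly_in_germ R 0 tau rb a (rb_germ 0 tau).
have HD x' y' : H x' -> H y' -> H (x' + y') := @hol_germD R C 0 tau x' y'.
have HM x' y' : H x' -> H y' -> H (x' * y') := @hol_germM R C 0 tau x' y'.
have Hdom x' y' : H x' -> H y' -> x' * y' = 0 -> x' = 0 \/ y' = 0 := @hol_germ_integral R C 0 tau tau0 x' y'.
have ev_inj a : poly_in rb a = 0 -> a = 0 := @poly_rb_inj R 0 tau tau0 a.
have ev_cst (c : C) : poly_in rb c%:P = (fun=> c) := @poly_in_cst R rb c.
have hline (F : V -> C) : hol_ball F X1 e -> @hol_ball R C (fun t : C => F (X1 + t *: v)) 0 tau.
  move=> hF t /t0 h; exact: dd_diff (line_diff (hF _ (te t h))).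
pose ev : {rmorphism {poly C} -> (C -> C)} := poly_in rb.
pose AHc := @AlgIn R C {poly C} ev H; pose Algc := @Alg {poly C} (C -> C) ev.
have Ag k : AHc (on_ball (0 : C) tau (fun t : C => g k (X1 + t *: v))).
  split; first exact: (line_Alg (gP k) tau0 tv (Pg0 k)).
  exact: (ex_intro2 _ _ (fun t : C => g k (X1 + t *: v)) (hline _ (hg k)) erefl).
have Au j : AHc (on_ball (0 : C) tau (fun t : C => u j (X1 + t *: v))).
  split; first exact: (line_Alg (uP j) tau0 tv (Pu0 j)).
  exact: (ex_intro2 _ _ (fun t : C => u j (X1 + t *: v)) (hline _ (hu j)) erefl).
have rbe (t : C) : nm (rb t) < tau by have := @retract_ball_in R C 0 tau tau0 t; rewrite subr0.
have AF z : AHc (on_ball (0 : C) tau (fun t : C => fso (X1 + t *: v, z))).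
  exact: (fs_val_AH f alpha beta H_ev HD HM ev_cst z Ag).
have AT z : nm (z - w1) < e -> Algc (on_ball (0 : C) tau (fun t : C => pto (X1 + t *: v, z))).
  move=> ze; apply: (pot_val_Alg H_ev HD HM Hdom ev_inj ev_cst hPsi P0 hP Au).
  by move=> t; exact: (in_rho (te _ (rbe t)) ze).
have AG : Algc (on_ball (0 : C) tau G).
  apply: (AlgM (AF w).1); apply: (Alg_inv H_ev HD HM Hdom ev_inj (AF w').1 (AF w').2).
  by apply/funext => t; exact: (mulfV (F0 _ _ (rbe t) we')).
have AHh : Algc (on_ball (0 : C) tau Hh).
  have Ab : Algc (fun=> b) by rewrite /Algc -(ev_cst b); exact: Alg_ev.
  exact: (AlgM Ab (AlgD (AT w we) (AlgN (AT w' we')))).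
have z0 : nm (0 : C) < tau by rewrite nm0.
have Gn0 : exists2 t : C, nm (t - 0) < tau & G t != 0.
  by exists 0; rewrite ?subr0 // /G mulf_neq0 ?invr_eq0 //; exact: F0.
have dHz := algebraic_exponential tau0 hG hH ode AG AHh Gn0.
have : Hh (0 + 1) = Hh 0.
  apply: (direction_constant hH); rewrite ?subr0 ?add0r ?nm1 //.
  by move=> t /[dup] /hH dt /dHz E; rewrite (derive1_dd 1 dt) E scaler0.
rewrite /Hh add0r scale0r addr0 scale1r => /(mulfI b0).
by have -> : X1 + v = x by rewrite /v addrC subrK.
Qed.

End Branches.

Lemma diff_map_meval (R : realType) (V : normedModType (Cplx R)) r (P : {poly (mpoly r (Cplx R))})
  (y : 'I_r -> V -> Cplx R) (u : V -> Cplx R) z :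
  (forall i, differentiable (y i) z) -> differentiable u z ->
  differentiable (fun z => (map_poly (meval (fun i => y i z)) P).[u z]) z.
Proof.
move=> hy hu; elim/poly_ind: P => [|P c IH].
  by apply: dd_diff (dd_ext (dd_cst (0 : Cplx R) z) _ (fun=> erefl)) => t; rewrite rmorph0 horner0.
have D := ddD (ddM (ddP IH) (ddP hu)) (ddP (diff_meval c hy)).
apply: dd_diff (dd_ext D _ (fun=> erefl)) => t.
by rewrite rmorphD rmorphM /= map_polyX map_polyC hornerMXaddC.
Qed.

Lemma poly_at_meval (R : realType) r (P : {poly (mpoly r (Cplx R))}) (y : 'rV[Cplx R]_r) :
  poly_at (fun (i : 'I_(size P)) (y : 'rV[Cplx R]_r) => meval (fun k => y 0 k) P`_i) y =
  map_poly (meval (fun k => y 0 k)) P.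
Proof. by rewrite /map_poly poly_def. Qed.

(** * Vanishing of the mixed derivative of the potential along a curve *)

Section LocalRigidity.
Variable R : realType.
Local Notation C := (Cplx R).
Variables (n m : nat) (f : 'I_n -> C -> C) (l : 'I_m -> C -> C) (alpha b : C) (beta : 'I_n -> C).
Variables (Psi : 'rV[C]_(m + m) -> C) (z0 : C) (d rho : R) (P : mpoly (m + m + 1) C).
Let p0 : 'rV[C]_(m + m) := join_row (fun j => l j z0) (fun j => star (l j) z0^* ).
Hypotheses (d0 : 0 < d) (rho0 : 0 < rho) (b0 : b != 0).
Hypotheses (hf : forall k, @hol_ball R C (f k) z0 d) (hl : forall j, @hol_ball R C (l j) z0 d).
Hypotheses (hPsi : hol_ball Psi p0 rho) (P0 : P != 0)
  (hP : forall p, nm (p - p0) < rho -> meval (fun i => row_mx p (Psi p)%:M 0 i) P = 0).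
Local Notation fsv := (fs_val f alpha beta).
Local Notation ptv := (pot_val l Psi).
Local Notation fsw := (fs_dw f beta).
Local Notation ptw := (pot_dw l Psi).
Local Notation fx z := (fun k => f k z).
Local Notation lx z := (fun j => l j z).
Hypothesis N0 : fsv (fx z0) z0^* != 0.
Let fso : C * C -> C := @fs_on R n f alpha beta C f.
Let pto : C * C -> C := @pot_on R m l Psi C l.
Let Q (p : C * C) : C := 'd fso p ((0, 1) : C * C) / fso p - b * 'd pto p ((0, 1) : C * C).

Let c0 : C * C := (z0, z0^* ).

Let conj_in w r : nm (w - z0^* ) < r -> nm (w^* - z0) < r.
Proof. by rewrite -nm_conj rmorphB /= conjCK. Qed.

Let dd_join (V : normedModType C) (u : 'I_m -> V -> C) (p : V * C) :
  (forall k, differentiable (u k) p.1) -> (forall k, differentiable (l k) p.2^* ) ->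
  differentiable (fun p : V * C => join_row (fun k => u k p.1) (fun j => star (l j) p.2)) p.
Proof.
move=> hu hL.
exact: dd_diff (dd_join_row (fun k => dd_comp (dd_fst p) (ddP (hu k)))
                            (fun k => dd_comp (dd_snd p) (dd_starD (hL k)))).
Qed.

Let near_join (V : normedModType C) (u : 'I_m -> V -> C) (g : 'I_n -> V -> C) (x1 : V) (w1 : C) :
  (forall k, differentiable (u k) x1) -> (forall k, differentiable (g k) x1) ->
  nm (w1 - z0^* ) < d ->
  nm (join_row (fun k => u k x1) (fun j => star (l j) w1) - p0) < rho -> fsv (fun k => g k x1) w1 != 0 ->
  exists2 r : R, 0 < r & forall x w, nm (x - x1) < r -> nm (w - w1) < r ->
    nm (join_row (fun k => u k x) (fun j => star (l j) w) - p0) < rho /\ fsv (fun k => g k x) w != 0.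
Proof.
move=> hu hg /conj_in hw hr hv.
have rr : 0 < rho - nm (join_row (fun k => u k x1) (fun j => star (l j) w1) - p0) by rewrite subr_gt0.
have /contCP/(_ _ rr)[r r0 hr1] :=
  differentiable_continuous (@dd_join V u (x1, w1) hu (fun k => hl k hw)).
have nv : 0 < nm (fsv (fun k => g k x1) w1) by rewrite nm_gt0.
have /contCP/(_ _ nv)[s s0 hs] := differentiable_continuous
  (dd_diff (dd_fs_on alpha beta (p := (x1, w1)) hg (fun k => hf k hw))).
exists (Num.min r s); first by rewrite lt_min r0 s0.
move=> x w; rewrite !lt_min => /andP[x_r x_s] /andP[w_r w_s]; split.
  apply: le_lt_trans (nm_dist _ _ (join_row (fun k => u k x1) (fun j => star (l j) w1))) _.
  by rewrite -ltrBrDr; apply: (hr1 (x, w)); apply/nm_pair_ltP.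
apply/eqP => E; have := hs (x, w); rewrite /fs_on /= E sub0r nmN ltxx => H.
by have /H := (nm_pair_ltP (x, w) (x1, w1) s).2 (conj x_s w_s).
Qed.

Lemma local_domain : exists d1 : R, [/\ 0 < d1 /\ d1 <= d,
    forall z w, nm (z - z0) < d1 -> nm (w - z0^* ) < d1 ->
      nm (join_row (lx z) (fun j => star (l j) w) - p0) < rho /\ fsv (fx z) w != 0,
    hol_ball fso c0 d1, hol_ball pto c0 d1 & hol_ball Q c0 d1].
Proof.
have zz : nm (z0 - z0) < d by rewrite subrr nm0.
have ww : nm (z0^* - z0^* ) < d by rewrite subrr nm0.
have pp : nm (join_row (lx z0) (fun j => star (l j) z0^* ) - p0) < rho by rewrite subrr nm0.
have [r r0 hr] := near_join (fun k => hl k zz) (fun k => hf k zz) ww pp N0.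
pose d1 := Num.min r d; have d10 : 0 < d1 by rewrite lt_min r0.
have d1d : d1 <= d by rewrite ge_min lexx orbT.
have hd1 z w : nm (z - z0) < d1 -> nm (w - z0^* ) < d1 ->
    nm (join_row (lx z) (fun j => star (l j) w) - p0) < rho /\ fsv (fx z) w != 0.
  by rewrite !lt_min => /andP[h1 _] /andP[h2 _]; exact: hr.
have fd z k : nm (z - z0) < d1 -> differentiable (f k) z.
  by move=> zd; exact: hf (lt_le_trans zd d1d).
have ld z j : nm (z - z0) < d1 -> differentiable (l j) z.
  by move=> zd; exact: hl (lt_le_trans zd d1d).
have fs_hol : hol_ball fso c0 d1.
  move=> p /nm_pair_ltP[h1 h2].
  exact: dd_diff (dd_fs_on _ _ (fun k => fd _ k h1) (fun k => fd _ k (conj_in h2))).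
have pt_hol : hol_ball pto c0 d1.
  move=> p /nm_pair_ltP[h1 h2].
  exact: dd_diff (dd_pot_on (fun k => ld _ k h1) (fun k => ld _ k (conj_in h2)) (hPsi (hd1 _ _ h1 h2).1)).
have fso0 p : nm (p - c0) < d1 -> fso p != 0.
  by move=> /nm_pair_ltP[h1 h2]; exact: (hd1 _ _ h1 h2).2.
exists d1; split; [by [] |exact: hd1|exact: fs_hol|exact: pt_hol|].
exact: (mixed_log_hol b _ fs_hol pt_hol fso0).
Qed.

Hypothesis Hrel : forall z, nm (z - z0) < d -> 'd Q ((z, z^* ) : C * C) ((1, 0) : C * C) = 0.

Lemma no_mixed_derivative : exists2 d' : R, 0 < d' & forall z, nm (z - z0) < d' ->
  'd (fun p => 'd pto p ((0, 1) : C * C)) ((z, z^* ) : C * C) ((1, 0) : C * C) = 0.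
Proof.
have [d1 [[d10 d1d] hd1 fs_hol pt_hol Q_hol]] := local_domain.
have fd z k : nm (z - z0) < d1 -> differentiable (f k) z.
  by move=> zd; exact: hf (lt_le_trans zd d1d).
have ld z j : nm (z - z0) < d1 -> differentiable (l j) z.
  by move=> zd; exact: hl (lt_le_trans zd d1d).
have dQ_hol := hol_dir ((1, 0) : C * C) Q_hol.
pose d2 := d1 / 2; have d20 : 0 < d2 by rewrite divr_gt0.
have d2d : d2 < d1 by rewrite /d2; have := d10; lra.
(* [Hrel] gives this for [w = z^*] only; [polarize] frees [w], at the price of half the radius. *)
have dQ0 z w : nm (z - z0) < d2 -> nm (w - z0^* ) < d2 -> 'd Q ((z, w) : C * C) ((1, 0) : C * C) = 0.
  apply: (polarize d10 dQ_hol) => z' zd; exact: Hrel (lt_le_trans zd d1d).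
have Qc z w : nm (z - z0) < d2 -> nm (w - z0^* ) < d2 -> Q (z, w) = Q (z0, w).
  move=> zd wd.
  have H : hol_ball Q c0 d2 by move=> p pd; exact: Q_hol (lt_trans pd d2d).
  have K (p : C * C) : nm (p - c0) < d2 -> 'd Q p ((z - z0, 0) : C * C) = 0.
    move=> /nm_pair_ltP[h1 h2].
    have -> : ((z - z0, 0) : C * C) = (z - z0) *: ((1, 0) : C * C).
      by apply: injective_projections; rewrite /= ?scaler0 // -[RHS]/(_ * _) mulr1.
    by case: p h1 h2 => p1 p2 h1 h2; rewrite (linearZZ ('d Q _)) (dQ0 _ _ h1 h2) scaler0.
  have zz : nm (z0 - z0) < d2 by rewrite subrr nm0.
  have E : ((z0, w) : C * C) + (z - z0, 0) = (z, w).
    by apply: injective_projections; rewrite /= ?addr0 // addrC subrK.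
  have i1 : nm (((z0, w) : C * C) - c0) < d2 by apply/nm_pair_ltP.
  have i2 : nm (((z0, w) : C * C) + (z - z0, 0) - c0) < d2 by rewrite E; apply/nm_pair_ltP.
  have G (F : C * C -> C) : F ((z0, w) + (z - z0, 0)) = F (z0, w) -> F (z, w) = F (z0, w) by rewrite E.
  exact: (G Q (direction_constant H K i1 i2)).
pose x (i : 'I_(n + m)) : C -> C := match fintype.split i with inl k => f k | inr j => l j end.
have xf k : x (lshift m k) = f k by rewrite /x (unsplitK (inl k)).
have xl j : x (rshift n j) = l j by rewrite /x (unsplitK (inr j)).
have xd i z : nm (z - z0) < d2 -> differentiable (x i) z.
  by move=> zd; have zd1 := lt_trans zd d2d; rewrite /x; case: (fintype.split i) => j; [exact: fd|exact: ld].
have [r [s [s_ind s_dep]]] := transcendence_basis x z0 d20.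
have [Pj hPj] := choice s_dep.
pose sep j z := (map_poly (meval (fun i => x (s i) z)) (Pj j)^`()).[x j z].
(* A generic point, at which every component is a simple root of its relation over the basis; [z0]
   itself need not be one. *)
have [z1 z1d sep0] : exists2 z, nm (z - z0) < d2 & forall j, sep j z != 0.
  apply: (@exists_nonzero R C _ sep z0 d2 d20) => j; last by have [_ _] := hPj j.
  by move=> z zd; exact: (diff_map_meval _ (fun i => xd (s i) z zd) (xd j z zd)).
pose X z : 'rV[C]_r := \row_i x (s i) z.
pose X1 := X z1; pose w1 := z1^*.
have XE z (p : mpoly r C) : meval (fun i => X z 0 i) p = meval (fun i => x (s i) z) p.
  by apply: meval_eq => i; rewrite mxE.
have XP z P' : map_poly (meval (fun i => X z 0 i)) P' = map_poly (meval (fun i => x (s i) z)) P'.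
  by congr map_poly; apply/funext => p; exact: XE.
(* The triple packs the radius for the basis, the radius for the root and the branch, so that a
   single [choice] serves all components. *)
have branch j : exists t : R * R * ('rV[C]_r -> C), [/\ 0 < t.1.1 /\ 0 < t.1.2, hol_ball t.2 X1 t.1.1,
    forall y, nm (y - X1) < t.1.1 -> (map_poly (meval (fun k => y 0 k)) (Pj j)).[t.2 y] = 0
  & forall y u, nm (y - X1) < t.1.1 -> nm (u - x j z1) < t.1.2 ->
     (map_poly (meval (fun k => y 0 k)) (Pj j)).[u] = 0 -> u = t.2 y].
  pose c (i : 'I_(size (Pj j))) (y : 'rV[C]_r) := meval (fun k => y 0 k) (Pj j)`_i.
  have cE y : poly_at c y = map_poly (meval (fun k => y 0 k)) (Pj j) := poly_at_meval _ _.
  have hc i : hol_ball (c i) X1 1 by exact: hol_meval_coord.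
  have [_ rel _] := hPj j.
  have y0 : (poly_at c X1).[x j z1] = 0 by rewrite cE XP; exact: rel.
  have y'0 : (poly_at c X1)^`().[x j z1] != 0 by rewrite cE XP deriv_map; exact: sep0.
  have [e [r' [lam [[h1 h2] _ h3 h4 h5]]]] := simple_root_branch ltr01 hc y0 y'0.
  exists (e, r', lam); split=> // y; first by rewrite -cE; exact: h4.
  by move=> u hy hu; rewrite -cE; exact: h5.
have [t ht] := choice branch.
pose lam j := (t j).2.
have [e1 e10 he1] := fin_min (fun j => (let: And4 a _ _ _ := ht j in a.1) : 0 < (t j).1.1).
have [r1 r10 hr1] := fin_min (fun j => (let: And4 a _ _ _ := ht j in a.2) : 0 < (t j).1.2).
have lam_hol j : hol_ball (lam j) X1 e1.
  by have [_ h _ _] := ht j => y ye; apply: h; exact: lt_le_trans ye (he1 j).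
have lam_root j y : nm (y - X1) < e1 -> (map_poly (meval (fun k => y 0 k)) (Pj j)).[lam j y] = 0.
  by have [_ _ h _] := ht j => ye; apply: h; exact: lt_le_trans ye (he1 j).
have lam_uniq j z : nm (z - z0) < d2 -> nm (X z - X1) < e1 -> nm (x j z - x j z1) < r1 ->
    x j z = lam j (X z).
  move=> zd Xe xr; have [_ _ _ h] := ht j; have [_ rel _] := hPj j.
  apply: h; [exact: lt_le_trans Xe (he1 j) | exact: lt_le_trans xr (hr1 j) |].
  by rewrite XP; exact: rel.
have X11 : nm (X1 - X1) < e1 by rewrite subrr nm0.
have lam1 j : lam j X1 = x j z1 by rewrite /X1 -lam_uniq // subrr nm0.
pose g k := lam (lshift m k); pose u j := lam (rshift n j).
have gz k : g k X1 = f k z1 by rewrite /g lam1 xf.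
have uz j : u j X1 = l j z1 by rewrite /u lam1 xl.
have w1d2 : nm (w1 - z0^* ) < d2 by rewrite /w1 -rmorphB nm_conj.
have w1d : nm (w1 - z0^* ) < d := lt_le_trans (lt_trans w1d2 d2d) d1d.
have [a1 a2] := hd1 _ _ (lt_trans z1d d2d) (lt_trans w1d2 d2d).
have a1' : nm (join_row (fun k => u k X1) (fun j => star (l j) w1) - p0) < rho.
  by have -> : (fun k => u k X1) = lx z1 by apply/funext.
have a2' : fsv (fun k => g k X1) w1 != 0.
  by have -> : (fun k => g k X1) = fx z1 by apply/funext.
have [r2 r20 hr2] := near_join (fun j => lam_hol _ _ X11) (fun k => lam_hol _ _ X11) w1d a1' a2'.
have z1d' : 0 < d2 - nm (z1 - z0) by rewrite subr_gt0.
pose e := Num.min (Num.min e1 r2) (d2 - nm (z1 - z0)).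
have e0 : 0 < e by rewrite !lt_min e10 r20.
have ee y : y < e -> [/\ y < e1, y < r2 & y < d2 - nm (z1 - z0)] by rewrite !lt_min => /andP[/andP[]].
have we w : nm (w - w1) < e -> nm (w - z0^* ) < d2.
  move=> /ee[_ _ h]; apply: le_lt_trans (nm_dist _ _ w1) _.
  by rewrite -[nm (w1 - _)]nm_conj rmorphB /= !conjCK -ltrBrDr.
have DX : differentiable (fun z : C => \row_j x j z) z1.
  exact: dd_diff (dd_row (fun j => ddP (xd j z1 z1d))).
have er0 : 0 < Num.min e r1 by rewrite lt_min e0.
have /contCP/(_ _ er0)[dl dl0 hdl] := differentiable_continuous DX.
pose e3 := Num.min dl (d2 - nm (z1 - z0)).
have e30 : 0 < e3 by rewrite lt_min dl0.
have near z : nm (z - z1) < e3 -> [/\ nm (z - z0) < d2, nm (X z - X1) < e & forall j, x j z = lam j (X z)].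
  rewrite lt_min => /andP[/hdl hz hz'].
  have zd2 : nm (z - z0) < d2 by apply: le_lt_trans (nm_dist _ _ z1) _; rewrite -ltrBrDr.
  have hx j : nm (x j z - x j z1) < Num.min e r1.
    by have := (nm_row_ltP _ er0).1 hz j; rewrite !mxE.
  have Xe : nm (X z - X1) < e.
    by apply/nm_row_ltP => // i; rewrite !mxE; have := hx (s i); rewrite lt_min => /andP[].
  split=> // j; apply: lam_uniq => //; first by have [] := ee _ Xe.
  by have := hx j; rewrite lt_min => /andP[].
have gX z k : nm (z - z1) < e3 -> g k (X z) = f k z by move=> /near[_ _ /(_ (lshift m k))]; rewrite xf.
have uX z j : nm (z - z1) < e3 -> u j (X z) = l j z by move=> /near[_ _ /(_ (rshift n j))]; rewrite xl.
have Pj0 j : map_poly (meval (fun i => X1 0 i)) (Pj j) != 0.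
  by apply/eqP => E; case/eqP: (sep0 j); rewrite /sep -deriv_map -XP E deriv0 horner0.
have sub_e j : hol_ball (lam j) X1 e.
  by move=> y /ee[h _ _]; exact: lam_hol.
have sub_root j y : nm (y - X1) < e -> (map_poly (meval (fun k => y 0 k)) (Pj j)).[lam j y] = 0.
  by move=> /ee[h _ _]; exact: lam_root.
have in_rho y w : nm (y - X1) < e -> nm (w - w1) < e ->
    nm (join_row (fun k => u k y) (fun j => star (l j) w) - p0) < rho.
  by move=> /ee[_ h1 _] /ee[_ h2 _]; case: (hr2 y w h1 h2).
have in_fs y w : nm (y - X1) < e -> nm (w - w1) < e -> fsv (fun k => g k y) w != 0.
  by move=> /ee[_ h1 _] /ee[_ h2 _]; case: (hr2 y w h1 h2).
have wf k w : nm (w - w1) < e -> differentiable (f k) w^*.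
  by move=> /we/conj_in h; exact: fd _ k (lt_trans h d2d).
have wl j w : nm (w - w1) < e -> differentiable (l j) w^*.
  by move=> /we/conj_in h; exact: ld _ j (lt_trans h d2d).
pose Z y := exists2 z, nm (z - z1) < e3 & y = X z.
have Z_in y : Z y -> nm (y - X1) < e by move=> [z /near[_ h _] ->].
(* A polynomial vanishing on the small arc around [z1] vanishes along the whole curve by the
   identity theorem, hence is zero by independence. *)
have Z_dense (p : mpoly r C) : (forall y, Z y -> meval (fun i => y 0 i) p = 0) -> p = 0.
  move=> Hp; apply: s_ind.
  have hol : @hol_ball R C (fun z => meval (fun i => x (s i) z) p) z0 d2.
    by move=> z zd; exact: (diff_meval _ (fun i => xd (s i) z zd)).
  apply: (identity_ball hol z1d); exists e3 => // z ze.
  by rewrite -XE; apply: Hp; exists z.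
have Zq y w : Z y -> nm (w - w1) < e ->
    fsw (fun k => g k y) w / fsv (fun k => g k y) w - b * ptw (fun k => u k y) w = Q (z0, w).
  move=> [z ze ->] wwe.
  have -> : (fun k => g k (X z)) = fx z by apply/funext => k; exact: gX.
  have -> : (fun k => u k (X z)) = lx z by apply/funext => k; exact: uX.
  have [zd _ _] := near z ze; have wd := we w wwe.
  have zd1 := lt_trans zd d2d; have wd1 := lt_trans wd d2d.
  rewrite -(Qc z w zd wd); apply/esym.
  have E (A A' B B' D : C) : A = A' -> B = B' -> A / D - b * B = A' / D - b * B' by move=> -> ->.
  apply: E.
    exact: (d_fs_on alpha beta (p := (z, w)) (fun k => fd z k zd1) (fun k => wf k w wwe)).
  exact: (d_pot_on (p := (z, w)) (fun k => ld z k zd1) (fun k => wl k w wwe) (hPsi (hd1 _ _ zd1 wd1).1)).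
have PD := potential_difference hPsi P0 hP e0 b0 (fun k => sub_e (lshift m k)) (fun j => sub_e (rshift n j))
  (fun k => Pj0 (lshift m k)) (fun j => Pj0 (rshift n j))
  (fun k => sub_root (lshift m k)) (fun j => sub_root (rshift n j))
  in_rho in_fs wf wl Z_in Z_dense Zq.
have PD' z w w' : nm (z - z1) < e3 -> nm (w - w1) < e -> nm (w' - w1) < e ->
    pto (z, w) - pto (z, w') = pto (z1, w) - pto (z1, w').
  move=> ze wwe wwe'; have [_ Xe _] := near z ze; have := PD (X z) w w' Xe wwe wwe'.
  have -> : (fun j => u j (X z)) = lx z by apply/funext => k; exact: uX.
  by have -> : (fun j => u j X1) = lx z1 by apply/funext.
pose Dw (p : C * C) : C := 'd pto p ((0, 1) : C * C).
have Dw_hol : hol_ball Dw c0 d1 := hol_dir ((0, 1) : C * C) pt_hol.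
have pin z w : nm (z - z1) < e3 -> nm (w - w1) < e -> nm ((z, w) - c0) < d1.
  move=> /near[h1 _ _] /we h2; apply/nm_pair_ltP; split; [exact: lt_trans h1 d2d|exact: lt_trans h2 d2d].
have z1e : nm (z1 - z1) < e3 by rewrite subrr nm0.
(* By [PD'] the potentials at [z] and [z1] differ by a quantity independent of [w], so their
   derivatives in [w] agree. *)
have DwE z w : nm (z - z1) < e3 -> nm (w - w1) < e -> Dw (z, w) = Dw (z1, w).
  move=> ze wwe.
  have D y (ye : nm (y - z1) < e3) : dd (fun w' : C => pto (y, w')) w (fun h : C => 'd pto (y, w) ((0, h) : C * C)).
    exact: dd_comp (dd_pair (dd_cst y w) (dd_id w)) (ddP (pt_hol _ (pin y w ye wwe))).
  have B := ddB (D z ze) (D z1 z1e).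
  have B0 : dd (fun w' : C => pto (z, w') - pto (z1, w')) w (fun=> 0).
    apply: (near_dd _ (dd_cst (pto (z, w) - pto (z1, w)) w)).
    exists (e - nm (w - w1)); first by rewrite subr_gt0.
    move=> w' hw'; have wwe' : nm (w' - w1) < e.
      by apply: le_lt_trans (nm_dist _ _ w) _; rewrite -ltrBrDr.
    have E (p q p' q' : C) : p - q = p' - q' -> p - p' = q - q'.
      by move=> pq; rewrite -(subrK q p) pq; ring.
    exact: (E _ _ _ _ (PD' z w w' ze wwe wwe')).
  have := etrans (esym (dd_val (1 : C) B)) (dd_val (1 : C) B0).
  by move/eqP; rewrite subr_eq0 => /eqP.
have Ez : zero_near (fun p => 'd Dw p ((1, 0) : C * C)) ((z1, w1) : C * C).
  exists (Num.min e e3); first by rewrite lt_min e0.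
  move=> [z w] /nm_pair_ltP[/= h1 h2].
  have ze : nm (z - z1) < e3 by apply: lt_le_trans h1 _; rewrite ge_min lexx orbT.
  have wwe : nm (w - w1) < e by apply: lt_le_trans h2 _; rewrite ge_min lexx.
  apply: (@const_dir R (C * C)%type C Dw (z, w) (1, 0) (Dw_hol _ (pin z w ze wwe))).
  exists (e3 - nm (z - z1)); first by rewrite subr_gt0.
  move=> h hh; have zh : nm (z + h - z1) < e3.
    rewrite [z + h]addrC -addrA; apply: le_lt_trans (nmD _ _) _; by rewrite -ltrBrDr.
  have -> : ((z, w) : C * C) + h *: (1, 0) = (z + h, w).
    apply: injective_projections; rewrite /= ?scaler0 ?addr0 // -[h *: 1]/(h * 1).
    by rewrite mulr1.
  by rewrite (DwE _ _ zh wwe) (DwE _ _ ze wwe).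
have w1e : nm (w1 - w1) < e by rewrite subrr nm0.
exists d1 => // z zd.
apply: (identity_ball (hol_dir ((1, 0) : C * C) Dw_hol) (pin _ _ z1e w1e) Ez).
by apply/nm_pair_ltP; split=> //=; rewrite -rmorphB nm_conj.
Qed.

End LocalRigidity.

(** * Wirtinger derivatives and pullbacks *)

Section Wirtinger.
Variable R : realType.
Local Notation C := (Cplx R).

Definition diag m (z : 'rV[C]_m) : 'rV[C]_(m + m) := row_mx z (conjv z).

Lemma real_derivC_rder m (v : 'rV[C]_m) (g : 'rV[C]_m -> C) z c :
  rder (fun t => g (z + ofR t *: v)) 0 c -> real_derivC v g z = c.
Proof.
move=> D; rewrite /real_derivC /real_deriv !derive1E.
have Dr := rder_re D; have Di := rder_im D.
have -> : 'D_1 (fun t : R => (@reC R \o g) (z + ofR t *: v)) 0 = reC c by exact: (@derive_val _ _ _ _ _ _ _ Dr).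
have -> : 'D_1 (fun t : R => (@imC R \o g) (z + ofR t *: v)) 0 = imC c by exact: (@derive_val _ _ _ _ _ _ _ Di).
by case: (c).
Qed.

Lemma rder_near (V : normedModType C) (f g : R -> V) x c r : 0 < r ->
  (forall t, `|t| < r -> f (x + t) = g (x + t)) -> rder f x c -> rder g x c.
Proof.
move=> r0 fg D e e0; have [d d0 hd] := D e e0.
exists (Num.min d r); first by rewrite lt_min d0.
move=> h; rewrite lt_min => /andP[h1 h2]; rewrite -fg //.
by have := fg 0; rewrite addr0 normr0 => <- //; exact: hd.
Qed.

Lemma conjvD m (u v : 'rV[C]_m) : conjv (u + v) = conjv u + conjv v.
Proof. by rewrite /conjv map_mxD. Qed.

Lemma conj_ofR (x : R) : (ofR x : C)^* = ofR x.
Proof. exact: conjc_real. Qed.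

Lemma conjvZ m (a : C) (v : 'rV[C]_m) : conjv (a *: v) = a^* *: conjv v.
Proof. by rewrite /conjv map_mxZ. Qed.

Lemma diag_line m (z v : 'rV[C]_m) t : diag (z + ofR t *: v) = diag z + ofR t *: diag v.
Proof. by rewrite /diag conjvD conjvZ conj_ofR scale_row_mx add_row_mx. Qed.

Lemma rder_diag m (G : 'rV[C]_(m + m) -> C) (z v : 'rV[C]_m) : differentiable G (diag z) ->
  rder (fun t => G (diag (z + ofR t *: v))) 0 ('d G (diag z) (diag v)).
Proof.
move=> dG.
have D : rder (fun t => diag z + ofR t *: diag v) 0 (diag v) by exact: rder_aff.
apply: (rder_ext (f := fun t => G (diag z + ofR t *: diag v))) => [t|]; first by rewrite diag_line.
apply: (rder_dd D); rewrite scale0r addr0; exact: ddP.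
Qed.

Lemma conjv_basis m (j : 'I_m) : conjv (basis_vec R j) = basis_vec R j.
Proof. by rewrite /conjv /basis_vec map_delta_mx. Qed.

(** In the directions [v] and ['i *: v] the second block of [diag] is multiplied by conjugate
    scalars, so the two Wirtinger combinations isolate one block each. *)
Lemma wirtinger_linear m (L : {linear 'rV[C]_(m + m) -> C}) (g : 'rV[C]_m -> C) z j :
  (forall v, real_derivC v g z = L (diag v)) ->
  dz j g z = L (row_mx (basis_vec R j) 0) /\ dzbar j g z = L (row_mx 0 (basis_vec R j)).
Proof.
move=> H; rewrite /dz /dzbar !H.
have E1 : diag (basis_vec R j) = row_mx (basis_vec R j) 0 + row_mx 0 (basis_vec R j).
  by rewrite /diag conjv_basis add_row_mx addr0 add0r.
have E2 : diag ('i *: basis_vec R j) = 'i *: (row_mx (basis_vec R j) 0 - row_mx 0 (basis_vec R j)).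
  rewrite /diag conjvZ conjv_basis conjCi opp_row_mx add_row_mx scale_row_mx oppr0 addr0 add0r.
  by rewrite scalerN scaleNr.
rewrite E1 E2 (linearZZ L) (linearB L) (linearD L).
move: (L _) (L _) => a b; rewrite -[_ *: _]/(_ * _) mulrA -expr2 sqrCi.
by split; field.
Qed.

Lemma wirtinger m (G : 'rV[C]_(m + m) -> C) (g : 'rV[C]_m -> C) z j : differentiable G (diag z) ->
  (exists2 r : R, 0 < r & forall u, nm (u - z) < r -> g u = G (diag u)) ->
  dz j g z = 'd G (diag z) (row_mx (basis_vec R j) 0) /\
  dzbar j g z = 'd G (diag z) (row_mx 0 (basis_vec R j)).
Proof.
move=> dG [r r0 hr]; apply: wirtinger_linear => v; apply: real_derivC_rder.
have v1 : 0 < nm v + 1 by rewrite ltr_wpDl // nm_ge0.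
apply: (rder_near (divr_gt0 r0 v1) _ (rder_diag v dG)) => t tr; rewrite add0r hr //.
rewrite addrAC subrr add0r nmZ nm_ofR; move: tr; rewrite ltr_pdivlMr //; apply: le_lt_trans.
by apply: ler_wpM2l; [exact: normr_ge0 | rewrite lerDl].
Qed.

End Wirtinger.

(** * Pullback of a form with polarized potential *)

Section CurvePullback.
Variable R : realType.
Local Notation C := (Cplx R).

Lemma row_basis_sum m (v : 'rV[C]_m) : v = \sum_j v 0 j *: basis_vec R j.
Proof. exact: row_sum_delta. Qed.

Lemma lin_row_mxl m (L : {linear 'rV[C]_(m + m) -> C}) (v : 'rV[C]_m) :
  L (row_mx v 0) = \sum_j v 0 j * L (row_mx (basis_vec R j) 0).
Proof.
rewrite {1}(row_basis_sum v) (big_morph (fun u : 'rV[C]_m => row_mx u (0 : 'rV[C]_m))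
  (fun a b => etrans (congr1 (row_mx (a + b)) (esym (addr0 0))) (esym (add_row_mx a 0 b 0))) (row_mx0 _ _ _ _)).
rewrite linear_sum; apply: eq_bigr => j _.
by rewrite -[in LHS](scaler0 _ (v 0 j)) -scale_row_mx (linearZZ L).
Qed.

Lemma lin_row_mxr m (L : {linear 'rV[C]_(m + m) -> C}) (v : 'rV[C]_m) :
  L (row_mx 0 v) = \sum_j v 0 j * L (row_mx 0 (basis_vec R j)).
Proof.
rewrite {1}(row_basis_sum v) (big_morph (row_mx (0 : 'rV[C]_m))
  (fun a b => etrans (congr1 (fun u => row_mx u (a + b)) (esym (addr0 0))) (esym (add_row_mx 0 a 0 b))) (row_mx0 _ _ _ _)).
rewrite linear_sum; apply: eq_bigr => j _.
by rewrite -[in LHS](scaler0 _ (v 0 j)) -scale_row_mx (linearZZ L).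
Qed.

Lemma derive1_coord m (L : C -> 'rV[C]_m) z j : differentiable L z ->
  dd (fun z => L z 0 j) z (fun h : C => h * derive1 L z 0 j).
Proof.
move=> dL; apply: dd_eq (dd_comp (dd1 dL) (dd_coord _ j)) _ => h.
by rewrite mxE.
Qed.

Lemma join_row_diag m (L : C -> 'rV[C]_m) z :
  join_row (fun j => L z 0 j) (fun j => star (fun z => L z 0 j) z^* ) = diag (L z).
Proof.
congr row_mx; apply/rowP => j; rewrite !mxE //.
by rewrite /star conjCK.
Qed.

(** [G k] is meant to be the polarized derivative of a potential in [zbar_k]. The sum is then the
    derivative in [w], at [w = z^*], of the polarized potential along the curve, and its derivative
    in [z'] is the pulled back form. *)
Theorem curve_pull m (L : C -> 'rV[C]_m) (G : 'I_m -> 'rV[C]_(m + m) -> C) (h : 'M[C]_m) z :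
  differentiable L z -> (forall k, differentiable (G k) (diag (L z))) ->
  (forall j k, h j k = 'd (G k) (diag (L z)) (row_mx (basis_vec R j) 0)) ->
  dd (fun z' : C => \sum_k dstar (fun z => L z 0 k) z^* *
        G k (join_row (fun j => L z' 0 j) (fun j => star (fun z => L z 0 j) z^* ))) z
     (fun s : C => s * (pull_form (derive1 L z) h) 0 0).
Proof.
move=> dL dG hE.
have DJ : dd (fun z' : C => join_row (fun j => L z' 0 j) (fun j => star (fun z => L z 0 j) z^* )) z
    (fun s : C => s *: row_mx (derive1 L z) 0).
  apply: dd_eq (dd_join_row (fun j => derive1_coord j dL) (fun j => dd_cst _ z)) _ => s.
  rewrite scale_row_mx scaler0; congr row_mx; apply/rowP => j; rewrite !mxE //.
have DG k : dd (fun z' : C => G k (join_row (fun j => L z' 0 j) (fun j => star (fun z => L z 0 j) z^* ))) z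
    (fun s : C => s * \sum_j derive1 L z 0 j * h j k).
  have DGk : dd (G k) (join_row (fun j => L z 0 j) (fun j => star (fun z => L z 0 j) z^* )) ('d (G k) (diag (L z))).
    by rewrite join_row_diag; exact: ddP.
  apply: dd_eq (dd_comp DJ DGk) _ => s; rewrite (linearZZ ('d (G k) _)) lin_row_mxl.
  by congr (_ * _); apply: eq_bigr => j _; rewrite hE.
apply: dd_eq (dd_sum (fun k => ddMl (dstar (fun z => L z 0 k) z^* ) (DG k))) _ => s.
rewrite /pull_form mxE mulr_sumr; apply: eq_bigr => k _; rewrite !mxE.
rewrite /dstar conjCK (dd_derive1 (derive1_coord k dL)).
by rewrite mulrCA; congr (_ * _); rewrite mulrC; congr (_ * _); apply: eq_bigr => j _; rewrite mxE.
Qed.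

End CurvePullback.

(** * Logarithmic potentials of space forms *)

Section SpaceFormPotential.
Variable R : realType.
Local Notation C := (Cplx R).
Variables (n : nat) (alpha c : R) (beta : 'I_n -> R).

(** The weights cover at once all affine charts of projective space and the ball. *)
Definition qnorm (u : 'rV[C]_n) : R := alpha + \sum_k beta k * abs2 (u 0 k).
Definition qpotential (u : 'rV[C]_n) : R := c * ln (qnorm u).
Definition qpol (p : 'rV[C]_(n + n)) : C :=
  ofR alpha + \sum_k ofR (beta k) * (p 0 (lshift n k) * p 0 (rshift n k)).
(** The polarized derivative of [qpotential] in [zbar_k]; as a quotient it needs no complex
    logarithm. *)
Definition qdbar (k : 'I_n) (p : 'rV[C]_(n + n)) : C :=
  ofR c * ('d qpol p (row_mx 0 (basis_vec R k)) / qpol p).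

Lemma mul_conj (z : C) : z * z^* = ofR (abs2 z).
Proof.
apply: C_ext; rewrite ?reCM ?imCM; case: z => x y; rewrite /reC /imC /ofR /abs2 /=.
  by rewrite mulrN opprK -!expr2.
by rewrite mulrN mulrC addNr.
Qed.

Lemma qpol_diag u : qpol (diag u) = ofR (qnorm u).
Proof.
rewrite /qpol /qnorm rmorphD rmorph_sum; congr (_ + _); apply: eq_bigr => k _.
by rewrite rmorphM /= /diag row_mxEl row_mxEr mxE mul_conj.
Qed.

Lemma dd_qpol (p : 'rV[C]_(n + n)) : dd qpol p (fun h =>
  \sum_k ofR (beta k) * (p 0 (lshift n k) * h 0 (rshift n k) + p 0 (rshift n k) * h 0 (lshift n k))).
Proof.
have D k := ddMl (ofR (beta k)) (ddM (dd_coord p (lshift n k)) (dd_coord p (rshift n k))).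
by apply: dd_ext (ddD (dd_cst (ofR alpha : C) p) (dd_sum D)) _ _ => h //; rewrite add0r.
Qed.

Lemma real_derivC_qpotential (v z : 'rV[C]_n) : 0 < qnorm z ->
  real_derivC v (@ofR R \o qpotential) z = ofR c * ('d qpol (diag z) (diag v) / qpol (diag z)).
Proof.
move=> z0; have D := rder_diag v (dd_diff (dd_qpol (diag z))).
set e := 'd _ _ _ in D *.
pose nr (t : R) := qnorm (z + ofR t *: v).
have nr0 : nr 0 = qnorm z by rewrite /nr scale0r addr0.
have Dr : is_derive 0 (1 : R) nr (reC e).
  have := rder_re D; have -> // : (@reC R \o (fun t => qpol (diag (z + ofR t *: v)))) = nr.
  by apply/funext => t; rewrite /= qpol_diag.
(* On the diagonal [qpol] is real, so its derivative along a real parameter is real. *)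
have Di : imC e = 0.
  have := rder_im D; have -> : (@imC R \o (fun t => qpol (diag (z + ofR t *: v)))) = cst 0.
    by apply/funext => t; rewrite /= qpol_diag imC_ofR.
  move=> DI; have := @derive_val _ _ _ _ _ _ _ DI => <-; exact: derive_cst.
have Dl : is_derive 0 (1 : R) (fun t => c * ln (nr t)) (c * (reC e / qnorm z)).
  have Dln : is_derive (nr 0) (1 : R) (@ln R) (qnorm z)^-1 by rewrite nr0; exact: is_derive1_ln.
  have Dc := is_deriveZ c (is_derive1_comp Dln Dr).
  by have -> : c * (reC e / qnorm z) = c *: ((qnorm z)^-1 * reC e) by rewrite [_^-1 * _]mulrC.
have E1 : real_deriv v (@reC R \o (@ofR R \o qpotential)) z = c * (reC e / qnorm z).
  by rewrite /real_deriv derive1E; exact: (@derive_val _ _ _ _ _ _ _ Dl).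
have E2 : real_deriv v (@imC R \o (@ofR R \o qpotential)) z = 0.
  by rewrite /real_deriv derive1E; exact: derive_cst.
rewrite /real_derivC E1 E2 qpol_diag.
have -> : e = ofR (reC e) by apply: C_ext; rewrite ?reC_ofR ?imC_ofR.
by rewrite -[LHS]/(ofR (c * (reC e / qnorm z))) !rmorphM /= fmorphV.
Qed.

Lemma diag_near (u z : 'rV[C]_n) r : nm (u - z) < r -> nm (diag u - diag z) < r.
Proof.
move=> uz; have r0 := le_lt_trans (nm_ge0 _) uz.
apply/nm_row_ltP => // i; have H := (nm_row_ltP _ r0).1 uz.
rewrite /diag !mxE; case: (fintype.split i) => j; have := H j; rewrite !mxE //.
by rewrite -rmorphB /= nm_conj.
Qed.

Lemma qnorm_near (z : 'rV[C]_n) : 0 < qnorm z ->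
  exists2 r : R, 0 < r & forall u, nm (u - z) < r -> 0 < qnorm u.
Proof.
move=> z0; have /contCP/(_ _ z0)[r r0 hr] := differentiable_continuous (dd_diff (dd_qpol (diag z))).
exists r => // u /diag_near/hr; rewrite !qpol_diag -rmorphB nm_ofR.
by have := ler_norm (qnorm z - qnorm u); rewrite distrC; lra.
Qed.

Lemma hol_qdbar k (p : 'rV[C]_(n + n)) : qpol p != 0 -> differentiable (qdbar k) p.
Proof.
move=> p0; have D : differentiable (fun p => 'd qpol p (row_mx 0 (basis_vec R k))) p.
  by apply: (dir_differentiable _ ltr01) => q _; exact: dd_diff (dd_qpol q).
exact: dd_diff (ddMl (ofR c) (ddM (ddP D) (ddV (dd_qpol p) p0))).
Qed.

Lemma dzbar_qpotential k u : 0 < qnorm u -> dzbar k (@ofR R \o qpotential) u = qdbar k (diag u).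
Proof.
move=> u0; have D := ddMl (ofR c / qpol (diag u)) (ddP (dd_diff (dd_qpol (diag u)))).
pose L := 'd (fun p => ofR c / qpol (diag u) * qpol p) (diag u).
have LE h : L h = ofR c * ('d qpol (diag u) h / qpol (diag u)).
  have E (a q t : C) : a / q * t = a * (t / q) by ring.
  exact: etrans (dd_val h D) (E _ _ _).
have H v : real_derivC v (@ofR R \o qpotential) u = L (diag v).
  exact: etrans (real_derivC_qpotential v u0) (esym (LE _)).
exact: etrans (proj2 (wirtinger_linear k H)) (LE _).
Qed.

Lemma ddbar_qpotential z j k : 0 < qnorm z ->
  ddbar qpotential z j k = 'd (qdbar k) (diag z) (row_mx (basis_vec R j) 0).
Proof.
move=> z0; rewrite mxE; apply: (proj1 (wirtinger (G := qdbar k) _ _ _)).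
  by apply: hol_qdbar; rewrite qpol_diag -nm_eq0 nm_ofR normr_eq0 gt_eqF.
have [r r0 hr] := qnorm_near z0; exists r => // u /hr u0.
exact: dzbar_qpotential.
Qed.

Lemma fs_dwE (f : 'I_n -> C -> C) (g : 'I_n -> C) w :
  \sum_k dstar (f k) w * qdbar k (join_row g (fun k => star (f k) w)) =
  ofR c * (fs_dw f (fun k => ofR (beta k)) g w / fs_val f (ofR alpha) (fun k => ofR (beta k)) g w).
Proof.
pose J := join_row g (fun k => star (f k) w).
have Jl k : J 0 (lshift n k) = g k by rewrite /J row_mxEl mxE.
have Jr k : J 0 (rshift n k) = star (f k) w by rewrite /J row_mxEr mxE.
have EN : qpol J = fs_val f (ofR alpha) (fun k => ofR (beta k)) g w.
  by congr (_ + _); apply: eq_bigr => k _; rewrite Jl Jr.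
have ED k : 'd qpol J (row_mx 0 (basis_vec R k)) = ofR (beta k) * g k.
  rewrite (dd_val _ (dd_qpol J)) (bigD1 k) //= big1 => [|i ik].
    by rewrite Jl Jr row_mxEl row_mxEr !mxE !eqxx mulr1 mulr0 !addr0.
  by rewrite Jl Jr row_mxEl row_mxEr !mxE eqxx (negbTE ik) /= !mulr0 addr0 mulr0.
rewrite /fs_dw mulr_suml mulr_sumr; apply: eq_bigr => k _.
by rewrite /qdbar -/J ED EN; ring.
Qed.

End SpaceFormPotential.

Section KahlerPotential.
Variable R : realType.
Local Notation C := (Cplx R).
Variables (m : nat) (psi : 'rV[C]_m -> R) (Psi : 'rV[C]_(m + m) -> C) (z : 'rV[C]_m) (r : R).
Hypotheses (r0 : 0 < r) (hPsi : hol_ball Psi (diag z) r)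
  (PsiE : forall u, nm (u - z) < r -> Psi (diag u) = ofR (psi u)).

Definition pol_dbar (k : 'I_m) (p : 'rV[C]_(m + m)) : C := 'd Psi p (row_mx 0 (basis_vec R k)).

Lemma hol_pol_dbar k : hol_ball (pol_dbar k) (diag z) r.
Proof. exact: hol_dir. Qed.

Lemma ddbar_potential j k :
  ddbar psi z j k = 'd (pol_dbar k) (diag z) (row_mx (basis_vec R j) 0).
Proof.
have zz : nm (diag z - diag z) < r by rewrite subrr nm0.
rewrite mxE; apply: (proj1 (wirtinger (G := pol_dbar k) _ _ _)).
  exact: hol_pol_dbar.
exists r => // u ur.
apply: (proj2 (wirtinger (G := Psi) _ _ _)); first exact: hPsi (diag_near ur).
exists (r - nm (u - z)); first by rewrite subr_gt0.
move=> v hv; rewrite /= PsiE //; apply: le_lt_trans (nm_dist _ _ u) _.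
by rewrite -ltrBrDr.
Qed.

Lemma pot_dwE (l : 'I_m -> C -> C) (u : 'I_m -> C) w :
  pot_dw l Psi u w = \sum_k dstar (l k) w * pol_dbar k (join_row u (fun j => star (l j) w)).
Proof.
have E0 (v : 'I_m -> C) : join_row (fun=> 0) v = row_mx 0 (\row_j v j).
  by congr row_mx; apply/rowP => j; rewrite !mxE.
rewrite /pot_dw E0 (lin_row_mxr ('d Psi _)).
by apply: eq_bigr => k _; rewrite mxE.
Qed.

End KahlerPotential.

(** * Curves with equal pullbacks, read in charts *)

Section CurveRigidity.
Variable R : realType.
Local Notation C := (Cplx R).

Lemma d_first (F : C * C -> C) z w c : differentiable F (z, w) ->
  dd (fun z' : C => F (z', w)) z (fun s : C => s * c) -> 'd F ((z, w) : C * C) ((1, 0) : C * C) = c.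
Proof.
move=> dF D; have D' := dd_comp (dd_pair (dd_id z) (dd_cst w z)) (ddP dF).
by have := etrans (esym (dd_val (1 : C) D')) (dd_val (1 : C) D); rewrite mul1r.
Qed.

Variables (n m : nat) (Ls : C -> 'rV[C]_n) (Lm : C -> 'rV[C]_m) (alpha b : R) (beta : 'I_n -> R).
Variables (U : set 'rV[C]_m) (psi : 'rV[C]_m -> R) (W : set 'rV[C]_(m + m)) (Psi : 'rV[C]_(m + m) -> C).
Hypotheses (Uo : open U) (pol : is_polarization U psi W Psi) (nash : nash_on W Psi) (b0 : b != 0).
Variables (z0 : C) (d : R).
Hypotheses (d0 : 0 < d) (hLs : forall z, nm (z - z0) < d -> differentiable Ls z)
  (hLm : forall z, nm (z - z0) < d -> differentiable Lm z)
  (LmU : forall z, nm (z - z0) < d -> U (Lm z))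
  (qpos : forall z, nm (z - z0) < d -> 0 < qnorm alpha beta (Ls z)).
Let pot := qpotential alpha b^-1 beta.
Hypothesis same : forall z, nm (z - z0) < d ->
  pull_form (derive1 Ls z) (ddbar pot (Ls z)) 0 0 = pull_form (derive1 Lm z) (ddbar psi (Lm z)) 0 0.

Let f (k : 'I_n) (z : C) : C := Ls z 0 k.
Let l (j : 'I_m) (z : C) : C := Lm z 0 j.
Let be k : C := ofR (beta k).
Let fso : C * C -> C := @fs_on R n f (ofR alpha) be C f.
Let pto : C * C -> C := @pot_on R m l Psi C l.
Let Q (p : C * C) : C := 'd fso p ((0, 1) : C * C) / fso p - ofR b * 'd pto p ((0, 1) : C * C).

Let hf k z e : nm (z - z0) + e <= d -> @hol_ball R C (f k) z e.
Proof.
move=> ze y yz; apply: dd_diff (derive1_coord k (hLs _)).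
by apply: le_lt_trans (nm_dist _ _ z) _; move: yz ze; rewrite -lerBrDl -ltrBrDr => yz /(lt_le_trans yz).
Qed.

Let hl k z e : nm (z - z0) + e <= d -> @hol_ball R C (l k) z e.
Proof.
move=> ze y yz; apply: dd_diff (derive1_coord k (hLm _)).
by apply: le_lt_trans (nm_dist _ _ z) _; move: yz ze; rewrite -lerBrDl -ltrBrDr => yz /(lt_le_trans yz).
Qed.

Let polarized z : nm (z - z0) < d -> exists2 r : R, 0 < r & hol_ball Psi (diag (Lm z)) r /\
  forall u, nm (u - Lm z) < r -> Psi (diag u) = ofR (psi u).
Proof.
move=> zd; have [Wo _ UW hW E] := pol.
have [r r0 hr] := (openCP W).1 Wo _ (UW _ (LmU zd)).
have [s s0 hs] := (openCP U).1 Uo _ (LmU zd).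
exists (Num.min r s); first by rewrite lt_min r0.
split=> [p|u]; rewrite lt_min => /andP[h1 h2].
  by apply: hW; exact: hr.
by apply: E; exact: hs.
Qed.

Let N0 z : nm (z - z0) < d -> fs_val f (ofR alpha) be (fun k => f k z) z^* != 0.
Proof.
move=> zd; have -> : fs_val f (ofR alpha) be (fun k => f k z) z^* = ofR (qnorm alpha beta (Ls z)).
  by rewrite -qpol_diag -join_row_diag; congr (_ + _); apply: eq_bigr => k _; rewrite row_mxEl row_mxEr !mxE.
by rewrite -nm_eq0 nm_ofR normr_eq0 gt_eqF // qpos.
Qed.

Let domain z : nm (z - z0) < d -> exists d1 : R, [/\ 0 < d1,
  forall z' w, nm (z' - z) < d1 -> nm (w - z^* ) < d1 ->
    [/\ forall k, differentiable (f k) z', forall j, differentiable (l j) z',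
      forall k, differentiable (f k) w^*, forall j, differentiable (l j) w^*
      & differentiable Psi (join_row (fun k => l k z') (fun j => star (l j) w))],
  differentiable (fun p => 'd pto p ((0, 1) : C * C)) ((z, z^* ) : C * C) &
  differentiable Q ((z, z^* ) : C * C)].
Proof.
move=> zd; have [r r0 [hP _]] := polarized zd; rewrite -join_row_diag in hP.
have e0 : 0 < d - nm (z - z0) by rewrite subr_gt0.
have ee : nm (z - z0) + (d - nm (z - z0)) <= d by rewrite addrC subrK.
have [d1 [[d10 d1d] hd1 _ ph qh]] := local_domain (ofR b) e0 r0 (fun k => hf k ee) (fun j => hl j ee) hP (N0 zd).
have cc : nm ((z, z^* ) - (z, z^* ) : C * C) < d1 by rewrite subrr nm0.
exists d1; split=> [//|z' w h1 h2||]; last exact: qh cc; last exact: (hol_dir _ ph cc).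
have h1' := lt_le_trans h1 d1d; have h2' := lt_le_trans h2 d1d.
have h3 : nm (w^* - z) < d - nm (z - z0) by rewrite -nm_conj rmorphB /= conjCK.
split.
- by move=> k; exact: (hf k ee h1').
- by move=> k; exact: (hl k ee h1').
- by move=> k; exact: (hf k ee h3).
- by move=> k; exact: (hl k ee h3).
- exact: hP (hd1 _ _ h1 h2).1.
Qed.

Let pullM z := pull_form (derive1 Lm z) (ddbar psi (Lm z)) 0 0.
Let pullS z := pull_form (derive1 Ls z) (ddbar pot (Ls z)) 0 0.

Let DM z : nm (z - z0) < d ->
  dd (fun z' : C => 'd pto ((z', z^* ) : C * C) ((0, 1) : C * C)) z (fun s : C => s * pullM z).
Proof.
move=> zd; have [d1 [d10 hd1 _ _]] := domain zd; have [r r0 [hP PE]] := polarized zd.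
have rr : nm (diag (Lm z) - diag (Lm z)) < r by rewrite subrr nm0.
have D := curve_pull (hLm zd) (fun k => hol_pol_dbar hP k rr) (fun j k => ddbar_potential r0 hP PE j k).
apply: (near_dd _ D); exists d1 => // z' z'd.
have ww : nm (z^* - z^* ) < d1 by rewrite subrr nm0.
have [_ h2 _ h4 h5] := hd1 _ _ z'd ww.
apply/esym; apply: etrans (d_pot_on (p := (z', z^* )) h2 h4 h5) _; exact: pot_dwE.
Qed.

Let DS z : nm (z - z0) < d ->
  dd (fun z' : C => 'd fso ((z', z^* ) : C * C) ((0, 1) : C * C) / fso (z', z^* )) z
     (fun s : C => s * (ofR b * pullS z)).
Proof.
move=> zd; have [d1 [d10 hd1 _ _]] := domain zd.
have q0 : qpol alpha beta (diag (Ls z)) != 0.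
  by rewrite qpol_diag -nm_eq0 nm_ofR normr_eq0 gt_eqF // qpos.
have D := ddMl (ofR b) (curve_pull (hLs zd) (fun k => hol_qdbar b^-1 k q0)
  (fun j k => ddbar_qpotential b^-1 j k (qpos zd))).
apply: (near_dd _ (dd_eq D _)); last by move=> s; rewrite mulrCA.
exists d1 => // z' z'd.
have ww : nm (z^* - z^* ) < d1 by rewrite subrr nm0.
have [h1 _ h3 _ _] := hd1 _ _ z'd ww.
have bb : ofR b * ofR b^-1 = 1 :> C by rewrite -rmorphM /= mulfV // rmorph1.
have E : 'd fso ((z', z^* ) : C * C) ((0, 1) : C * C) = fs_dw f be (fun k => f k z') z^*.
  exact: (d_fs_on (ofR alpha) be (p := (z', z^* )) h1 h3).
have FE := fs_dwE alpha b^-1 beta f (fun k => f k z') z^*.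
apply: etrans (congr1 ( *%R (ofR b)) FE) _; rewrite mulrA bb mul1r.
by apply: (congr1 (fun t => t / _)); exact: esym.
Qed.

Theorem curve_rigidity : exists2 d' : R, 0 < d' & forall z, nm (z - z0) < d' ->
  pull_form (derive1 Lm z) (ddbar psi (Lm z)) 0 0 = 0.
Proof.
have zz : nm (z0 - z0) < d by rewrite subrr nm0.
have Hrel z : nm (z - z0) < d -> 'd Q ((z, z^* ) : C * C) ((1, 0) : C * C) = 0.
  move=> zd; have [d1 [_ _ _ dQ]] := domain zd; apply: (d_first dQ).
  apply: dd_eq (ddB (DS zd) (ddMl (ofR b) (DM zd))) _ => s.
  by rewrite /pullS /pullM same //; ring.
have [Wo _ UW _ _] := pol; have [_ /(_ _ (UW _ (LmU zz)))[V [P [Vo Vz VW P0 hP]]]] := nash.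
have [r r0 hr] := (openCP V).1 Vo _ Vz.
have [r' r'0 [hPsi _]] := polarized zz.
pose rho := Num.min r r'; have rho0 : 0 < rho by rewrite lt_min r0.
have hPsi' : hol_ball Psi (join_row (fun j => l j z0) (fun j => star (l j) z0^* )) rho.
  by rewrite join_row_diag => p; rewrite lt_min => /andP[_ h]; exact: hPsi.
have hP' p : nm (p - join_row (fun j => l j z0) (fun j => star (l j) z0^* )) < rho ->
    meval (fun i => row_mx p (Psi p)%:M 0 i) P = 0.
  by rewrite join_row_diag lt_min => /andP[h _]; apply: hP; exact: hr.
have ee : nm (z0 - z0) + d <= d by rewrite subrr nm0 add0r.
have b0' : ofR b != 0 :> C by rewrite -nm_eq0 nm_ofR normr_eq0.
have [d' d'0 hd'] := no_mixed_derivative d0 rho0 b0' (fun k => hf k ee) (fun j => hl j ee) hPsi' P0 hP' (N0 zz) Hrel.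
exists (Num.min d d'); first by rewrite lt_min d0.
move=> z; rewrite lt_min => /andP[zd /hd' H]; have [d1 [_ _ dP _]] := domain zd.
by rewrite -/(pullM z) -(d_first dP (DM zd)).
Qed.

End CurveRigidity.

(** * Space forms *)

Section Definiteness.
Variable R : realType.
Local Notation C := (Cplx R).

Lemma abs2_ge0 (z : C) : 0 <= abs2 z.
Proof. by rewrite addr_ge0 // sqr_ge0. Qed.

Lemma abs2_eq0 (z : C) : abs2 z = 0 -> z = 0.
Proof.
move=> /eqP; rewrite paddr_eq0 ?sqr_ge0 // !sqrf_eq0 => /andP[/eqP x /eqP y].
exact: C_ext.
Qed.

Variables (n : nat) (alpha b : R) (beta : 'I_n -> R).
Implicit Types u J : 'rV[C]_n.
Let norm_form J : R := \sum_k beta k * abs2 (J 0 k).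
Let pairing J u : C := \sum_k ofR (beta k) * (J 0 k * (u 0 k)^* ).

Lemma pull_form_qpotential J u : 0 < qnorm alpha beta u ->
  pull_form J (ddbar (qpotential alpha b^-1 beta) u) 0 0 =
  ofR (b^-1 * (norm_form J / qnorm alpha beta u - abs2 (pairing J u) / qnorm alpha beta u ^+ 2)).
Proof.
move=> u0; set N := qnorm alpha beta u.
have N0 : ofR N != 0 :> C by rewrite -nm_eq0 nm_ofR normr_eq0 gt_eqF.
have hE j k : ddbar (qpotential alpha b^-1 beta) u j k =
    ofR b^-1 * ((ofR (beta k) * (k == j)%:R) / ofR N - (ofR (beta k) * u 0 k) * (ofR (beta j) * (u 0 j)^* ) / ofR N ^+ 2).
  rewrite ddbar_qpotential //.
  have qE p : qdbar alpha b^-1 beta k p = ofR b^-1 * (ofR (beta k) * p 0 (lshift n k) * (qpol alpha beta p)^-1).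
    rewrite /qdbar (dd_val _ (dd_qpol alpha beta p)) (bigD1 k) //= big1 => [|i ik].
      by rewrite row_mxEl row_mxEr !mxE !eqxx mulr1 mulr0 !addr0.
    by rewrite row_mxEl row_mxEr !mxE eqxx (negbTE ik) /= !mulr0 addr0 mulr0.
  have q0 : qpol alpha beta (diag u) != 0 by rewrite qpol_diag.
  have D := ddMl (ofR b^-1) (ddM (ddMl (ofR (beta k)) (dd_coord (diag u) (lshift n k))) (ddV (dd_qpol alpha beta (diag u)) q0)).
  have {}D : dd (qdbar alpha b^-1 beta k) (diag u) _ := dd_ext D (fun p => esym (qE p)) (fun=> erefl).
  rewrite (dd_val _ D) (bigD1 j) //= big1 => [|i ij]; last first.
    by rewrite row_mxEl row_mxEr !mxE eqxx (negbTE ij) /= !mulr0 addr0 mulr0.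
  rewrite !row_mxEl !row_mxEr !mxE !eqxx /= eq_sym qpol_diag -/N.
  have E (b1 bk uk M bj uj v e : C) : M != 0 ->
      b1 * (bk * uk * (- M ^- 2 * (bj * (uj * 0 + v * 1) + 0)) + M^-1 * (bk * e)) =
      b1 * (bk * e / M - bk * uk * (bj * v) / M ^+ 2) by move=> M0; field.
  exact: E N0.
set A := pairing J u.
have H1 k : (J *m ddbar (qpotential alpha b^-1 beta) u) 0 k =
    ofR b^-1 * (ofR (beta k) * J 0 k / ofR N - ofR (beta k) * u 0 k * A / ofR N ^+ 2).
  have H2 : \sum_j J 0 j * (k == j)%:R = J 0 k.
    rewrite (bigD1 k) //= eqxx mulr1 big1 ?addr0 // => j jk.
    by rewrite eq_sym (negbTE jk) mulr0.
  rewrite -[in RHS]H2 /A /pairing !(mulr_sumr, mulr_suml) -sumrB mulr_sumr mxE.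
  have E (b1 bk uk M bj uj v e : C) : M != 0 ->
      uj * (b1 * (bk * e / M - bk * uk * (bj * v) / M ^+ 2)) =
      b1 * (bk * (uj * e) / M - bk * uk * (bj * (uj * v)) / M ^+ 2) by move=> M0; field.
  by apply: eq_bigr => j _; rewrite hE; exact: E N0.
have H3 : \sum_k ofR (beta k) * (u 0 k * (J 0 k)^* ) = A^*.
  rewrite rmorph_sum; apply: eq_bigr => k _.
  by rewrite !rmorphM /= conj_ofR conjCK [(J 0 k)^* * _]mulrC.
have H4 v : ofR (norm_form v) = \sum_k ofR (beta k) * (v 0 k * (v 0 k)^* ) :> C.
  by rewrite rmorph_sum; apply: eq_bigr => k _; rewrite rmorphM mul_conj.
have -> : ofR (b^-1 * (norm_form J / N - abs2 A / N ^+ 2)) =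
    ofR b^-1 * (ofR (norm_form J) / ofR N - A * A^* / ofR N ^+ 2) :> C.
  by rewrite mul_conj rmorphM rmorphB /= !rmorphM /= !fmorphV rmorphXn.
rewrite H4 -H3 !(mulr_sumr, mulr_suml) -sumrB mulr_sumr /pull_form mxE.
have E (b1 bk jk M uk a v : C) : M != 0 ->
    b1 * (bk * jk / M - bk * uk * a / M ^+ 2) * v =
    b1 * (bk * (jk * v) / M - a * (bk * (uk * v)) / M ^+ 2) by move=> M0; field.
by apply: eq_bigr => k _; rewrite H1 !mxE; exact: E N0.
Qed.

(** The weighted square norm of [a J - A u], with [a] that of [u] and [A] the pairing, expands to
    [a] times the defect of the inequality. If [a = 0], every term of [A] vanishes. *)
Lemma cauchy_schwarz J u : (forall k, 0 <= beta k) ->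
  abs2 (pairing J u) <= norm_form J * norm_form u.
Proof.
move=> be0; set A := pairing J u; set a := norm_form u; set s := norm_form J.
have nf0 v : 0 <= norm_form v by apply: sumr_ge0 => k _; rewrite mulr_ge0 // abs2_ge0.
have E : \sum_k beta k * abs2 (ofR a * J 0 k - A * u 0 k) = a * (s * a - abs2 A).
  have H v : ofR (norm_form v) = \sum_k ofR (beta k) * (v 0 k * (v 0 k)^* ) :> C.
    by rewrite rmorph_sum; apply: eq_bigr => k _; rewrite rmorphM mul_conj.
  have Hc : \sum_k ofR (beta k) * (u 0 k * (J 0 k)^* ) = A^*.
    rewrite rmorph_sum; apply: eq_bigr => k _.
    by rewrite !rmorphM /= conj_ofR conjCK [(J 0 k)^* * _]mulrC.
  apply: (fmorph_inj (@ofR R)); rewrite rmorphM rmorphB rmorphM /= -mul_conj rmorph_sum.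
  have HA : \sum_k ofR (beta k) * (J 0 k * (u 0 k)^* ) = A by [].
  clearbody A.
  have T k : ofR (beta k * abs2 (ofR a * J 0 k - A * u 0 k)) =
      ofR a * ofR a * (ofR (beta k) * (J 0 k * (J 0 k)^* )) - ofR a * A^* * (ofR (beta k) * (J 0 k * (u 0 k)^* ))
      - ofR a * A * (ofR (beta k) * (u 0 k * (J 0 k)^* )) + A * A^* * (ofR (beta k) * (u 0 k * (u 0 k)^* )) :> C.
    have c1 : (ofR a * J 0 k - A * u 0 k)^* = ofR a * (J 0 k)^* - A^* * (u 0 k)^*.
      by rewrite rmorphB /= !rmorphM /= conj_ofR.
    by rewrite rmorphM /= -mul_conj c1; ring.
  rewrite (eq_bigr _ (fun k _ => T k)) big_split /= !sumrB -!mulr_sumr -!H Hc HA -/a -/s; ring.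
have [a0|a0] := eqVneq a 0.
  have A0 : A = 0.
    apply: big1 => k _; have : beta k * abs2 (u 0 k) = 0.
      apply/eqP; move/eqP: a0; rewrite psumr_eq0 => [/allP/(_ k)|i _]; last by rewrite mulr_ge0 // abs2_ge0.
      by rewrite mem_index_enum => /(_ isT)/implyP/(_ isT).
    move/eqP; rewrite mulf_eq0 => /orP[/eqP ->|/eqP/abs2_eq0 ->]; first by rewrite rmorph0 mul0r.
    by rewrite rmorph0 !mulr0.
  by rewrite A0 a0 mulr0 /abs2 /reC /imC /= expr0n addr0.
have ap : 0 < a by rewrite lt0r a0 nf0.
rewrite -subr_ge0 -(pmulr_rge0 _ ap) -E; apply: sumr_ge0 => k _.
by rewrite mulr_ge0 // abs2_ge0.
Qed.

(** Vanishing means [N * norm_form J = abs2 (pairing J u)]. For positive weights, [cauchy_schwarz]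
    bounds the right side by [(N - alpha) * norm_form J], so [norm_form J <= 0]; for negative
    weights, the left side is nonpositive and the right side nonnegative. *)
Theorem pull_form_definite J u : b != 0 -> 0 < qnorm alpha beta u ->
  (0 < alpha /\ forall k, 0 < beta k) \/ (forall k, beta k < 0) ->
  pull_form J (ddbar (qpotential alpha b^-1 beta) u) 0 0 = 0 -> J = 0.
Proof.
move=> b0 u0 sgn; rewrite pull_form_qpotential //; set N := qnorm alpha beta u in u0 *.
move/eqP; rewrite -nm_eq0 nm_ofR normr_eq0 mulf_eq0 invr_eq0 (negbTE b0) /= => /eqP E.
have {}E : N * norm_form J = abs2 (pairing J u).
  have : norm_form J / N = abs2 (pairing J u) / N ^+ 2 by apply/eqP; rewrite -subr_eq0 E.
  move/(congr1 (fun x => x * N ^+ 2)); rewrite divfK; last by rewrite expf_neq0 // gt_eqF.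
  by rewrite expr2 mulrA divfK ?gt_eqF // mulrC.
have s0 : norm_form J = 0.
  case: sgn => [[al0 be0]|be0].
    have CS := cauchy_schwarz J u (fun k => ltW (be0 k)).
    have nf0 : 0 <= norm_form J by apply: sumr_ge0 => k _; rewrite mulr_ge0 ?abs2_ge0 // ltW.
    apply/eqP; rewrite eq_le nf0 andbT -(pmulr_rle0 _ al0).
    by move: CS; rewrite -E /N /qnorm -/(norm_form u); lra.
  have nf0 : norm_form J <= 0.
    by apply: sumr_le0 => k _; rewrite mulr_le0_ge0 ?abs2_ge0 // ltW.
  apply/eqP; rewrite eq_le nf0 /= -(pmulr_rge0 _ u0) E; exact: abs2_ge0.
have be0 k : beta k != 0 by case: sgn => [[_ /(_ k)]|/(_ k)] H; [rewrite gt_eqF | rewrite lt_eqF].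
have terms k : beta k * abs2 (J 0 k) = 0.
  case: sgn => [[_ pos]|neg].
    by apply: (psumr_eq0P _ s0) => // i _; rewrite mulr_ge0 ?abs2_ge0 // ltW.
  apply/eqP; rewrite -oppr_eq0; apply/eqP; apply: (psumr_eq0P (P := predT) (F := fun k => - (beta k * abs2 (J 0 k)))) => //.
    by move=> i _; rewrite oppr_ge0 mulr_le0_ge0 ?abs2_ge0 // ltW.
  by rewrite sumrN -/(norm_form J) s0 oppr0.
apply/rowP => k; rewrite mxE; apply: abs2_eq0.
by have /eqP := terms k; rewrite mulf_eq0 (negbTE (be0 k)) => /eqP.
Qed.

End Definiteness.

(** * Charts and potentials of projective and hyperbolic spaces *)

Section SpaceForms.
Variable R : realType.
Local Notation C := (Cplx R).

Definition definite_potential n (U : set 'rV[C]_n) (h : 'rV[C]_n -> 'M[C]_n) : Prop :=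
  exists alpha b : R, exists beta : 'I_n -> R,
  [/\ b != 0, forall z, U z -> 0 < qnorm alpha beta z,
      (0 < alpha /\ forall k, 0 < beta k) \/ (forall k, beta k < 0)
    & h = ddbar (qpotential alpha b^-1 beta)].

(** The interface through which both families of space forms enter: charts that separate points, and
    definite logarithmic potentials. *)
Definition space_charts n (S : hmanifold R n) : Prop :=
  [/\ forall p : S, exists i, cdom (@atlas R n S i) p,
      forall i, open (cdom (@atlas R n S i)),
      forall i (p q : S), cdom (atlas i) p -> cdom (atlas i) q ->
        cmap (atlas i) p = cmap (atlas i) q -> p = q
    & forall i : atlas_index S, definite_potential (cimage (atlas i)) (@metric R n S i)].

Section Projective.
Local Open Scope quotient_scope.
Variables (n : nat) (b : R).
Hypothesis b0 : 0 < b.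

(** In these weights [FS_norm] is a diagonal form in all homogeneous coordinates, so each affine
    chart gives a [qnorm], with constant term the weight of the coordinate set to 1. *)
Let weight (i : 'I_n.+1) : R := if i == ord0 then 1 else b^-1.

Let weight0 i : 0 < weight i.
Proof. by rewrite /weight; case: ifP => // _; rewrite invr_gt0. Qed.

Let FS_norm_lift j (u : 'rV[C]_n) :
  FS_norm b (lift_affine b j u) = qnorm (weight j) (fun k => weight (lift j k) * b ^+ 2) u.
Proof.
have E Z : FS_norm b Z = \sum_i weight i * abs2 (Z 0 i).
  rewrite big_ord_recl /weight eqxx mul1r /FS_norm mulr_sumr; congr (_ + _).
have ME (z : C) : abs2 (ofR b * z) = b ^+ 2 * abs2 z.
  by rewrite /abs2 reCM imCM reC_ofR imC_ofR !mul0r subr0 addr0; ring.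
rewrite E (bigD1_ord j) //= mxE unlift_none; congr (_ + _).
  by rewrite /abs2 /reC /imC /= expr1n expr0n addr0 mulr1.
by apply: eq_bigr => k _; rewrite mxE liftK ME mulrA.
Qed.

Let CP_pi_eq (p q : CP R n) (l : C) : l != 0 ->
  homogeneous_coords q = l *: homogeneous_coords p -> p = q.
Proof.
move=> l0 E; rewrite -[p]reprK -[q]reprK; apply/eqmodP; apply/asboolP.
by exists l.
Qed.

Lemma CP_space_charts : space_charts (CPb n b).
Proof.
split=> /=.
- move=> p; have /rV0Pn[j Zj] : homogeneous_coords p != 0.
    by have := valP (repr p); rewrite inE.
  by exists j.
- move=> j; rewrite /open /= /quotient_open.
  (* Openness is tested upstairs; the chosen representative may be replaced by [Z] because the
     nonvanishing of a coordinate is invariant under scaling. *)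
  have -> : \pi_(CP R n) @^-1` [set p | homogeneous_coords p 0 j != 0] =
            (fun Z : @punctured R n => \val Z) @^-1` [set Z : 'rV[C]_n.+1 | Z 0 j != 0].
    apply/seteqP; split=> Z /=; have : Z = repr (\pi_(CP R n) Z) %[mod CP R n] by rewrite reprK.
      move=> /eqmodP/asboolP[l l0 E]; rewrite /homogeneous_coords E mxE mulf_eq0 negb_or.
      by case/andP.
    move=> /eqmodP/asboolP[l l0 E] Zj; rewrite /homogeneous_coords E mxE mulf_neq0 //.
  apply: open_comp; first by move=> Z _; exact: initial_continuous.
  apply/openCP => x xj; exists (nm (x 0 j)); first by rewrite nm_gt0.
  move=> y yx; apply/eqP => yj; have := le_lt_trans (nm_coord (y - x) j) yx.
  by rewrite !mxE yj sub0r nmN ltxx.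
- move=> j p q pj qj E; set P := homogeneous_coords p in pj E; set Q := homogeneous_coords q in qj E.
  apply: (@CP_pi_eq p q (Q 0 j / P 0 j)); first by rewrite mulf_neq0 ?invr_eq0.
  apply/rowP => i; rewrite mxE; case: (unliftP j i) => [k ->|->]; last by rewrite divfK.
  have := congr1 (fun v : 'rV[C]_n => v 0 k) E; rewrite !mxE -/P -/Q => Ek.
  have bn0 : ofR b != 0 :> C by rewrite -nm_eq0 nm_ofR normr_eq0 gt_eqF.
  have {}Ek : Q 0 (lift j k) = P 0 (lift j k) / (ofR b * P 0 j) * (ofR b * Q 0 j).
    by rewrite Ek divfK // mulf_neq0.
  by rewrite Ek; field; rewrite pj /=.
- move=> j; exists (weight j), b, (fun k => weight (lift j k) * b ^+ 2); split.
  + by rewrite gt_eqF.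
  + move=> z _; rewrite ltr_pwDl ?weight0 // sumr_ge0 // => k _.
    by rewrite mulr_ge0 ?abs2_ge0 // ltW // mulr_gt0 // exprn_gt0.
  + by left; split=> // k; rewrite mulr_gt0 // exprn_gt0.
  + apply/funext => z; congr (ddbar _ z); apply/funext => u.
    by rewrite /FS_potential FS_norm_lift.
Qed.

End Projective.

Lemma CH_space_charts n (b : R) (b_lt0 : b < 0) : space_charts (CHb n b_lt0).
Proof.
split=> /=.
- by move=> p; exists tt.
- by move=> _; exact: openT.
- by move=> _ p q _ _; exact: val_inj.
- case; exists (1 : R), b, (fun=> b); split.
  + by rewrite lt_eqF.
  + move=> _ [p _ <-]; have := valP p; rewrite inE /CH_ball /= => pb.
    rewrite /qnorm -mulr_sumr -/(sqnorm _) -(ltrD2r (-1)) addrAC subrr !add0r.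
    by rewrite -(mulfV (_ : b != 0)) ?lt_eqF // -mulrN ltr_nM2l.
  + by right.
  + apply/funext => z; congr (ddbar _ z); apply/funext => u.
    by rewrite /space_form_potential /qpotential /qnorm /sqnorm mulr_sumr.
Qed.

Lemma space_form_charts n (S : hmanifold R n) : complex_space_form S -> space_charts S.
Proof. by case=> [b b0|b b_lt0]; [exact: CP_space_charts | exact: CH_space_charts]. Qed.

End SpaceForms.

(** * Curves in manifolds *)

Section Curves.
Variable R : realType.
Local Notation C := (Cplx R).

Lemma pull_form_mul k m n (A : 'M[C]_(k, m)) (B : 'M[C]_(m, n)) h :
  pull_form (A *m B) h = pull_form A (pull_form B h).
Proof. by rewrite /pull_form trmx_mul /conjv map_mxM !mulmxA. Qed.

Lemma derive1_comp_row m n (h : C -> 'rV[C]_m) (g : 'rV[C]_m -> 'rV[C]_n) z :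
  differentiable h z -> differentiable g (h z) ->
  dd (fun z => g (h z)) z (fun s : C => s *: (derive1 h z *m jacobian g (h z))).
Proof.
move=> dh dg; apply: dd_eq (dd_comp (dd1 dh) (ddP dg)) _ => s.
by rewrite (linearZZ ('d g _)) /jacobian mul_rV_lin1.
Qed.

Lemma curve_near (X : topologicalType) (G : C -> X) z (A : set X) :
  {for z, continuous G} -> open A -> A (G z) ->
  exists2 r : R, 0 < r & forall z', nm (z' - z) < r -> A (G z').
Proof.
move=> cG oA AG; have /nbhsCP[r r0 hr] := cG A (open_nbhs_nbhs (conj oA AG)).
by exists r.
Qed.

Section ChartChange.
Variables (m : nat) (X : cmanifold R m) (D : set C) (G : C -> X) (c : chart R X m).
Hypotheses (hX : is_complex_manifold X) (hG : holomorphic_curve D G) (hc : is_holo_chart c).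

Lemma transition_near z i : D z -> cdom c (G z) -> cdom (atlas i) (G z) ->
  exists2 r : R, 0 < r & forall z', nm (z' - z) < r ->
    cdom c (G z') /\ cdom (atlas i) (G z').
Proof.
move=> Dz cz iz; have [[co _ _ _ _] _] := hc; have [_ _ ch _ _] := hX; have [io _ _ _ _] := ch i.
have [cG _] := hG Dz.
have [r r0 hr] := curve_near cG co cz; have [s s0 hs] := curve_near cG io iz.
exists (Num.min r s); first by rewrite lt_min r0.
by move=> z'; rewrite lt_min => /andP[/hr h1 /hs h2].
Qed.

Lemma holo_chart_curve z i : D z -> cdom c (G z) -> cdom (atlas i) (G z) ->
  differentiable (cmap c \o G) z /\
  derive1 (cmap (atlas i) \o G) z =
    derive1 (cmap c \o G) z *m jacobian (transition c (atlas i)) (cmap c (G z)).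
Proof.
move=> Dz cz iz; have [_ _ ch _ _] := hX; have [_ _ iK _ _] := ch i.
have [[_ _ cK _ _] /(_ i)[tci tic]] := hc; have [_ /(_ i iz) di] := hG Dz.
have [r r0 hr] := transition_near Dz cz iz.
have dc : differentiable (cmap c \o G) z.
  have D1 := derive1_comp_row di (tic _ iz cz).
  apply: near_diff (dd_diff D1); exists r => // z' /hr[h1 h2].
  by rewrite /transition /= iK.
split; first exact: dc.
have D2 := derive1_comp_row dc (tci _ cz iz).
apply: dd_derive1; apply: (near_dd _ D2); exists r => // z' /hr[h1 h2].
by rewrite /transition /= cK.
Qed.

End ChartChange.

(** * Constancy of curves in a space form *)

Section LocalConstancy.
Variables (m n : nat) (M : hmanifold R m) (S : hmanifold R n).
Hypotheses (hM : is_complex_manifold M) (nashM : nash_kahler_potentials M) (hS : space_charts S).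
Variables (D : set C) (F : C -> S) (L : C -> M).
Hypotheses (Do : open D) (hF : holomorphic_curve D F) (hL : holomorphic_curve D L)
  (same : same_curve_pullback D F L).

Theorem curve_locally_constant z0 : D z0 ->
  exists2 r : R, 0 < r & forall z, nm (z - z0) < r -> F z = F z0.
Proof.
move=> Dz0; have [covS opS injS potS] := hS.
have [_ _ chM covM _] := hM.
have [i iz] := covS (F z0); have [j jz] := covM (L z0).
have [c [psi [hc cz _ kp [W [Psi [pol nash]]]]]] := nashM (L z0).
have [[co cio cK _ _] _] := hc.
have [alpha [b [beta [b0 qpos sgn hmet]]]] := potS i.
have [r1 r10 hr1] := (openCP D).1 Do _ Dz0.
have [cF _] := hF Dz0; have [r2 r20 hr2] := curve_near cF (opS i) iz.
have [r3 r30 hr3] := transition_near hM hL hc Dz0 cz jz.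
pose d := Num.min r1 (Num.min r2 r3).
have d0 : 0 < d by rewrite !lt_min r10 r20.
have hd z : nm (z - z0) < d -> [/\ D z, cdom (atlas i) (F z), cdom c (L z) & cdom (atlas j) (L z)].
  by rewrite !lt_min => /and3P[/hr1 h1 /hr2 h2 /hr3[h3 h4]].
pose Ls := cmap (atlas i) \o F; pose Lm := cmap c \o L.
have dLs z : nm (z - z0) < d -> differentiable Ls z.
  by move=> /hd[h1 h2 _ _]; have [_ H] := hF h1; exact: H.
have dLm z : nm (z - z0) < d -> differentiable Lm z.
  by move=> /hd[h1 h2 h3 h4]; exact: (holo_chart_curve hM hL hc h1 h3 h4).1.
have LmU z : nm (z - z0) < d -> cimage c (Lm z) by move=> /hd[_ _ h3 _]; exists (L z).
have LsU z : nm (z - z0) < d -> 0 < qnorm alpha beta (Ls z).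
  by move=> /hd[_ h2 _ _]; apply: qpos; exists (F z).
have eqp z : nm (z - z0) < d ->
    pull_form (derive1 Ls z) (ddbar (qpotential alpha b^-1 beta) (Ls z)) 0 0 =
    pull_form (derive1 Lm z) (ddbar psi (Lm z)) 0 0.
  (* The Nash potential lives in the chart [c], which need not belong to the atlas; the pullback is
     moved from the chart [j] to [c] by the chain rule. *)
  move=> /hd[h1 h2 h3 h4]; have := same h1 h2 h4; rewrite /curve_pullback hmet => ->.
  by rewrite (holo_chart_curve hM hL hc h1 h3 h4).2 pull_form_mul (kp j _ h3 h4).
have [d' d'0 hd'] := curve_rigidity cio pol nash b0 d0 dLs dLm LmU LsU eqp.
pose e := Num.min d d'; have e0 : 0 < e by rewrite lt_min d0.
have dz z : nm (z - z0) < e -> derive1 Ls z = 0.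
  rewrite lt_min => /andP[zd zd']; apply: (pull_form_definite b0 (LsU z zd) sgn).
  by rewrite eqp // hd'.
have zz : nm (z0 - z0) < e by rewrite subrr nm0.
have zz' : nm (z0 - z0) < d by rewrite subrr nm0.
exists e => // z ze; have [_ h0 _ _] := hd z0 zz'.
have zd : nm (z - z0) < d by move: ze; rewrite lt_min => /andP[].
have [_ h1 _ _] := hd z zd; apply: (injS i) => //.
apply/rowP => k.
have hk : @hol_ball R C (fun z => Ls z 0 k) z0 e.
  by move=> y ye; apply: dd_diff (derive1_coord k (dLs y _)); move: ye; rewrite lt_min => /andP[].
have K y : nm (y - z0) < e -> 'd (fun z => Ls z 0 k) y (z - z0) = 0.
  move=> ye; have yd : nm (y - z0) < d by move: ye; rewrite lt_min => /andP[].
  by rewrite (dd_val _ (derive1_coord k (dLs y yd))) dz // mxE mulr0.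
have := direction_constant hk K zz; rewrite [z0 + _]addrC subrK => /(_ ze).
exact.
Qed.

Theorem curve_constant : connected D -> forall z w, D z -> D w -> F z = F w.
Proof.
move=> Dc z w Dz Dw.
(* Local constancy makes both this fibre and its complement in [D] open, so connectedness
   applies. *)
have H : [set y | D y /\ F y = F z] = D.
  apply: Dc; first by exists z.
  - exists [set y | D y /\ F y = F z]; last by rewrite setIA setIid.
    apply/openCP => y [Dy Fy]; have [r r0 hr] := curve_locally_constant Dy.
    have [s s0 hs] := (openCP D).1 Do _ Dy.
    exists (Num.min r s); first by rewrite lt_min r0.
    by move=> y'; rewrite lt_min => /andP[/hr h1 /hs h2]; split=> //; rewrite h1.
  - exists (~` [set y | D y /\ F y <> F z]).
      apply: open_closedC; apply/openCP => y [Dy Fy]; have [r r0 hr] := curve_locally_constant Dy.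
      have [s s0 hs] := (openCP D).1 Do _ Dy.
      exists (Num.min r s); first by rewrite lt_min r0.
      by move=> y'; rewrite lt_min => /andP[/hr h1 /hs h2]; split=> //; rewrite h1.
    apply/seteqP; split=> [y [Dy Fy]|y [Dy /not_andP[//|/contrapT Fy]]] //=.
    by split=> // -[].
by have [] : [set y | D y /\ F y = F z] w by rewrite H.
Qed.

End LocalConstancy.

(** * Absence of common Kaehler submanifolds *)

Section NotRelatives.
Variables (m n : nat) (M : hmanifold R m) (S : hmanifold R n).
Hypotheses (hM : is_complex_manifold M) (nashM : nash_kahler_potentials M) (hS : space_charts S).

Section Disc.
Variables (k : nat) (Z : cmanifold R k) (i : atlas_index Z) (x0 e : 'rV[C]_k) (D : set C).
Hypotheses (hZ : is_complex_manifold Z) (Do : open D)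
  (line_in : forall t, D t -> cimage (atlas i) (x0 + t *: e)).

Let disc (t : C) : Z := cinv (atlas i) (x0 + t *: e).

Let disc_chart t : D t -> cdom (atlas i) (disc t) /\ cmap (atlas i) (disc t) = x0 + t *: e.
Proof.
have [_ _ ch _ _] := hZ; have [_ _ iK _ _] := ch i.
by move=> /line_in[p ip E]; rewrite /disc -E iK.
Qed.

Let disc_continuous t : D t -> {for t, continuous disc}.
Proof.
move=> Dt; have [_ _ ch _ _] := hZ; have [_ _ _ _ ci] := ch i.
have [id_ dE] := disc_chart Dt; have := ci _ id_; rewrite dE => c1.
have c2 : {for t, continuous (fun t : C => x0 + t *: e)}.
  exact: differentiable_continuous (dd_diff (ddD (dd_cst x0 t) (ddZl e (dd_id t)))).
exact: (continuous_comp c2 c1).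
Qed.

Variables (q : nat) (X : cmanifold R q) (h : Z -> X).
Hypothesis hh : holomorphic_immersion h.

Lemma disc_derive t j : D t -> cdom (atlas j) (h (disc t)) ->
  dd (cmap (atlas j) \o (h \o disc)) t
     (fun s : C => s *: (e *m jacobian (in_charts h i j) (cmap (atlas i) (disc t)))).
Proof.
move=> Dt jt; have [_ H] := hh; have [it dE] := disc_chart Dt; have [dh _] := H _ _ _ it jt.
rewrite dE in dh *.
have D1 : dd (fun t : C => x0 + t *: e) t (fun s : C => s *: e).
  by apply: dd_eq (ddD (dd_cst x0 t) (ddZl e (dd_id t))) _ => s; rewrite add0r.
apply: dd_eq (dd_comp D1 (ddP dh)) _ => s.
by rewrite (linearZZ ('d (in_charts h i j) _)) /jacobian mul_rV_lin1.
Qed.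

Lemma disc_curve : holomorphic_curve D (h \o disc).
Proof.
move=> t Dt; split; last by move=> j jt; exact: dd_diff (disc_derive Dt jt).
have [ch _] := hh; exact: (continuous_comp (disc_continuous Dt) (ch (disc t))).
Qed.

End Disc.

Theorem not_relatives : ~ relatives M S.
Proof.
move=> [k [Z [f [g [[k0 hZ] [p _] hf hg same]]]]].
have [_ _ chZ covZ _] := hZ; have [i ip] := covZ p; have [_ io iK _ _] := chZ i.
pose x0 := cmap (atlas i) p; pose e : 'rV[C]_k := basis_vec R (Ordinal k0).
(* A coordinate line through [p], over all parameters for which it stays in the chart. This set may
   be disconnected, so constancy is used only near 0. *)
pose D := [set t : C | cimage (atlas i) (x0 + t *: e)].
have Do : open D.
  apply: open_comp io => t _.
  exact: differentiable_continuous (dd_diff (ddD (dd_cst x0 t) (ddZl e (dd_id t)))).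
have line_in t : D t -> cimage (atlas i) (x0 + t *: e) by [].
pose disc t : Z := cinv (atlas i) (x0 + t *: e).
have D0 : D 0 by rewrite /D /= scale0r addr0; exists p.
have disc_in t : D t -> cdom (atlas i) (disc t) by move=> [y iy E]; rewrite /disc -E iK.
have hF := disc_curve hZ line_in hg; have hL := disc_curve hZ line_in hf.
have dF t l Dt lt := disc_derive (t := t) (j := l) hZ line_in hg Dt lt.
have dL t l Dt lt := disc_derive (t := t) (j := l) hZ line_in hf Dt lt.
have sp : same_curve_pullback D (g \o disc) (f \o disc).
  move=> t Dt l j lt jt; rewrite /curve_pullback (dd_derive1 (dF t l Dt lt)) (dd_derive1 (dL t j Dt jt)).
  by rewrite !pull_form_mul; have := same _ i j l (disc_in t Dt) jt lt; rewrite /induced_metric => ->.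
have [r r0 hr] := curve_locally_constant hM nashM hS Do hF hL sp D0.
have [covS _ _ _] := hS; have [l lt] := covS (g (disc 0)).
(* Constancy of the curve near 0 kills the nonzero vector [e], against the injectivity of the
   differential of the immersion [g]. *)
have J0 : e *m jacobian (in_charts g i l) (cmap (atlas i) (disc 0)) = 0.
  rewrite -(dd_derive1 (dF 0 l D0 lt)); apply: dd_derive1.
  have DC := dd_cst (cmap (atlas l) (g (disc 0))) (0 : C).
  apply: (near_dd _ (dd_eq DC _)); last by move=> s; rewrite scaler0.
  by exists r => // s /hr E; rewrite /= -[g (disc s)]/((g \o disc) s) E.
have [_ /(_ _ _ _ (disc_in 0 D0) lt)[_ free]] := hg.
move/eqP: J0; rewrite mulmx_free_eq0 // => /eqP/rowP/(_ (Ordinal k0)).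
by rewrite !mxE !eqxx => /eqP; rewrite oner_eq0.
Qed.

End NotRelatives.
End Curves.

Theorem theorem2p5 (R : realType) (m n : nat)
    (M : hmanifold R m) (Sb : hmanifold R n) :
  is_kahler M -> real_analytic_metric M -> nash_kahler_potentials M ->
  (1 <= n)%N -> complex_space_form Sb ->
  (forall (D : set (Cplx R)) (F : Cplx R -> Sb) (L : Cplx R -> M),
     open D -> connected D ->
     holomorphic_curve D F -> holomorphic_curve D L ->
     same_curve_pullback D F L ->
     forall z w, D z -> D w -> F z = F w) /\
  ~ relatives M Sb.
Proof.
move=> [hM _ _ _ _] _ nashM _ /space_form_charts hS; split.
  by move=> D F L Do Dc hF hL same; exact: (curve_constant hM nashM hS Do hF hL same Dc).
exact: not_relatives.
Qed.
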